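(* Let $p\in(1,\infty)$, and let $m\ge2$ be an integer. If a closed curve $\gamma\in W^{2,p}_{\rm imm}(\mathbf{T}^1;\mathbb{R}^2)$ has a point of multiplicity $m$, then $$\overline{\mathcal{B}}_p[\gamma]\ge\varpi_p^*\,m^p.$$ Equality is attained if and only if $\gamma$ is a closed $m$-leafed $p$-elastica.
   Context: $\mathbf{T}^1=\mathbb{R}/\mathbb{Z}$. $W^{2,p}_{\rm imm}(0,1;\mathbb{R}^2)$ and $W^{2,p}_{\rm imm}(\mathbf{T}^1;\mathbb{R}^2)$ denote the $W^{2,p}$ maps from $(0,1)$, resp. $\mathbf{T}^1$, to $\mathbb{R}^2$ with nowhere vanishing derivative (on $[0,1]$, resp. $\mathbf{T}^1$). $\mathcal{B}_p[\gamma]=\int_\gamma|k|^p\,ds$, $\mathcal{L}[\gamma]=\int_\gamma ds$, $\overline{\mathcal{B}}_p[\gamma]=\mathcal{L}[\gamma]^{p-1}\mathcal{B}_p[\gamma]$ ($k$ signed curvature, $s$ arclength). $\gamma$ has a point $P\in\mathbb{R}^2$ of multiplicity $m$ if $\gamma^{-1}(P)$ contains at least $m$ distinct points. For $q\in[0,1)$, $x\in\mathbb{R}$: $\mathrm{F}_{1,p}(x,q)=\int_0^x\frac{|\cos\theta|^{1-2/p}}{\sqrt{1-q^2\sin^2\theta}}d\theta$, $\mathrm{E}_{1,p}(x,q)=\int_0^x\sqrt{1-q^2\sin^2\theta}\,|\cos\theta|^{1-2/p}d\theta$, $\mathrm{K}_{1,p}(q)=\mathrm{F}_{1,p}(\pi/2,q)$,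 $\mathrm{E}_{1,p}(q)=\mathrm{E}_{1,p}(\pi/2,q)$; $\mathrm{am}_{1,p}(\cdot,q)$ is the inverse function of $\mathrm{F}_{1,p}(\cdot,q)$; $\mathrm{cn}_p(s,q)=|\cos\mathrm{am}_{1,p}(s,q)|^{\frac2p-1}\cos\mathrm{am}_{1,p}(s,q)$ (value $0$ where the cosine vanishes; also $|x|^{p-2}x:=0$ at $x=0$). $q^*(p)\in(0,1)$ is the unique solution of $2\mathrm{E}_{1,p}(q)=\mathrm{K}_{1,p}(q)$. For $q\in(0,1)$, $\gamma_w(s,q)=\big(2\mathrm{E}_{1,p}(\mathrm{am}_{1,p}(s,q),q)-s,\,-q\frac p{p-1}|\mathrm{cn}_p(s,q)|^{p-2}\mathrm{cn}_p(s,q)\big)$. A half-fold figure-eight $p$-elastica is a curve that, up to similarity (translation, rotation, reflection, dilation) and reparameterization, is $s\mapsto\gamma_w(s-\mathrm{K}_{1,p}(q^* ),q^* )$, $s\in[0,2\mathrm{K}_{1,p}(q^* )]$, $q^*=q^*(p)$. $\varpi_p^*>0$ is the value of $\overline{\mathcal{B}}_p$ on a half-fold figure-eight $p$-elastica; explicitly $\varpi_p^*=2^{3p-1}(q^* )^{p-2}(2(q^* )^2-1)\mathrm{E}_{1,p}(q^* )^p$. An $m$-leafed $p$-elastica is a curve $\gamma\in W^{2,p}_{\rm imm}(0,1;\mathbb{R}^2)$ for which there are $0=a_0<a_1<\dots<a_m=1$ such that each $\gamma_i=\gamma|_{[a_{i-1},a_i]}$ is a half-fold figure-eight $p$-elastica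 and $\mathcal{L}[\gamma_1]=\dots=\mathcal{L}[\gamma_m]$. A curve $\gamma\in W^{2,p}_{\rm imm}(\mathbf{T}^1;\mathbb{R}^2)$ is a closed $m$-leafed $p$-elastica if for some $t_0\in\mathbf{T}^1$ the curve $[0,1]\ni t\mapsto\gamma(t+t_0)$ is an $m$-leafed $p$-elastica. *)

(* Defs.v *)
From HB Require Import structures.
From mathcomp Require Export all_boot all_order all_algebra.
From mathcomp Require Export all_classical all_reals all_analysis.
Export Order.TTheory GRing.Theory Num.Theory.
Export numFieldNormedType.Exports.

Set Implicit Arguments.
Unset Strict Implicit.
Unset Printing Implicit Defensive.

Local Open Scope classical_set_scope.
Local Open Scope ring_scope.
Local Notation "f ^` ()" := (derive1 f) : ring_scope.

Section Sobolev.
Context {R : realType}.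
Implicit Types (a b p : R) (u v : R -> R).
Local Notation mu := (@lebesgue_measure R).

Definition Lp_on p a b u : Prop :=
  measurable_fun `]a, b[ u /\
  (\int[mu]_(x in `]a, b[) ((`|u x| `^ p)%:E) < +oo)%E.

(* C^1 functions with compact support in ]a, b[, the usual test functions for
   Sobolev spaces on an interval. *)
Definition test_fun a b u : Prop :=
  [/\ forall x, derivable u x 1,
      continuous u^`() &
      exists c d, [/\ a < c, d < b & forall x, x \notin `[c, d] -> u x = 0]].

Definition weak_derivative a b u v : Prop :=
  forall phi, test_fun a b phi ->
    \int[mu]_(x in `]a, b[) (u x * phi^`() x) =
    - \int[mu]_(x in `]a, b[) (v x * phi x).

Definition W2p p a b u : Prop :=
  exists v w, [/\ Lp_on p a b u, Lp_on p a b v, Lp_on p a b w,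
                  weak_derivative a b u v & weak_derivative a b v w].

End Sobolev.

Section Curves.
Context {R : realType}.
Implicit Types (a b p : R) (g : R -> R * R).
Local Notation mu := (@lebesgue_measure R).

Definition crd1 g : R -> R := fun t => (g t).1.
Definition crd2 g : R -> R := fun t => (g t).2.

(* W^{2,p} immersions of (a, b). An element of W^{2,p} is represented by its
   continuous representative on [a, b] (which is C^1 up to the boundary);
   values outside [a, b] are irrelevant. (v1, v2) is the continuous extension
   to [a, b] of the derivative. *)
Definition W2p_imm p a b g : Prop :=
  [/\ {within `[a, b], continuous (crd1 g)},
      {within `[a, b], continuous (crd2 g)},
      W2p p a b (crd1 g), W2p p a b (crd2 g) &
      exists v1 v2 : R -> R,
        [/\ {within `[a, b], continuous v1},
            {within `[a, b], continuous v2},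
            forall t, t \in `]a, b[ -> is_derive t 1 (crd1 g) (v1 t),
            forall t, t \in `]a, b[ -> is_derive t 1 (crd2 g) (v2 t) &
            forall t, t \in `[a, b] -> (v1 t, v2 t) != (0, 0)]].

(* Maps on T^1 = R/Z are represented by their 1-periodic lifts to R. *)
Definition W2p_imm_T1 p g : Prop :=
  (forall t, g (t + 1) = g t) /\
  (forall a b, a < b -> W2p_imm p a b g).

Definition speed g (t : R) : R :=
  Num.sqrt ((crd1 g)^`() t ^+ 2 + (crd2 g)^`() t ^+ 2).

(* The derivatives are pointwise ones: for a W^{2,p} curve g' is absolutely
   continuous, hence differentiable almost everywhere, and its pointwise
   derivative is the weak second derivative. *)
Definition curvature g (t : R) : R :=
  ((crd1 g)^`() t * (crd2 g)^`()^`() t - (crd2 g)^`() t * (crd1 g)^`()^`() t)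
  / speed g t ^+ 3.

Definition curve_length a b g : R := \int[mu]_(t in `]a, b[) speed g t.

Definition bending p a b g : R :=
  \int[mu]_(t in `]a, b[) (`|curvature g t| `^ p * speed g t).

Definition nbending p a b g : R :=
  curve_length a b g `^ (p - 1) * bending p a b g.

(* Parameters in [0, 1[ are the points of T^1. *)
Definition has_point_of_multiplicity_T1 g (P : R * R) (m : nat) : Prop :=
  exists t : 'I_m -> R,
    [/\ injective t, forall i, t i \in `[0, 1[ & forall i, g (t i) = P].

End Curves.

Section Elastica.
Context {R : realType}.
Implicit Types (p q s x : R).
Local Notation mu := (@lebesgue_measure R).

Definition oriented_integral (f : R -> R) x : R :=
  if 0 <= x then \int[mu]_(t in `[0, x]) f t
  else - \int[mu]_(t in `[x, 0]) f t.

(* powR sends 0 to 0 for a negative exponent; this only affects the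
   null set of zeros of cos. *)
Definition F1 p x q : R :=
  oriented_integral
    (fun th => `|cos th| `^ (1 - 2 / p) / Num.sqrt (1 - q ^+ 2 * sin th ^+ 2)) x.

Definition E1 p x q : R :=
  oriented_integral
    (fun th => Num.sqrt (1 - q ^+ 2 * sin th ^+ 2) * `|cos th| `^ (1 - 2 / p)) x.

Definition K1c p q : R := F1 p (pi / 2) q.
Definition E1c p q : R := E1 p (pi / 2) q.

(* The inverse function of F1 p ^~ q, which is a bijection of R. *)
Definition am1 p s q : R := xget 0 [set x | F1 p x q = s].

Definition cnp p s q : R :=
  `|cos (am1 p s q)| `^ (2 / p - 1) * cos (am1 p s q).

Definition gamma_w p s q : R * R :=
  (2 * E1 p (am1 p s q) q - s,
   - q * (p / (p - 1)) * (`|cnp p s q| `^ (p - 2) * cnp p s q)).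

(* The unique q in (0, 1) with 2 E = K. *)
Definition qstar p : R :=
  xget 0 [set q | 0 < q < 1 /\ 2 * E1c p q = K1c p q].

Definition figure_eight_end p : R := 2 * K1c p (qstar p).

Definition figure_eight p s : R * R :=
  gamma_w p (s - K1c p (qstar p)) (qstar p).

(* The value of the normalized p-bending energy on the model curve; it equals
   2^(3p-1) q^(p-2) (2 q^2 - 1) (E1c p q)^p with q = qstar p. *)
Definition varpi p : R := nbending p 0 (figure_eight_end p) (figure_eight p).

(* Dilation by l, rotation by th, translation by c, composed with a
   reflection when sg is true. *)
Definition similarity (l th : R) (sg : bool) (c z : R * R) : R * R :=
  let y := (-1) ^+ sg * z.2 in
  (c.1 + l * (cos th * z.1 - sin th * y),
   c.2 + l * (sin th * z.1 + cos th * y)).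

(* A homeomorphism from [a, b] onto [c, d]; orientation reversal is allowed. *)
Definition reparam (a b c d : R) (phi : R -> R) : Prop :=
  {within `[a, b], continuous phi} /\ set_bij `[a, b] `[c, d] phi.

Definition half_fold_figure_eight p (a b : R) (g : R -> R * R) : Prop :=
  exists l th sg c phi,
    [/\ 0 < l, reparam a b 0 (figure_eight_end p) phi &
        forall t, t \in `[a, b] ->
          g t = similarity l th sg c (figure_eight p (phi t))].

Definition leafed p (m : nat) (g : R -> R * R) : Prop :=
  W2p_imm p 0 1 g /\
  exists a : nat -> R,
    [/\ a 0%N = 0, a m = 1,
        forall i, (i < m)%N -> a i < a i.+1,
        forall i, (i < m)%N -> half_fold_figure_eight p (a i) (a i.+1) g &
        forall i j, (i < m)%N -> (j < m)%N ->
          curve_length (a i) (a i.+1) g = curve_length (a j) (a j.+1) g].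

Definition closed_leafed p (m : nat) (g : R -> R * R) : Prop :=
  W2p_imm_T1 p g /\ exists t0 : R, leafed p m (fun t => g (t + t0)).

End Elastica.

(* Main.v *)
(** Write a loop of length [l] with speed [v], tangent angle [th] and [k = th'], so
    that its bending is the integral of [|k|^p v^(1-p)]. Let [m] be the midpoint and
    [B] the half-length of the range of [th]. Closedness gives
    [int v cos (th - m) = 0], which forces [B > pi/2]. Put [A = - cos B = 2 q^2 - 1]
    (with [B] cut off at [pi]), where [q = sin (B/2)]. By Young's inequality, for every
    [c > 0],
      [|k|^p v^(1-p) >= p c^(1-1/p) (cos (th-m) + A)_+^(1-1/p) |k|
                        - (p-1) c (cos (th-m) + A) v].
    The first term integrates to at least the oscillation of a potential of
    [(cos + A)_+^(1-1/p)] over [-B, B], the second one to [(p-1) c A l]. The best [c]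
    yields a bound on the normalized energy depending on [q] only. This bound is
    minimal exactly at [q = qstar p], because the integrand is log-convex in [ln q^2]
    and the derivative of the bound vanishes there by [2 E = K]. Equality forces
    [|k| = v (c (cos (th-m) + A))^(1/p)], the equation of the figure-eight.

    A curve with a point of multiplicity [n] is cut there into [n] loops, and the
    convexity of [x^(1-p)] combines the energies of the loops; equality forces them
    all to have the same length and to be figure-eights. *)

Require Import Defs.
From HB Require Import structures.
From mathcomp Require Import measurable_realfun.
From mathcomp Require Import ring lra.

Set Implicit Arguments.
Unset Strict Implicit.
Unset Printing Implicit Defensive.

Local Open Scope classical_set_scope.
Local Open Scope ring_scope.

(** * Absolutely continuous functions *)

(** The Young inequality is a calibration. On a wavelike p-elastica
    [|k|^p / (v^p (cos (th - m) + A))] is a constant [c], the first integral of its equation, and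
    the inequality with this [c] is sharp there. The amplitude [x] with [th = 2 asin (q sin x)]
    turns [cos th + A] into [2 q^2 cos^2 x], which is how the elliptic integrals enter. Three
    obstacles shape the proof. A W^{2,p} curve has weak second derivatives only, and its pointwise
    curvature is controlled almost everywhere: the calculus is done on the relation [AC], a function
    together with an integrable density. The exponent [1 - 2 / p] is negative for [p < 2], and the
    densities of [F1] and [E1] then blow up where the cosine vanishes. Finally, the equality
    equation is not Lipschitz where [cos (th - m) = - A], so a solution might rest at its extreme
    angles. This is excluded because [c] is fixed by the length, and crossing the open range of
    angles already uses up all of it. *)

Lemma is_derive_of_derive1 {R : realType} (f : R -> R) (x a : R) :
  derivable f x 1 -> f^`()%classic x = a -> is_derive x 1 f a.
Proof. by move=> df <-; rewrite derive1E; exact: derivableP. Qed.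

Section AbsolutelyContinuous.
Context {R : realType}.
Implicit Types (a b c d s t : R) (f g w h : R -> R).
Local Notation mu := (@lebesgue_measure R).

Lemma integrable_subitv a b c d f : a <= c -> d <= b ->
  mu.-integrable `[a, b] (EFin \o f) -> mu.-integrable `[c, d] (EFin \o f).
Proof.
move=> ac db; apply: integrableS => //.
by apply: subset_itv; rewrite bnd_simp.
Qed.

Lemma Rintegral_itv_cat a b c f : a <= b -> b <= c ->
  mu.-integrable `[a, c] (EFin \o f) ->
  \int[mu]_(x in `[a, c]) f x =
  \int[mu]_(x in `[a, b]) f x + \int[mu]_(x in `[b, c]) f x.
Proof.
move=> ab bc fi.
have := @Rintegral_itvB _ f (BLeft a) (BRight c) b fi.
rewrite !bnd_simp => /(_ ab bc).
rewrite (Rintegral_itv_obnd_cbnd (b := BRight c)); first by move=> <-; rewrite subrKC.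
by apply: integrableS fi => //; apply: subset_itv; rewrite bnd_simp.
Qed.

Lemma within_continuous_subitv a b c d f : a <= c -> d <= b ->
  {within `[a, b], continuous f} -> {within `[c, d], continuous f}.
Proof.
move=> ac db; apply: continuous_subspaceW.
by apply: subset_itv; rewrite bnd_simp.
Qed.

Lemma continuous_itv_integrable a b f : {within `[a, b], continuous f} ->
  mu.-integrable `[a, b] (EFin \o f).
Proof. by move=> cf; apply: continuous_compact_integrable => //; exact: segment_compact. Qed.

Lemma continuous_itv_bounded a b f : {within `[a, b], continuous f} ->
  exists M, 0 < M /\ forall t, t \in `[a, b] -> `|f t| <= M.
Proof.
move=> cf; have [ab|ba] := leP a b; last first.
  by exists 1; split=> // t; rewrite in_itv/= => /andP[at_ tb]; have := le_lt_trans (le_trans at_ tb) ba; rewrite ltxx.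
have cn : {within `[a, b], continuous (fun x => `|f x|)}.
  by apply: within_continuous_comp => // x _; exact: norm_continuous.
have [c cab cmax] := EVT_max ab cn.
exists (`|f c| + 1); split; first by rewrite ltr_wpDl.
by move=> t /cmax /le_trans; apply; rewrite lerDl.
Qed.

Lemma within_continuous_eps a b f t : {within `[a, b], continuous f} ->
  t \in `[a, b] -> forall e, 0 < e ->
  exists d, 0 < d /\ forall s, s \in `[a, b] -> `|s - t| < d -> `|f s - f t| < e.
Proof.
move=> /subspace_continuousP cf tab e e0.
have /cvgrPdist_lt/(_ _ e0) := cf t tab.
rewrite near_withinE => -[d /= d0 H].
exists d; split=> // s sab st; rewrite distrC; apply: H => //=.
by rewrite distrC.
Qed.

Lemma within_continuous_epsP a b f :
  (forall t, t \in `[a, b] -> forall e, 0 < e ->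
    exists d, 0 < d /\
      forall s, s \in `[a, b] -> `|s - t| < d -> `|f s - f t| <= e) ->
  {within `[a, b], continuous f}.
Proof.
move=> H; apply/subspace_continuousP => t tab.
apply/cvgrPdist_le => e e0.
have [d [d0 Hd]] := H t tab e e0.
rewrite near_withinE; exists d => //= s ts sab.
by rewrite distrC; apply: Hd => //; rewrite distrC.
Qed.

(** Continuous induction: the supremum of the points reached from [a] is itself reached, and passed
    unless it is [b]. The size [d] of the local steps may depend on the point [t]. *)
Lemma cousin a b (P : R -> R -> Prop) : a <= b ->
  (forall s t u, P s t -> P t u -> P s u) ->
  (forall t, t \in `[a, b] -> exists d, 0 < d /\
     forall s u, a <= s -> s <= t -> t <= u -> u <= b -> t - s < d -> u - t < d ->
     P s u) ->
  P a b.
Proof.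
move=> ab Ptr Ploc.
pose S := [set x | a <= x <= b /\ P a x].
have Sa : S a.
  split; first by rewrite lexx.
  have [|d [d0]] := Ploc a; first by rewrite in_itv/= lexx.
  by apply; rewrite ?subrr.
have hS : has_sup S.
  by split; [exists a | exists b => x [/andP[]]].
pose c := sup S.
have ac : a <= c by apply: (ub_le_sup hS.2).
have cb : c <= b by apply: (ge_sup hS.1) => x [/andP[]].
have cab : c \in `[a, b] by rewrite in_itv/= ac cb.
have [d [d0 Hd]] := Ploc c cab.
have [x Sx cx] := sup_adherent d0 hS.
have xc : x <= c by apply: (ub_le_sup hS.2).
case: (Sx) => /andP[ax xb] Pax.
have step u : c <= u -> u <= b -> u - c < d -> P a u.
  move=> cu ub uc; apply: (Ptr _ _ _ Pax); apply: Hd => //.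
  by rewrite ltrBlDr -ltrBlDl.
have [->|cltb] : b = c \/ c < b.
  by move: cb; rewrite le_eqVlt => /predU1P[->|]; [left|right].
- by apply: step; rewrite ?subrr.
- pose u := Num.min b (c + d / 2).
  have cu : c < u by rewrite lt_min cltb ltrDl divr_gt0.
  have Su : S u.
    split; first by rewrite (le_trans ac (ltW cu)) ge_min lexx.
    apply: step; rewrite ?(ltW cu) ?ge_min ?lexx//.
    by rewrite ltrBlDl gt_min ltrD2l gtr_pMr// invf_lt1// ltr1n orbT.
  by have := ub_le_sup hS.2 Su; rewrite leNgt -/c cu.
Qed.

(** Absolute continuity with the density as a datum: the product and chain rules below compute
    densities, without pointwise differentiation. *)
Definition AC a b f w := mu.-integrable `[a, b] (EFin \o w) /\
  forall t, t \in `[a, b] -> f t = f a + \int[mu]_(x in `[a, t]) w x.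

Lemma AC_sub a b f w s t : AC a b f w -> a <= s -> s <= t -> t <= b ->
  f t - f s = \int[mu]_(x in `[s, t]) w x.
Proof.
move=> [wi fE] as_ st tb.
have at_ := le_trans as_ st; have sb := le_trans st tb.
rewrite (fE t) ?in_itv/= ?at_// (fE s) ?in_itv/= ?as_//.
rewrite (Rintegral_itv_cat as_ st); last exact: (integrable_subitv _ tb wi).
by ring.
Qed.

Lemma AC_subitv a b c d f w : a <= c -> c <= d -> d <= b ->
  AC a b f w -> AC c d f w.
Proof.
move=> ac cd db H; split; first exact: integrable_subitv ac db H.1.
move=> t; rewrite in_itv/= => /andP[ct td].
by rewrite -(AC_sub H) ?(le_trans td)// subrKC.
Qed.

Lemma AC_continuous a b f w : a <= b -> AC a b f w -> {within `[a, b], continuous f}.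
Proof.
move=> ab [wi fE].
apply: (@subspace_eq_continuous _ _ _ (fun t => f a + \int[mu]_(x in `[a, t]) w x)).
  by move=> t; rewrite inE/= => tab; rewrite -fE.
apply: within_continuousD; first by move=> x; exact: cst_continuous.
exact: parameterized_integral_continuous.
Qed.

Lemma eq_AC a b f g w h : {in `[a, b], f =1 g} -> {in `[a, b], w =1 h} ->
  AC a b f w -> AC a b g h.
Proof.
move=> fg wh [wi fE]; split.
  apply: eq_integrable wi => // t; rewrite inE => tab /=.
  by rewrite wh.
move=> t tab; move: (tab); rewrite in_itv/= => /andP[at_ tb].
have aab : a \in `[a, b] by rewrite in_itv/= lexx (le_trans at_ tb).
rewrite -!fg// fE//; congr (_ + _); apply: eq_Rintegral => x.
rewrite inE/= in_itv/= => /andP[ax xt]; apply: wh.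
by rewrite in_itv/= ax (le_trans xt tb).
Qed.

(** The error is measured by [e] times the mass of a fixed majorant [h], which is additive in the
    interval. So [cousin] sums the local estimates to [e] times the integral of [h] over [[a, t]],
    and [e] is arbitrary. *)
Lemma AC_intro a b f w h : a <= b ->
  mu.-integrable `[a, b] (EFin \o w) -> mu.-integrable `[a, b] (EFin \o h) ->
  (forall t, t \in `[a, b] -> forall e, 0 < e -> exists d, 0 < d /\
     forall s u, a <= s -> s <= t -> t <= u -> u <= b -> t - s < d -> u - t < d ->
     `|f u - f s - \int[mu]_(x in `[s, u]) w x| <=
     e * \int[mu]_(x in `[s, u]) h x) ->
  AC a b f w.
Proof.
move=> ab wi hi H; split=> // t; rewrite in_itv/= => /andP[at_ tb].
pose D s u := f u - f s - \int[mu]_(x in `[s, u]) w x.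
have De e : 0 < e -> `|D a t| <= e * \int[mu]_(x in `[a, t]) h x.
  move=> e0.
  pose P s u := a <= s /\ u <= b -> s <= u ->
    `|D s u| <= e * \int[mu]_(x in `[s, u]) h x.
  suff [_ +] : a <= t /\ P a t by apply.
  apply: (@cousin a t (fun s u => s <= u /\ P s u)) => //.
  - move=> s m u [sm Psm] [mu_ Pmu]; split; first exact: le_trans mu_.
    move=> [as_ ub] su.
    have am := le_trans as_ sm; have mb := le_trans mu_ ub.
    rewrite /D (Rintegral_itv_cat sm mu_); last exact: integrable_subitv wi.
    rewrite (Rintegral_itv_cat sm mu_); last exact: integrable_subitv hi.
    rewrite mulrDr.
    rewrite (_ : _ - _ = D s m + D m u); last by rewrite /D; ring.
    by apply: le_trans (ler_normD _ _) _; apply: lerD; [exact: Psm|exact: Pmu].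
  - move=> x; rewrite in_itv/= => /andP[ax xt].
    have [|d [d0 Hd]] := H x _ e e0.
      by rewrite in_itv/= ax (le_trans xt tb).
    exists d; split=> // s u as_ sx xu ut xs ux; split; first exact: le_trans xu.
    by move=> _ _; apply: Hd => //; exact: le_trans ut tb.
have D0 : D a t = 0.
  apply/eqP; rewrite -normr_le0; apply/ler_addgt0Pr => e e0; rewrite add0r.
  set I := \int[mu]_(x in `[a, t]) h x in De.
  have : 0 < `|I| + 1 by rewrite ltr_wpDl.
  move=> I1; apply: le_trans (De (e / (`|I| + 1)) _) _; first by rewrite divr_gt0.
  rewrite -mulrA ger_pMr// mulrC ler_pdivrMr// mul1r.
  by rewrite (le_trans (ler_norm I))// lerDl.
by move: D0; rewrite /D => /eqP; rewrite subr_eq0 => /eqP <-; rewrite subrKC.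
Qed.

Lemma continuous_itv_measurable a b f : {within `[a, b], continuous f} ->
  measurable_fun `[a, b] f.
Proof. by move=> cf; exact: (subspace_continuous_measurable_fun (measurable_itv _)). Qed.

Lemma integrable_mul_continuous a b f w : {within `[a, b], continuous f} ->
  mu.-integrable `[a, b] (EFin \o w) ->
  mu.-integrable `[a, b] (EFin \o (fun x => f x * w x)).
Proof.
move=> cf wi.
have -> : (EFin \o (fun x => f x * w x)) = ((EFin \o f) \* (EFin \o w))%E.
  by apply/funext => x /=; rewrite EFinM.
apply: integrableMr => //; first exact: continuous_itv_measurable.
have [M [M0 HM]] := continuous_itv_bounded cf.
exists M; split; first by rewrite gtr0_real.
by move=> x Mx t tab /=; apply: le_trans (ltW Mx); exact: HM.
Qed.

Lemma integrableDR a b f g :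
  mu.-integrable `[a, b] (EFin \o f) -> mu.-integrable `[a, b] (EFin \o g) ->
  mu.-integrable `[a, b] (EFin \o (fun x => f x + g x)).
Proof.
move=> fi gi.
have -> : (EFin \o (fun x => f x + g x)) = ((EFin \o f) \+ (EFin \o g))%E.
  by apply/funext => x /=; rewrite EFinD.
exact: integrableD.
Qed.

Lemma integrableBR a b f g :
  mu.-integrable `[a, b] (EFin \o f) -> mu.-integrable `[a, b] (EFin \o g) ->
  mu.-integrable `[a, b] (EFin \o (fun x => f x - g x)).
Proof.
move=> fi gi.
have -> : (EFin \o (fun x => f x - g x)) = ((EFin \o f) \- (EFin \o g))%E.
  by apply/funext => x /=; rewrite EFinB.
exact: integrableB.
Qed.

Lemma integrableZR a b k f :
  mu.-integrable `[a, b] (EFin \o f) ->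
  mu.-integrable `[a, b] (EFin \o (fun x => k * f x)).
Proof.
move=> fi.
have -> : (EFin \o (fun x => k * f x)) = (fun x => k%:E * (EFin \o f) x)%E.
  by apply/funext => x /=; rewrite EFinM.
exact: integrableZl.
Qed.

Lemma Rintegral_itvZ a b k f : mu.-integrable `[a, b] (EFin \o f) ->
  \int[mu]_(x in `[a, b]) (k * f x) = k * \int[mu]_(x in `[a, b]) f x.
Proof. by move=> fi; rewrite RintegralZl. Qed.

Lemma Rintegral_itvD a b f g : mu.-integrable `[a, b] (EFin \o f) ->
  mu.-integrable `[a, b] (EFin \o g) ->
  \int[mu]_(x in `[a, b]) (f x + g x) =
  \int[mu]_(x in `[a, b]) f x + \int[mu]_(x in `[a, b]) g x.
Proof. by move=> fi gi; rewrite RintegralD. Qed.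

Lemma Rintegral_itvB_fun a b f g : mu.-integrable `[a, b] (EFin \o f) ->
  mu.-integrable `[a, b] (EFin \o g) ->
  \int[mu]_(x in `[a, b]) (f x - g x) =
  \int[mu]_(x in `[a, b]) f x - \int[mu]_(x in `[a, b]) g x.
Proof. by move=> fi gi; rewrite RintegralB. Qed.

Lemma Rintegral_itv_cst a b k : a <= b ->
  \int[mu]_(x in `[a, b]) k = k * (b - a).
Proof.
move=> ab; rewrite Rintegral_cst//; congr (_ * _).
rewrite /= lebesgue_measure_itv/= lte_fin; move: ab; rewrite le_eqVlt.
by move=> /predU1P[->|->]; rewrite ?ltxx ?subrr// -EFinD.
Qed.

Lemma le_Rintegral_itv a b f g : mu.-integrable `[a, b] (EFin \o f) ->
  mu.-integrable `[a, b] (EFin \o g) ->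
  (forall x, x \in `[a, b] -> f x <= g x) ->
  \int[mu]_(x in `[a, b]) f x <= \int[mu]_(x in `[a, b]) g x.
Proof. by move=> fi gi fg; apply: le_Rintegral. Qed.

Lemma Rintegral_error s u w k (e : R) h :
  mu.-integrable `[s, u] (EFin \o (fun x => k x * w x)) ->
  mu.-integrable `[s, u] (EFin \o w) ->
  mu.-integrable `[s, u] (EFin \o h) ->
  forall k0, (forall x, x \in `[s, u] -> `|k0 - k x| <= e) ->
  (forall x, x \in `[s, u] -> `|w x| <= h x) ->
  `|k0 * \int[mu]_(x in `[s, u]) w x - \int[mu]_(x in `[s, u]) (k x * w x)| <=
    e * \int[mu]_(x in `[s, u]) h x.
Proof.
move=> kwi wi hi k0 Hk wh.
have k0wi := integrableZR k0 wi.
rewrite -(Rintegral_itvZ _ wi) -Rintegral_itvB_fun//.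
apply: le_trans (le_normr_Rintegral _ (integrableBR k0wi kwi)) _ => //.
rewrite -(Rintegral_itvZ _ hi); apply: le_Rintegral_itv => //.
- exact: (integrable_norm (integrableBR k0wi kwi)).
- exact: (integrableZR e hi).
move=> x xsu /=; rewrite -mulrBl normrM ler_pM//; first exact: Hk.
exact: wh.
Qed.

(** Common source of the product rule and the chain rule: an increment of [f] combines increments of
    the primitives of [w1] and [w2], with coefficients taken somewhere in the interval. Continuity
    freezes these coefficients near [t], up to [e] against the majorant [|w1| + |w2|]. *)
Lemma AC_intro2 a b f (k1 w1 k2 w2 : R -> R) : a <= b ->
  {within `[a, b], continuous k1} -> {within `[a, b], continuous k2} ->
  mu.-integrable `[a, b] (EFin \o w1) -> mu.-integrable `[a, b] (EFin \o w2) ->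
  (forall s u, a <= s -> s <= u -> u <= b -> exists x y,
     [/\ x \in `[s, u], y \in `[s, u] &
     f u - f s = k1 x * \int[mu]_(x in `[s, u]) w1 x +
                 k2 y * \int[mu]_(x in `[s, u]) w2 x]) ->
  AC a b f (fun x => k1 x * w1 x + k2 x * w2 x).
Proof.
move=> ab ck1 ck2 w1i w2i H.
have kw1 := integrable_mul_continuous ck1 w1i.
have kw2 := integrable_mul_continuous ck2 w2i.
have n1 := integrable_norm w1i.
have n2 := integrable_norm w2i.
apply: (@AC_intro _ _ _ _ (fun x => `|w1 x| + `|w2 x|)) => //.
- exact: integrableDR.
- exact: integrableDR.
move=> t tab e e0.
have e2 : 0 < e / 2 by rewrite divr_gt0.
have [d1 [d10 H1]] := within_continuous_eps ck1 tab e2.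
have [d2 [d20 H2]] := within_continuous_eps ck2 tab e2.
exists (Num.min d1 d2); split; first by rewrite lt_min d10.
move=> s u as_ st tu ub.
rewrite !lt_min => /andP[ts1 ts2] /andP[ut1 ut2].
have [x [y [xsu ysu ->]]] := H s u as_ (le_trans st tu) ub.
have close d z : t - s < d -> u - t < d -> z \in `[s, u] -> z \in `[a, b] /\ `|z - t| < d.
  move=> tsd utd; rewrite !in_itv/= => /andP[sz zu]; split; first by apply/andP; split; lra.
  by rewrite ltr_norml; apply/andP; split; lra.
have sub f0 := @integrable_subitv a b s u f0 as_ ub.
rewrite Rintegral_itvD; [|exact: sub|exact: sub].
rewrite [X in X <= _](_ : _ = `|(k1 x * \int[mu]_(x in `[s, u]) w1 x - \int[mu]_(x in `[s, u]) (k1 x * w1 x)) +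
  (k2 y * \int[mu]_(x in `[s, u]) w2 x - \int[mu]_(x in `[s, u]) (k2 x * w2 x))|); last by congr `|_|; ring.
apply: le_trans (ler_normD _ _) _.
rewrite (Rintegral_itvD (sub _ n1) (sub _ n2)) mulrDr; apply: lerD.
- apply: Rintegral_error; [exact: sub|exact: sub|exact: (sub _ n1)| |by []].
  move=> z zsu.
  have [za zt] := close d1 z ts1 ut1 zsu; have [xa xt] := close d1 x ts1 ut1 xsu.
  rewrite (_ : _ - _ = (k1 x - k1 t) - (k1 z - k1 t)); last by ring.
  apply: le_trans (ler_normB _ _) _.
  by rewrite (splitr e) lerD// ltW// H1.
- apply: Rintegral_error; [exact: sub|exact: sub|exact: (sub _ n2)| |by []].
  move=> z zsu.
  have [za zt] := close d2 z ts2 ut2 zsu; have [xa xt] := close d2 y ts2 ut2 ysu.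
  rewrite (_ : _ - _ = (k2 y - k2 t) - (k2 z - k2 t)); last by ring.
  apply: le_trans (ler_normB _ _) _.
  by rewrite (splitr e) lerD// ltW// H2.
Qed.

Lemma AC_mul a b (f1 w1 f2 w2 : R -> R) : a <= b -> AC a b f1 w1 -> AC a b f2 w2 ->
  AC a b (fun x => f1 x * f2 x) (fun x => f1 x * w2 x + f2 x * w1 x).
Proof.
move=> ab A1 A2.
apply: AC_intro2 => //; [exact: AC_continuous A1|exact: AC_continuous A2|exact: A2.1|exact: A1.1|].
(* The increment of the product is [f1 u (f2 u - f2 s) + f2 s (f1 u - f1 s)]. *)
move=> s u as_ su ub; exists u, s.
rewrite !in_itv/= !lexx su; split=> //.
by rewrite -(AC_sub A1)// -(AC_sub A2)//; ring.
Qed.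

Lemma AC_add a b (f1 w1 f2 w2 : R -> R) : a <= b -> AC a b f1 w1 -> AC a b f2 w2 ->
  AC a b (fun x => f1 x + f2 x) (fun x => w1 x + w2 x).
Proof.
move=> ab A1 A2; split; first by apply: integrableDR; [exact: A1.1|exact: A2.1].
move=> t tab; rewrite A1.2// A2.2//; move: tab; rewrite in_itv/= => /andP[at_ tb].
have sub f0 := @integrable_subitv a b a t f0 (lexx _) tb.
by rewrite Rintegral_itvD; [ring|apply: sub; exact: A1.1|apply: sub; exact: A2.1].
Qed.

Lemma AC_cst a b c : AC a b (fun=> c) (fun=> 0).
Proof.
split; first exact: integrable0.
by move=> t _; rewrite Rintegral_cst// mul0r addr0.
Qed.

Lemma AC_comp a b (P P' f w : R -> R) : a <= b ->
  (forall x : R, is_derive x 1 P (P' x)) -> continuous P' -> AC a b f w ->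
  AC a b (fun x => P (f x)) (fun x => P' (f x) * w x).
Proof.
move=> ab dP cP' A.
have cf := AC_continuous ab A.
apply: (@eq_AC _ _ (fun x => P (f x)) _ (fun x => P' (f x) * w x + 0 * 0)) => //.
  by move=> x _; rewrite mulr0 addr0.
apply: (@AC_intro2 _ _ _ (fun x => P' (f x)) w (fun=> 0) (fun=> 0)) => //.
- by apply: within_continuous_comp => // x _; exact: cP'.
- by move=> x; exact: cst_continuous.
- exact: A.1.
- exact: integrable0.
move=> s u as_ su ub.
have cP x y : {within `[x, y], continuous P}.
  by apply: derivable_within_continuous => z _; have := dP z; case.
(* The mean value theorem for [P] gives a value between [f s] and [f u]; the intermediate value
   theorem for [f] pulls it back to a point of [[s, u]]. *)
have [x xsu Px] : exists2 x, x \in `[s, u] & P (f u) - P (f s) = P' (f x) * (f u - f s).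
  have cfsu := within_continuous_subitv as_ ub cf.
  have key : exists2 y, Num.min (f s) (f u) <= y <= Num.max (f s) (f u) &
      P (f u) - P (f s) = P' y * (f u - f s).
    have [su'|us] := leP (f s) (f u).
      have [c cc ->] := @MVT_segment _ P P' _ _ su' (fun x _ => dP x) (cP _ _).
      by exists c.
    have [c cc E] := @MVT_segment _ P P' _ _ (ltW us) (fun x _ => dP x) (cP _ _).
    exists c => //.
    by rewrite -[LHS]opprB E; ring.
  have [y yb ->] := key.
  by have [c csu <-] := IVT su cfsu yb; exists c.
exists x, s; split=> //; first by rewrite in_itv/= lexx su.
by rewrite -(AC_sub A)// mul0r addr0.
Qed.

Lemma AC_eq0 a b f w : {in `]a, b[, forall t, w t = 0} -> AC a b f w ->
  {in `[a, b], forall t, f t = f a}.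
Proof.
move=> w0 A t tab; rewrite A.2//; move: tab; rewrite in_itv/= => /andP[at_ tb].
have wi := integrable_subitv (lexx a) tb A.1.
rewrite -Rintegral_itv_bndo_bndc; last first.
  by apply: integrableS wi => //; apply: subset_itv; rewrite bnd_simp.
rewrite -Rintegral_itv_obnd_cbnd; last first.
  by apply: integrableS wi => //; apply: subset_itv; rewrite bnd_simp.
rewrite (@eq_Rintegral _ _ _ _ _ (fun=> 0)).
  by rewrite Rintegral_cst// mul0r addr0.
move=> x; rewrite inE/= in_itv/= => /andP[ax xt]; apply: w0.
by rewrite in_itv/= ax (lt_le_trans xt tb).
Qed.

Lemma AC_of_derive a b (f v : R -> R) : a <= b -> {within `[a, b], continuous f} ->
  {within `[a, b], continuous v} ->
  (forall t : R, t \in `]a, b[ -> is_derive t 1 f (v t)) -> AC a b f v.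
Proof.
move=> ab cf cv dv; split; first exact: continuous_itv_integrable.
move=> t; rewrite in_itv/= => /andP[at_ tb].
have [<-|at'] := eqVneq a t.
  by rewrite set_itv1 Rintegral_set1 addr0.
have {at'}at' : a < t by rewrite lt_neqAle at'.
have cft := within_continuous_subitv (lexx a) tb cf.
have sub x : x \in `]a, t[ -> x \in `]a, b[.
  by rewrite !in_itv/= => /andP[-> /lt_le_trans]; exact.
rewrite /Rintegral (@continuous_FTC2 _ _ f _ _ at').
- by rewrite -EFinB /= subrKC.
- exact: (within_continuous_subitv (lexx a) tb cv).
- have /(continuous_within_itvP _ at')[_ cl cr] := cft.
  by split=> // x /sub /dv [].
- by move=> x /sub /dv H; rewrite derive1E; apply: derive_val.
Qed.

(** Lebesgue differentiation, applied to the density extended by zero so that it is integrable on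
    the whole line. *)
Lemma AC_derivable_ae a b f w : a < b -> AC a b f w ->
  {ae mu, forall t : R, t \in `]a, b[ -> is_derive t 1 f (w t)}.
Proof.
move=> ab A.
pose wt := w \_ `[a, b].
have wti : mu.-integrable setT (EFin \o wt).
  have := A.1; rewrite (integrable_mkcond _ _)//.
  by rewrite restrict_EFin.
have wl : locally_integrable setT wt by apply: integrable_locally => //; exact: A.1.
have wiy y : mu.-integrable [set` Interval (BLeft a) (BRight y)] (EFin \o wt).
  exact: integrableS wti.
have := FTC1 wiy wl.
apply: filterS; first exact: (ae_filter_ringOfSetsType mu).
move=> t H tab.
move: (tab); rewrite in_itv/= => /andP[at_ tb].
have [|dF dFE] := H; first by rewrite /= lte_fin.
have fE : \forall x \near t, f a + \int[mu]_(u in [set` Interval (BLeft a) (BRight x)]) wt u = f x.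
  have : nbhs t `]a, b[%classic by apply: near_in_itvoo.
  apply: filterS => x /= xab.
  rewrite (A.2 x); last by move: xab; rewrite !in_itv/= => /andP[/ltW -> /ltW ->].
  congr (_ + _); apply: eq_Rintegral => y; rewrite inE/= in_itv/= => /andP[ay yx].
  rewrite /wt patchE ifT// inE/= in_itv/= ay (le_trans yx)//.
  by move: xab; rewrite in_itv/= => /andP[_ /ltW].
apply: (near_eq_is_derive fE).
rewrite (_ : w t = 0 + wt t); last first.
  by rewrite add0r /wt patchE ifT// inE/= in_itv/= !ltW.
exact: is_deriveD (is_derive_cst _ _ _) (is_derive_of_derive1 dF dFE).
Qed.

End AbsolutelyContinuous.

(** * Pointwise derivatives *)

Section Derivatives.
Context {R : realType}.
Implicit Types (x l C : R) (f g : R -> R).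

Lemma is_derive_add f g x (a b : R) : is_derive x 1 f a -> is_derive x 1 g b ->
  is_derive x 1 (fun y => f y + g y) (a + b).
Proof. exact: is_deriveD. Qed.

Lemma is_derive_opp f x (a : R) : is_derive x 1 f a ->
  is_derive x 1 (fun y => - f y) (- a).
Proof. exact: is_deriveN. Qed.

Lemma is_derive_sub f g x (a b : R) : is_derive x 1 f a -> is_derive x 1 g b ->
  is_derive x 1 (fun y => f y - g y) (a - b).
Proof. exact: is_deriveB. Qed.

Lemma is_derive_mul f g x (a b : R) : is_derive x 1 f a -> is_derive x 1 g b ->
  is_derive x 1 (fun y => f y * g y) (f x * b + g x * a).
Proof. exact: is_deriveM. Qed.

Lemma is_derive_const (k : R) x : is_derive x 1 (fun=> k) 0.
Proof. exact: is_derive_cst. Qed.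

Lemma is_derive_idfun x : is_derive x 1 (fun y : R => y) 1.
Proof. exact: is_derive_id. Qed.

Lemma is_derive_scale f x (k a : R) : is_derive x 1 f a ->
  is_derive x 1 (fun y => k * f y) (k * a).
Proof. exact: is_deriveZ. Qed.

Lemma is_derive_chain f g x (a b : R) : is_derive (g x) 1 f a -> is_derive x 1 g b ->
  is_derive x 1 (fun y => f (g y)) (a * b).
Proof. exact: is_derive1_comp. Qed.

Lemma is_derive_pow f n x (a : R) : is_derive x 1 f a ->
  is_derive x 1 (fun y => f y ^+ n) (n%:R * f x ^+ n.-1 * a).
Proof.
move=> df; have -> : (fun y => f y ^+ n) = f ^+ n by apply/funext => y; rewrite exprfctE.
exact: is_deriveX.
Qed.

(** Serves the square of the positive part, whose second order remainder is bounded by cases on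
    signs, also at the corner. *)
Lemma is_derive_quadratic f x l C :
  (forall h, `|f (x + h) - f x - h * l| <= C * h ^+ 2) -> is_derive x 1 f l.
Proof.
move=> H.
have cv : (fun h => h^-1 *: (f (h *: 1 + x) - f x)) @ 0^' --> l.
  apply/cvgrPdist_le => e e0.
  have C1 : 0 < `|C| + 1 by rewrite ltr_wpDl.
  exists (e / (`|C| + 1)) => /=; first by rewrite divr_gt0.
  move=> h /=; rewrite sub0r normrN => hd h0.
  have hn0 : 0 < `|h| by rewrite normr_gt0.
  rewrite /GRing.scale/= mulr1 [h + x]addrC distrC.
  rewrite (_ : _ - l = h^-1 * (f (x + h) - f x - h * l)); last first.
    by rewrite [RHS]mulrBr mulrA mulVf// mul1r.
  rewrite normrM normfV ler_pdivrMl//.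
  apply: le_trans (H h) _; rewrite -real_normK ?num_real// expr2 mulrCA.
  rewrite ler_pM2l//; apply: le_trans (_ : (`|C| + 1) * `|h| <= _).
    by rewrite ler_pM2r// (le_trans (ler_norm C))// lerDl.
  by rewrite mulrC -ler_pdivlMr// ltW.
apply: DeriveDef; first by apply/cvg_ex; exists l.
by apply: cvg_lim cv.
Qed.

Lemma is_derive_continuous f x l : is_derive x 1 f l -> {for x, continuous f}.
Proof. by case=> df _; apply: differentiable_continuous; exact/derivable1_diffP. Qed.

Lemma is_derive_derive1 f x l : is_derive x 1 f l -> f^`()%classic x = l.
Proof. by move=> df; rewrite derive1E; exact: derive_val. Qed.

Lemma is_derive1_uniq f x (a b : R) : is_derive x 1 f a -> is_derive x 1 f b -> a = b.
Proof. by move=> /is_derive_derive1 <- /is_derive_derive1 <-. Qed.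

Lemma is_derive_near f g x l : (\forall y \near x, f y = g y) ->
  is_derive x 1 f l -> is_derive x 1 g l.
Proof. exact: near_eq_is_derive. Qed.

Lemma is_derive_posr2 x :
  is_derive x 1 (fun y : R => Num.max 0 y ^+ 2) (2 * Num.max 0 x).
Proof.
apply: (@is_derive_quadratic _ _ _ 1) => h; rewrite mul1r.
by have [x0|x0] := leP 0 x; have [xh|xh] := leP 0 (x + h); rewrite ler_norml;
  apply/andP; split; rewrite ?mulr0 ?expr0n/=; nra.
Qed.

End Derivatives.

(** * Weak derivatives *)

Section WeakDerivatives.
Context {R : realType}.
Implicit Types (a b c d s t : R) (f g h u v w : R -> R).
Local Notation mu := (@lebesgue_measure R).

Lemma Rintegral_oo_cc a b f : measurable_fun `]a, b[ f ->
  \int[mu]_(x in `]a, b[) f x = \int[mu]_(x in `[a, b]) f x.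
Proof.
move=> mf; rewrite /Rintegral; congr fine; apply/esym.
by apply: integral_itv_bndoo; exact/measurable_EFinP.
Qed.

Lemma integrable_oo_cc a b f : mu.-integrable `]a, b[ (EFin \o f) ->
  mu.-integrable `[a, b] (EFin \o f).
Proof.
move=> /integrableP[mf fi]; apply/integrableP; split.
  exact: emeasurable_fun_itv_cc mf.
rewrite (@integral_itv_bndoo _ a b (fun x => `|(EFin \o f) x|%E) true false)//.
exact: measurableT_comp.
Qed.

Lemma Rintegral_gt0 a b f t : a < b -> {within `[a, b], continuous f} ->
  (forall x, x \in `[a, b] -> 0 <= f x) -> t \in `[a, b] -> 0 < f t ->
  0 < \int[mu]_(x in `[a, b]) f x.
Proof.
move=> ab cf f0 tab ft.
have fi := continuous_itv_integrable cf.
have f20 : 0 < f t / 2 by rewrite divr_gt0.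
have [d [d0 Hd]] := within_continuous_eps cf tab f20.
move: (tab); rewrite in_itv/= => /andP[at_ tb].
have [s [r [as_ sr rb near_t]]] : exists s r : R, [/\ a <= s, s < r, r <= b &
    forall x, x \in `[s, r] -> `|x - t| < d].
  have [tltb|] := ltP t b.
    exists t, (Num.min b (t + d / 2)); split=> //.
    - by rewrite lt_min tltb ltrDl divr_gt0.
    - by rewrite ge_min lexx.
    move=> x; rewrite in_itv/= le_min => /and3P[tx xb xd].
    by rewrite ger0_norm ?subr_ge0//; lra.
  move=> bt; exists (Num.max a (t - d / 2)), t; split=> //.
  - by rewrite le_max lexx.
  - by rewrite gt_max (lt_le_trans ab bt) gtrBl divr_gt0.
  move=> x; rewrite in_itv/= ge_max => /andP[/andP[ax xd] xt].
  by rewrite ler0_norm ?subr_le0//; lra.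
have sub := @integrable_subitv R a b.
apply: (@lt_le_trans _ _ (\int[mu]_(x in `[s, r]) (f t / 2))).
  by rewrite Rintegral_itv_cst ?ltW// mulr_gt0// subr_gt0.
apply: (@le_trans _ _ (\int[mu]_(x in `[s, r]) f x)).
  apply: le_Rintegral_itv.
  - by apply: continuous_itv_integrable; apply: continuous_subspaceT => ?; exact: cst_continuous.
  - exact: sub as_ rb fi.
  move=> x xsr; have xab : x \in `[a, b].
    by move: xsr; rewrite !in_itv/= => /andP[sx xu]; rewrite (le_trans as_ sx) (le_trans xu rb).
  have := Hd x xab (near_t x xsr); rewrite ltr_norml => /andP[+ _]; lra.
rewrite (@Rintegral_itv_cat _ a s b)//; last exact: le_trans (ltW sr) rb.
rewrite (@Rintegral_itv_cat _ s r b)//; [|exact: ltW|exact: sub as_ (lexx b) fi].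
have ge0 x y : a <= x -> y <= b -> 0 <= \int[mu]_(z in `[x, y]) f z.
  move=> ax yb; apply: Rintegral_ge0 => z /= zxy; apply: f0.
  by move: zxy; rewrite !in_itv/= => /andP[xz zy]; rewrite (le_trans ax xz) (le_trans zy yb).
rewrite ler_wpDl//; first exact: ge0 (lexx _) (le_trans (ltW sr) rb).
by rewrite ler_wpDr//; exact: ge0 (le_trans as_ (ltW sr)) (lexx _).
Qed.

Lemma Rintegral_eq0_continuous a b f : a < b -> {within `[a, b], continuous f} ->
  (forall x, x \in `[a, b] -> 0 <= f x) -> \int[mu]_(x in `[a, b]) f x = 0 ->
  forall t, t \in `[a, b] -> f t = 0.
Proof.
move=> ab cf f0 If t tab; apply/eqP; rewrite eq_le f0// andbT leNgt.
by apply/negP => ft; have := Rintegral_gt0 ab cf f0 tab ft; rewrite If ltxx.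
Qed.

Lemma within_continuous_constant a b f k : a < b -> {within `[a, b], continuous f} ->
  {in `]a, b[, forall t, f t = k} -> {in `[a, b], forall t, f t = k}.
Proof.
move=> ab cf fk t tab; apply/eqP; rewrite -subr_eq0 -normr_le0.
apply/ler_addgt0Pr => e e0; rewrite add0r.
have [d [d0 Hd]] := within_continuous_eps cf tab e0.
move: (tab); rewrite in_itv/= => /andP[at_ tb].
have [s [sab st]] : exists s : R, (s \in `]a, b[) /\ (`|s - t| < d).
  have [tltb|bt] := ltP t b.
    exists (Num.min ((t + b) / 2) (t + d / 2)); split.
      by rewrite in_itv/= lt_min gt_min; apply/andP; split; [apply/andP|apply/orP; left]; lra.
    rewrite ger0_norm ?subr_ge0 ?le_min; last by apply/andP; lra.
    by rewrite ltrBlDr gt_min; apply/orP; right; lra.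
  exists (Num.max ((a + b) / 2) (t - d / 2)); split.
    by rewrite in_itv/= lt_max gt_max; apply/andP; split; [apply/orP; left|apply/andP]; lra.
  rewrite ler0_norm ?subr_le0 ?ge_max; last by apply/andP; lra.
  by rewrite opprB ltrBlDr -ltrBlDl lt_max; apply/orP; right; lra.
have sab' : s \in `[a, b] by move: sab; rewrite !in_itv/= => /andP[/ltW -> /ltW ->].
by rewrite distrC -(fk s sab) distrC ltW// distrC Hd.
Qed.

Lemma Rintegral_support a b c d f : a < c -> d < b ->
  {in `]a, b[, forall x, x \notin `[c, d] -> f x = 0} ->
  \int[mu]_(x in `]a, b[) f x = \int[mu]_(x in `[c, d]) f x.
Proof.
move=> ac db f0; rewrite [LHS]Rintegral_mkcond [RHS]Rintegral_mkcond.
have memE (i : interval R) x : (x \in [set` i]) = (x \in i).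
  by apply/idP/idP; rewrite inE.
apply: eq_Rintegral => x _; rewrite !patchE !memE.
case: ifPn => xab; case: ifPn => xcd //; first exact: f0.
move: xab xcd; rewrite !in_itv/= => /negP + /andP[cx xd]; case.
by rewrite (lt_le_trans ac cx) (le_lt_trans xd db).
Qed.

Lemma test_fun_AC a b u : a <= b -> test_fun a b u -> AC a b u u^`()%classic.
Proof.
move=> ab [du cu _]; apply: (AC_of_derive ab).
- by apply: derivable_within_continuous => x _; exact: du.
- exact: continuous_subspaceT.
- by move=> t _; apply: is_derive_of_derive1 => //; exact: du.
Qed.

Lemma AC_weak_derivative a b f w u : a <= b -> AC a b f w -> test_fun a b u ->
  \int[mu]_(x in `[a, b]) (f x * u^`()%classic x) =
  - \int[mu]_(x in `[a, b]) (w x * u x).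
Proof.
move=> ab A tu; have B := test_fun_AC ab tu.
have [_ cu' [c [d [ac db u0]]]] := tu.
have := (AC_mul ab A B).2 b; rewrite in_itv/= ab lexx => /(_ isT).
rewrite [u a]u0 ?in_itv/= -?ltNge ?ac//; last by rewrite leNgt ac.
rewrite [u b]u0 ?in_itv/=; last by rewrite [b <= d]leNgt db andbF.
rewrite !mulr0 add0r Rintegral_itvD; last 2 first.
- by apply: integrable_mul_continuous; [exact: AC_continuous A|exact: B.1].
- by apply: integrable_mul_continuous; [exact: AC_continuous B|exact: A.1].
move/esym/eqP; rewrite addr_eq0 => /eqP ->.
by congr (- _); apply: eq_Rintegral => x _; rewrite mulrC.
Qed.

End WeakDerivatives.

(** * The fundamental lemma of the calculus of variations and the du Bois-Reymond lemma *)

Section DuBoisReymond.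
Context {R : realType}.
Implicit Types (a b c d s t : R) (f g h u v w : R -> R).
Local Notation mu := (@lebesgue_measure R).

(** This is [1 - (1 - beta)^n] for a bump [beta] with values in [[0, 1]], positive exactly on []c,
    d[]. It tends to the indicator function of []c, d[]; squaring the positive part makes it of
    class C^1. *)
Definition plateau c d (n : nat) (t : R) : R :=
  1 - (1 - Num.max 0 ((t - c) * (d - t)) ^+ 2 / (d - c) ^+ 4) ^+ n.

Lemma plateau_derive c d n t : is_derive t 1 (plateau c d n)
  (- (n%:R * (1 - Num.max 0 ((t - c) * (d - t)) ^+ 2 / (d - c) ^+ 4) ^+ n.-1 *
   - (2 * Num.max 0 ((t - c) * (d - t)) * (c + d - 2 * t) / (d - c) ^+ 4))).
Proof.
have q : is_derive t 1 (fun t => (t - c) * (d - t)) (c + d - 2 * t).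
  have := is_derive_mul (is_derive_sub (is_derive_idfun t) (is_derive_const c t))
    (is_derive_sub (is_derive_const d t) (is_derive_idfun t)).
  by move/is_derive_eq; apply; ring.
have q2 := @is_derive_chain R (fun y => Num.max 0 y ^+ 2) (fun t => (t - c) * (d - t))
  t _ _ (is_derive_posr2 _) q.
have q3 := is_derive_pow n (is_derive_sub (is_derive_const 1 t)
  (is_derive_scale ((d - c) ^+ 4)^-1 q2)).
have q4 := is_derive_sub (is_derive_const 1 t) q3.
have -> : plateau c d n = fun y : R => 1 - (1 - (d - c) ^- 4 * Num.max 0 ((y - c) * (d - y)) ^+ 2) ^+ n.
  by apply/funext => y; rewrite /plateau [_ / _]mulrC.
apply: is_derive_eq q4 _.
by rewrite -![_ / _]mulrC; ring.
Qed.

Lemma continuous_max0 (f : R -> R) : continuous f -> continuous (fun x => Num.max 0 (f x)).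
Proof.
move=> cf; have -> : (fun x => Num.max 0 (f x)) = (fun x => (f x + `|f x|) / 2).
  apply/funext => x; have [h|h] := leP 0 (f x).
    by rewrite ger0_norm//; field.
  by rewrite ltr0_norm// subrr mul0r.
move=> x; apply: cvgM; last exact: cvg_cst.
by apply: cvgD; [exact: cf|apply: cvg_norm; exact: cf].
Qed.

Lemma cvg_exprn T (F : set_system T) (FF : Filter F) (f : T -> R) (l : R) n :
  f @ F --> l -> (fun x => f x ^+ n) @ F --> l ^+ n.
Proof.
move=> fl; elim: n => [|n IH].
  by rewrite expr0; under eq_fun do rewrite expr0; exact: cvg_cst.
by rewrite exprS; under eq_fun do rewrite exprS; exact: cvgM.
Qed.

Lemma plateau_test_fun a b c d n : a < c -> c < d -> d < b -> test_fun a b (plateau c d n).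
Proof.
move=> ac cd db; split.
- by move=> x; have [] := plateau_derive c d n x.
- have cq : continuous (fun x : R => (x - c) * (d - x)).
    move=> x; apply: cvgM; [apply: cvgB|apply: cvgB]; by [exact: cvg_id|exact: cvg_cst].
  have -> : (plateau c d n)^`()%classic = (fun t : R => (- (n%:R * (1 - Num.max 0 ((t - c) * (d - t)) ^+ 2 / (d - c) ^+ 4) ^+ n.-1 *
   - (2 * Num.max 0 ((t - c) * (d - t)) * (c + d - 2 * t) / (d - c) ^+ 4)))).
    by apply/funext => t; rewrite (is_derive_derive1 (plateau_derive c d n t)).
  move=> x; have cm := continuous_max0 cq (x := x).
  apply: cvgN; apply: cvgM.
    apply: cvgM; first exact: cvg_cst.
    apply: cvg_exprn; apply: cvgB; first exact: cvg_cst.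
    by apply: cvgM; [apply: cvg_exprn; exact: cm|exact: cvg_cst].
  apply: cvgN; apply: cvgM; last exact: cvg_cst.
  apply: cvgM; first by apply: cvgM; [exact: cvg_cst|exact: cm].
  by apply: cvgB; [exact: cvg_cst|apply: cvgM; [exact: cvg_cst|exact: cvg_id]].
- exists c, d; split=> // x; rewrite in_itv/= negb_and -!ltNge => xcd.
  rewrite /plateau max_l ?expr0n/= ?mul0r ?subr0 ?expr1n ?subrr//.
  by case/orP: xcd => h; nra.
Qed.

Lemma plateau_base_itv c d t : c < d ->
  0 <= Num.max 0 ((t - c) * (d - t)) ^+ 2 / (d - c) ^+ 4 <= 1.
Proof.
move=> cd; apply/andP; split; first by rewrite divr_ge0// exprn_even_ge0.
rewrite ler_pdivrMr ?exprn_gt0 ?subr_gt0// mul1r (_ : 4%N = (2 * 2)%N)// exprM.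
rewrite ler_pXn2r ?nnegrE ?le_max ?lexx ?exprn_even_ge0// ge_max exprn_even_ge0//=.
have := sqr_ge0 ((t - c) + (d - t) / 2); have := sqr_ge0 (d - t).
by rewrite !expr2; nra.
Qed.

Lemma plateau_bound c d n t : c < d -> `|plateau c d n t| <= 1.
Proof.
move=> cd; have /andP[h0 h1] := plateau_base_itv t cd.
rewrite /plateau; set x := _ / _ in h0 h1 *.
have x0 : 0 <= 1 - x by rewrite subr_ge0.
have := exprn_ge0 n x0; have : (1 - x) ^+ n <= 1 by rewrite exprn_ile1// gerBl.
by move=> A B; rewrite ger0_norm; lra.
Qed.

Lemma plateau_cvg c d t : t \in `]c, d[ -> plateau c d n t @[n --> \oo] --> (1 : R).
Proof.
rewrite in_itv/= => /andP[ct td]; have cd := lt_trans ct td.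
have /andP[h0 h1] := plateau_base_itv t cd.
rewrite /plateau; set x := _ / _ in h0 h1 *.
have x0 : 0 < x.
  have td0 : 0 < (t - c) * (d - t) by rewrite mulr_gt0 ?subr_gt0.
  rewrite /x divr_gt0// ?exprn_gt0 ?subr_gt0//.
  by rewrite lt_max td0 orbT.
rewrite -[X in _ --> X]subr0; apply: cvgB; first exact: cvg_cst.
by apply: cvg_expr; rewrite ger0_norm; lra.
Qed.

Lemma plateau_out c d n t : c < d -> t \notin `]c, d[ -> plateau c d n t = 0.
Proof.
move=> cd; rewrite in_itv/= negb_and -!leNgt => tcd.
rewrite /plateau max_l ?expr0n/= ?mul0r ?subr0 ?expr1n ?subrr//.
by case/orP: tcd => h; nra.
Qed.

(** The functions [plateau c d n] are admissible, bounded by 1 and converge to the indicator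
    function of []c, d[]: dominated convergence applies. *)
Lemma weak_zero a b h : a < b -> mu.-integrable `[a, b] (EFin \o h) ->
  (forall u, test_fun a b u -> \int[mu]_(x in `]a, b[) (h x * u x) = 0) ->
  forall c d, a < c -> c < d -> d < b -> \int[mu]_(x in `[c, d]) h x = 0.
Proof.
move=> ab hi H c d ac cd db.
have memE (i : interval R) x : (x \in [set` i]) = (x \in i).
  by apply/idP/idP; rewrite inE.
have sub (i : interval R) : [set` i] `<=` `[a, b]%classic -> mu.-integrable [set` i] (EFin \o h).
  by move=> sb; apply: integrableS hi => //; exact: measurable_itv.
have hoo : mu.-integrable `]a, b[ (EFin \o h).
  by apply: sub => x /=; rewrite !in_itv/= => /andP[cx xd]; rewrite !ltW.
have hcd : mu.-integrable `]c, d[ (EFin \o h).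
  by apply: sub => x /=; rewrite !in_itv/= => /andP[cx xd]; rewrite (ltW (lt_trans ac cx)) (ltW (lt_trans xd db)).
have hpi n : mu.-integrable `]a, b[ (EFin \o (fun x => h x * plateau c d n x)).
  have := test_fun_AC (ltW ab) (plateau_test_fun n ac cd db).
  move=> /(AC_continuous (ltW ab)) cp.
  have := integrable_mul_continuous cp hi.
  rewrite (_ : (fun x => h x * plateau c d n x) = (fun x => plateau c d n x * h x)); last first.
    by apply/funext => x; rewrite mulrC.
  by apply: integrableS => //; apply: subset_itv; rewrite bnd_simp.
have L : (\int[mu]_(x in `]a, b[) (h x * plateau c d n x)%:E)%E @[n --> \oo] -->
    (\int[mu]_(x in `]a, b[) ((h \_ `]c, d[) x)%:E)%E.
  apply: (@dominated_cvg _ _ _ mu `]a, b[%classic _ _ _ (fun x => `|h x|%:E)) => //.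
  - by move=> n; have /integrableP[] := hpi n.
  - move=> x xab; rewrite patchE memE; case: ifPn => xcd.
      apply: cvg_EFin; first by near=> n.
      rewrite /comp/= -[X in _ --> X]mulr1.
      by apply: cvgM; [exact: cvg_cst|exact: plateau_cvg].
    under eq_fun do rewrite plateau_out// mulr0.
    exact: cvg_cst.
  - exact: integrable_norm hoo.
  - move=> n x xab; rewrite abse_EFin lee_fin normrM.
    by rewrite -[leRHS]mulr1 ler_wpM2l// plateau_bound.
have L0 : (fun n => (\int[mu]_(x in `]a, b[) (h x * plateau c d n x)%:E)%E) = cst 0%:E.
  apply/funext => n /=.
  have E := congr1 EFin (H _ (plateau_test_fun n ac cd db)).
  by rewrite -E /Rintegral fineK//; exact: integrable_fin_num (hpi n).
have : \int[mu]_(x in `]a, b[) ((h \_ `]c, d[) x) = 0.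
  rewrite /Rintegral; move: L; rewrite L0 => /cvg_lim <-//.
  by rewrite lim_cst.
rewrite -Rintegral_mkcondr (_ : _ `&` _ = `]c, d[%classic); last first.
  apply/seteqP; split=> [x []//|x /= xcd]; split=> //.
  by move: xcd; rewrite /= !in_itv/= => /andP[cx xd]; rewrite (lt_trans ac cx) (lt_trans xd db).
rewrite Rintegral_oo_cc//.
by have /integrableP[/measurable_EFinP] := hcd.
Unshelve. all: by end_near.
Qed.

(** By [weak_zero] the primitive of [h] is constant inside the interval, and [h] is almost
    everywhere its derivative. *)
Lemma weak_zero_ae a b h : a < b -> mu.-integrable `[a, b] (EFin \o h) ->
  (forall u, test_fun a b u -> \int[mu]_(x in `]a, b[) (h x * u x) = 0) ->
  {ae mu, forall t, t \in `]a, b[ -> h t = 0}.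
Proof.
move=> ab hi H.
pose F t := \int[mu]_(x in `[a, t]) h x.
have AF : AC a b F h by split=> // t tab; rewrite /F set_itv1 Rintegral_set1 add0r.
have F0 : {in `]a, b[, forall t, F t = F ((a + b) / 2)}.
  pose m := (a + b) / 2.
  have [am mb] : a < m /\ m < b by rewrite /m; lra.
  move=> t; rewrite in_itv/= -/m => /andP[at_ tb]; apply/eqP; rewrite -subr_eq0; apply/eqP.
  have [|tm|->] := ltgtP t m; last by rewrite subrr.
    by move=> tm; rewrite -opprB (AC_sub AF) ?(ltW at_) ?(ltW tm) ?(ltW mb)// (weak_zero ab hi H)// oppr0.
  by rewrite (AC_sub AF) ?(ltW am) ?(ltW tm) ?(ltW tb)// (weak_zero ab hi H).
have := AC_derivable_ae ab AF.
apply: filterS; first exact: (ae_filter_ringOfSetsType mu).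
move=> t /[swap] tab /(_ tab) dF.
apply: (is_derive1_uniq dF).
apply: is_derive_near (is_derive_const (F ((a + b) / 2)) t).
have : nbhs t `]a, b[%classic by apply: near_in_itvoo.
by apply: filterS => x /= xab; rewrite F0.
Qed.

(** Let [eta] be a bump on [[c, d]] and [m] the mean of [k] with weight [eta]. Then [eta (k - m)]
    has mean zero, so its primitive is a test function, and testing with it gives that the integral
    of [eta (k - m)^2] is zero. *)
Lemma du_bois_reymond_oo a b (k : R -> R) c d : a < c -> c < d -> d < b ->
  {within `[a, b], continuous k} ->
  (forall u, test_fun a b u -> \int[mu]_(x in `]a, b[) (k x * u^`()%classic x) = 0) ->
  exists m, {in `]c, d[, forall t, k t = m}.
Proof.
move=> ac cd db ck H.
(* Composition with the projection onto [[c, d]] makes [k] continuous on the whole line without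
   changing it where [eta] lives. *)
pose clip x := Num.max c (Num.min x d).
have clip_itv x : clip x \in `[a, b].
  by rewrite in_itv/= le_max (ltW ac) /= ge_max ge_min (ltW db) orbT (ltW (lt_trans cd db)).
have cclip : continuous clip.
  by apply: max_fun_continuous; [move=> x; exact: cvg_cst|apply: min_fun_continuous; move=> x; [exact: cvg_id|exact: cvg_cst]].
have clipE x : x \in `[c, d] -> clip x = x.
  by rewrite in_itv/= => /andP[cx xd]; rewrite /clip min_l// max_r.
have ab : a < b by exact: lt_trans (lt_trans ac cd) db.
pose kc x := k (clip x).
have ckc : continuous kc.
  move=> x; apply: continuous_comp; first exact: cclip.
  have /(continuous_within_itvP _ ab)[+ _ _] := ck; apply.
  rewrite in_itv/= lt_max ac /= gt_max gt_min db orbT andbT.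
  exact: lt_trans db.
pose eta x := Num.max 0 ((x - c) * (d - x)).
have ceta : continuous eta.
  apply: continuous_max0 => x.
  by apply: cvgM; [apply: cvgB|apply: cvgB]; [exact: cvg_id|exact: cvg_cst|exact: cvg_cst|exact: cvg_id].
have eta0 x : 0 <= eta x by rewrite le_max lexx.
have eta_gt0 x : x \in `]c, d[ -> 0 < eta x.
  by rewrite in_itv/= => /andP[cx xd]; rewrite lt_max mulr_gt0 ?subr_gt0 ?orbT.
have eta_out x : x \notin `[c, d] -> eta x = 0.
  by rewrite in_itv/= negb_and -!ltNge => xcd; rewrite /eta max_l//; case/orP: xcd => h; nra.
have int f s t : continuous f -> mu.-integrable `[s, t] (EFin \o f).
  by move=> cf; apply: continuous_itv_integrable; exact: continuous_subspaceT.
have cetak : continuous (fun x => eta x * kc x).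
  by move=> x; apply: cvgM; [exact: ceta|exact: ckc].
pose I := \int[mu]_(x in `[c, d]) eta x.
have I0 : 0 < I.
  apply: (@Rintegral_gt0 _ _ _ _ ((c + d) / 2)) => //.
  - exact: continuous_subspaceT.
  - by rewrite in_itv/=; apply/andP; split; lra.
  - by apply: eta_gt0; rewrite in_itv/=; apply/andP; split; lra.
pose m := \int[mu]_(x in `[c, d]) (eta x * kc x) / I.
pose psi x := eta x * (kc x - m).
have cpsi : continuous psi.
  move=> x; apply: cvgM; first exact: ceta.
  by apply: cvgB; [exact: ckc|exact: cvg_cst].
have psi_out x : x \notin `[c, d] -> psi x = 0 by move=> h; rewrite /psi eta_out// mul0r.
have psi0 : \int[mu]_(x in `[c, d]) psi x = 0.
  under eq_Rintegral do rewrite /psi mulrBr [_ * m]mulrC.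
  rewrite Rintegral_itvB_fun; [|exact: int| ]; last by apply: integrableZR; exact: int.
  rewrite Rintegral_itvZ; last exact: int.
  by rewrite -/I /m divfK ?gt_eqF// subrr.
pose phi t := \int[mu]_(x in `[a, t]) psi x.
have phi_lt t : t < c -> phi t = 0.
  move=> tc; rewrite /phi (@eq_Rintegral _ _ _ _ _ (fun=> 0)).
    by rewrite Rintegral_cst// mul0r.
  move=> x; rewrite inE/= in_itv/= => /andP[ax xt]; apply: psi_out.
  by rewrite in_itv/= negb_and -!ltNge (le_lt_trans xt tc).
have phi_gt t : d < t -> phi t = 0.
  move=> dt; rewrite /phi (@Rintegral_itv_cat _ a c t); [|exact: ltW|exact: ltW (lt_trans cd dt)|exact: int].
  rewrite (@Rintegral_itv_cat _ c d t); [|exact: ltW|exact: ltW|exact: int].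
  rewrite psi0 add0r -Rintegral_itv_bndo_bndc; last first.
    apply: integrableS (int _ a c cpsi) => //.
    by apply: subset_itv; rewrite bnd_simp.
  rewrite (@eq_Rintegral _ _ _ _ _ (fun=> 0)); last first.
    move=> x; rewrite inE/= in_itv/= => /andP[ax xc]; apply: psi_out.
    by rewrite in_itv/= negb_and -!ltNge xc.
  rewrite Rintegral_cst// mul0r add0r -Rintegral_itv_obnd_cbnd; last first.
    apply: integrableS (int _ d t cpsi) => //.
    by apply: subset_itv; rewrite bnd_simp.
  rewrite (@eq_Rintegral _ _ _ _ _ (fun=> 0)); last first.
    move=> x; rewrite inE/= in_itv/= => /andP[dx xt]; apply: psi_out.
    by rewrite in_itv/= negb_and -!ltNge dx orbT.
  by rewrite Rintegral_cst// mul0r.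
have dphi t : is_derive t 1 phi (psi t).
  have [ta|at_] := ltP a t.
    have tt1 : t < t + 1 by rewrite ltrDl.
    have [dF dE] := continuous_FTC1_closed tt1 (int psi a (t + 1) cpsi) ta (cpsi t).
    exact: is_derive_of_derive1 dF dE.
  have tc := le_lt_trans at_ ac.
  rewrite psi_out; last by rewrite in_itv/= negb_and -!ltNge tc.
  apply: is_derive_near (is_derive_const 0 t).
  by near=> y; rewrite phi_lt//; near: y; exact: lt_nbhsl.
have dphiE : phi^`()%classic = psi.
  by apply/funext => t; exact: is_derive_derive1.
have tphi : test_fun a b phi.
  split; [by move=> x; have [] := dphi x|by rewrite dphiE|].
  exists c, d; split=> // x; rewrite in_itv/= negb_and -!ltNge.
  by case/orP; [exact: phi_lt|exact: phi_gt].
have := H _ tphi; rewrite dphiE (Rintegral_support ac db); last first.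
  by move=> x _ xcd; rewrite psi_out// mulr0.
(* As [psi] has mean zero, subtracting [m] from [k] costs nothing and leaves the integral of a
   weighted square. *)
have -> : \int[mu]_(x in `[c, d]) (k x * psi x) =
    \int[mu]_(x in `[c, d]) (eta x * (kc x - m) ^+ 2 + m * psi x).
  apply: eq_Rintegral => x; rewrite inE/= => xcd.
  by rewrite /psi /kc clipE//; ring.
have csq : continuous (fun x => eta x * (kc x - m) ^+ 2).
  move=> x; apply: cvgM; first exact: ceta.
  by apply: cvg_exprn; apply: cvgB; [exact: ckc|exact: cvg_cst].
rewrite Rintegral_itvD; [|exact: int|by apply: integrableZR; exact: int].
rewrite Rintegral_itvZ ?psi0; last exact: int.
rewrite mulr0 addr0 => E; exists m => t tcd.
have tcd' : t \in `[c, d] by move: tcd; rewrite !in_itv/= => /andP[/ltW -> /ltW ->].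
have sq0 : eta t * (kc t - m) ^+ 2 = 0.
  apply: (@Rintegral_eq0_continuous _ c d (fun x => eta x * (kc x - m) ^+ 2)) => //.
  - exact: continuous_subspaceT.
  - by move=> x _; rewrite mulr_ge0// sqr_ge0.
move/eqP: sq0; rewrite mulf_eq0 gt_eqF ?eta_gt0//= sqrf_eq0 subr_eq0.
by rewrite /kc clipE// => /eqP.
Unshelve. all: by end_near.
Qed.

Lemma du_bois_reymond a b (k : R -> R) : a < b -> {within `[a, b], continuous k} ->
  (forall u, test_fun a b u -> \int[mu]_(x in `]a, b[) (k x * u^`()%classic x) = 0) ->
  {in `[a, b], forall t, k t = k a}.
Proof.
move=> ab ck H.
have E : {in `]a, b[, forall t, k t = k ((a + b) / 2)}.
  move=> t; rewrite in_itv/= => /andP[at_ tb].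
  (* The interval []c, d[] is to contain both [t] and the midpoint, whose value is the common
     constant. *)
  pose c := Num.min (a + (t - a) / 2) (a + (b - a) / 4).
  pose d := Num.max (b - (b - t) / 2) (b - (b - a) / 4).
  have [ct cm] : c < t /\ c < (a + b) / 2.
    by split; rewrite gt_min; apply/orP; [left|right]; lra.
  have [td md] : t < d /\ (a + b) / 2 < d.
    by split; rewrite lt_max; apply/orP; [left|right]; lra.
  have ac : a < c by rewrite lt_min; apply/andP; split; lra.
  have db : d < b by rewrite gt_max; apply/andP; split; lra.
  have [m Hm] := du_bois_reymond_oo ac (lt_trans ct td) db ck H.
  by rewrite !Hm// in_itv/= ?ct ?td ?cm ?md.
have := within_continuous_constant ab ck E.
move=> E' t tab; rewrite (E' t tab) (E' a)// in_itv/= lexx ltW//.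
Qed.

(** The difference of [v] and a primitive of [w] has zero weak derivative, hence is constant by
    [du_bois_reymond]. *)
Lemma weak_derivative_AC a b v w : a < b -> {within `[a, b], continuous v} ->
  mu.-integrable `[a, b] (EFin \o w) -> weak_derivative a b v w -> AC a b v w.
Proof.
move=> ab cv wi H.
pose V t := \int[mu]_(x in `[a, t]) w x.
have AV : AC a b V w by split=> // t tab; rewrite /V set_itv1 Rintegral_set1 add0r.
have cV := AC_continuous (ltW ab) AV.
have key : {in `[a, b], forall t, v t - V t = v a - V a}.
  apply: (@du_bois_reymond a b (fun t => v t - V t)) => //.
    exact: within_continuousB.
  move=> u tu; have [du cu _] := tu.
  have cu' : {within `[a, b], continuous u} by apply: derivable_within_continuous => x _; exact: du.
  have cdu' : {within `[a, b], continuous u^`()%classic} by exact: continuous_subspaceT.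
  have vdu := integrable_mul_continuous cv (continuous_itv_integrable cdu').
  have Vdu := integrable_mul_continuous cV (continuous_itv_integrable cdu').
  have uw := integrable_mul_continuous cu' wi.
  have mes f : mu.-integrable `[a, b] (EFin \o f) -> measurable_fun `]a, b[ f.
    move=> /integrableP[/measurable_EFinP mf _].
    apply: measurable_funS mf => //.
    by apply: subset_itv; rewrite bnd_simp.
  under eq_Rintegral do rewrite mulrBl.
  rewrite Rintegral_oo_cc; last exact: mes (integrableBR vdu Vdu).
  rewrite Rintegral_itvB_fun// (AC_weak_derivative (ltW ab) AV tu).
  rewrite -(Rintegral_oo_cc (mes _ vdu)) (H u tu).
  rewrite Rintegral_oo_cc; first by rewrite subrr.
  rewrite (_ : (fun x => w x * u x) = (fun x => u x * w x)); first exact: mes.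
  by apply/funext => x; rewrite mulrC.
split=> // t tab; have := key t tab.
rewrite {2}/V set_itv1 Rintegral_set1 subr0 -/(V t) => <-.
by rewrite subrK.
Qed.

Lemma Lp_on_integrable p a b w : 1 < p -> a < b -> Lp_on p a b w ->
  mu.-integrable `[a, b] (EFin \o w) /\
  mu.-integrable `[a, b] (EFin \o (fun x => `|w x| `^ p)).
Proof.
move=> p1 ab [mw wp].
have mwp : measurable_fun `]a, b[ (fun x => `|w x| `^ p).
  have mn : measurable_fun `]a, b[ (fun x => `|w x|) by exact: measurableT_comp.
  exact: measurableT_comp (measurable_powR p) mn.
have ip : mu.-integrable `[a, b] (EFin \o (fun x => `|w x| `^ p)).
  apply: integrable_oo_cc; apply/integrableP; split; first exact/measurable_EFinP.
  apply: le_lt_trans wp.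
  by under eq_integral do rewrite /= ger0_norm ?powR_ge0//.
split=> //.
(* On a bounded interval integrability of [w] follows from [|w| <= 1 + |w|^p]. *)
have ig : mu.-integrable `[a, b] (EFin \o (fun x => 1 + `|w x| `^ p)).
  apply: integrableDR => //; apply: continuous_itv_integrable.
  by apply: continuous_subspaceT => x; exact: cst_continuous.
apply: le_integrable ig => //.
- by apply/measurable_EFinP; apply: measurable_fun_itv_cc mw.
- move=> x _ /=; rewrite lee_fin.
  rewrite [leRHS]ger0_norm; last by rewrite addr_ge0// powR_ge0.
  have [w1|w1] := leP `|w x| 1; first by rewrite ler_wpDr// powR_ge0.
  by rewrite ler_wpDl// le1r_powR// ltW.
Qed.

(** The weak first derivative [v'] of [W2p] and the classical one [v] are both weak derivatives of
    [u], so they agree almost everywhere. Hence [w] is also a weak derivative of the continuous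
    function [v], and therefore its density. *)
Lemma W2p_AC p a b u v : 1 < p -> a < b -> W2p p a b u ->
  {within `[a, b], continuous u} -> {within `[a, b], continuous v} ->
  (forall t, t \in `]a, b[ -> is_derive t 1 u (v t)) ->
  exists w, AC a b v w /\ mu.-integrable `[a, b] (EFin \o (fun x => `|w x| `^ p)).
Proof.
move=> p1 ab [v' [w [_ Lv Lw wv ww]]] cu cv dv.
have [wi wpi] := Lp_on_integrable p1 ab Lw.
have [vi _] := Lp_on_integrable p1 ab Lv.
exists w; split=> //.
have Au := AC_of_derive (ltW ab) cu cv dv.
have mes f : mu.-integrable `[a, b] (EFin \o f) -> measurable_fun `]a, b[ f.
  move=> /integrableP[/measurable_EFinP mf _].
  apply: measurable_funS mf => //.
  by apply: subset_itv; rewrite bnd_simp.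
have cvi := continuous_itv_integrable cv.
have vae : {ae mu, forall t, t \in `]a, b[ -> v' t - v t = 0}.
  apply: (@weak_zero_ae a b (fun t => v' t - v t)) => //; first exact: integrableBR.
  move=> f tf; have Af := test_fun_AC (ltW ab) tf.
  have cf := AC_continuous (ltW ab) Af.
  have fv := integrable_mul_continuous cf vi.
  have fv' := integrable_mul_continuous cf cvi.
  have E1 : \int[mu]_(x in `[a, b]) (u x * f^`()%classic x) = - \int[mu]_(x in `[a, b]) (f x * v' x).
    rewrite -Rintegral_oo_cc; last exact: mes (integrable_mul_continuous cu Af.1).
    rewrite (wv f tf) -Rintegral_oo_cc; last exact: mes.
    by congr (- _); apply: eq_Rintegral => x _; rewrite mulrC.
  have E2 := AC_weak_derivative (ltW ab) Au tf.
  under eq_Rintegral do rewrite mulrC mulrBr.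
  rewrite Rintegral_oo_cc; last exact: mes (integrableBR fv fv').
  rewrite Rintegral_itvB_fun//.
  apply/eqP; rewrite subr_eq0 -eqr_opp -E1 E2; apply/eqP; congr (- _).
  by apply: eq_Rintegral => x _; rewrite mulrC.
apply: weak_derivative_AC => // f tf; rewrite -(ww f tf) /Rintegral; congr fine.
have Af := test_fun_AC (ltW ab) tf.
apply: ae_eq_integral => //.
- have := mes _ (integrable_mul_continuous cv Af.1).
  by move=> ?; exact/measurable_EFinP.
- apply/measurable_EFinP; apply: measurable_funM; first exact: mes.
  exact: mes Af.1.
move: vae; apply: filterS; first exact: (ae_filter_ringOfSetsType mu).
by move=> t H tab; congr (_%:E); move/eqP: (H tab); rewrite subr_eq0 => /eqP ->.
Qed.

End DuBoisReymond.

(** * Tangent angle of an immersion *)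

Section TangentAngle.
Import HBNNSimple.
Context {R : realType}.
Implicit Types (a b c d s t p : R) (f v k th : R -> R) (g : R -> R * R).
Local Notation mu := (@lebesgue_measure R).

(* No measurability is required: the integral of a nonnegative function is a
   supremum over the simple functions below it. *)
Lemma ge0_ae_eq_integral_nonmeasurable (D : set R) (f1 f2 : R -> \bar R) :
  (forall x, D x -> (0 <= f1 x)%E) -> (forall x, D x -> (0 <= f2 x)%E) ->
  {ae mu, forall x, D x -> f1 x = f2 x} ->
  (\int[mu]_(x in D) f1 x = \int[mu]_(x in D) f2 x)%E.
Proof.
suff le (G1 G2 : R -> \bar R) : (forall x, D x -> (0 <= G1 x)%E) -> (forall x, D x -> (0 <= G2 x)%E) ->
    {ae mu, forall x, D x -> G1 x = G2 x} ->
    (\int[mu]_(x in D) G1 x <= \int[mu]_(x in D) G2 x)%E.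
  move=> f10 f20 f12; apply/eqP; rewrite eq_le !le//.
  move: f12; apply: filterS; first exact: (ae_filter_ringOfSetsType mu).
  by move=> x H Dx; rewrite H.
move=> f10 f20 [B [mB B0 HB]].
rewrite !ge0_integralE//; apply: ub_ereal_sup => _ [h /= hf <-].
pose h' := proj_nnsfun h (measurableC mB).
have h'E x : h' x = h x * (x \notin B)%:R.
  rewrite /h' /= mindicE; congr (_ * (nat_of_bool _)%:R).
  by apply/idP/idP; rewrite notin_setE !inE.
have -> : sintegral mu h = sintegral mu h'.
  rewrite -!integralT_nnsfun.
  rewrite (@ge0_ae_eq_integral _ _ _ mu setT (fun x => (h x)%:E) (fun x => (h' x)%:E))//.
  - by apply/measurable_EFinP.
  - by apply/measurable_EFinP.
  - by move=> x _; rewrite lee_fin.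
  - by move=> x _; rewrite lee_fin.
  - exists B; split=> // x /= nx; apply: contrapT => xB; apply: nx => _.
    transitivity (h' x)%:E => //.
    by rewrite h'E (_ : x \notin B) ?mulr1// notin_setE.
apply: ereal_sup_ubound; exists h' => // x.
suff: ((h' x)%:E <= (G2 \_ D) x)%E by [].
rewrite h'E patchE; case: ifPn => Dx; last first.
  move: (hf x); rewrite patchE (negbTE Dx) !lee_fin => hx.
  by case: (x \notin B); rewrite /= ?mulr0 ?mulr1.
case: (boolP (x \in B)) => xB /=; first by rewrite mulr0; apply: f20; rewrite inE in Dx.
rewrite mulr1; move: (hf x); rewrite patchE Dx.
suff -> : G1 x = G2 x by [].
apply: contrapT => nf; move: xB; rewrite notin_setE; apply; apply: HB => H.
by apply: nf; apply: H; rewrite inE in Dx.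
Qed.

Lemma unit_vector_angle (x y : R) : x ^+ 2 + y ^+ 2 = 1 ->
  exists al, cos al = x /\ sin al = y.
Proof.
move=> xy.
have x1 : -1 <= x <= 1.
  by rewrite -ler_norml -(@ler_pXn2r _ 2) ?nnegrE// expr1n real_normK ?num_real//; have := sqr_ge0 y; lra.
have y2 : Num.sqrt (1 - x ^+ 2) = `|y| by rewrite -xy addrAC subrr add0r sqrtr_sqr.
have [y0|y0] := leP 0 y.
  by exists (acos x); rewrite acosK ?in_itv//= sin_acos// y2 ger0_norm.
by exists (- acos x); rewrite cosN sinN acosK ?in_itv//= sin_acos// y2 ltr0_norm// opprK.
Qed.

(** All that is used of a curve from here on. The density [k] of the angle [th] is taken with
    respect to the parameter, so it is the curvature times the speed [v], and [|k|^p v^(1-p)] is the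
    bending density. The pointwise curvature is identified almost everywhere only. *)
Record tangent_lift p a b g v th k : Prop := TangentLift {
  tl_cont1 : {within `[a, b], continuous (crd1 g)};
  tl_cont2 : {within `[a, b], continuous (crd2 g)};
  tl_speed : {within `[a, b], continuous v};
  tl_speed_gt0 : {in `[a, b], forall t, 0 < v t};
  tl_angle : AC a b th k;
  tl_derive1 : {in `]a, b[, forall t, is_derive t 1 (crd1 g) (v t * cos (th t))};
  tl_derive2 : {in `]a, b[, forall t, is_derive t 1 (crd2 g) (v t * sin (th t))};
  tl_integrable : mu.-integrable `[a, b] (EFin \o (fun t => `|k t| `^ p * v t `^ (1 - p)));
  tl_curvature : {ae mu, forall t, t \in `]a, b[ -> curvature g t = k t / v t}
}.

Lemma within_continuous_mul (A : set R) (f1 f2 : R -> R) :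
  {within A, continuous f1} -> {within A, continuous f2} ->
  {within A, continuous (fun x => f1 x * f2 x)}.
Proof. by move=> c1 c2 x; apply: cvgM; [exact: c1|exact: c2]. Qed.

Lemma within_continuous_add (A : set R) (f1 f2 : R -> R) :
  {within A, continuous f1} -> {within A, continuous f2} ->
  {within A, continuous (fun x => f1 x + f2 x)}.
Proof. by move=> c1 c2 x; apply: cvgD; [exact: c1|exact: c2]. Qed.

Lemma within_continuous_sqr (A : set R) (f1 : R -> R) :
  {within A, continuous f1} -> {within A, continuous (fun x => f1 x ^+ 2)}.
Proof. by move=> c1; under eq_fun do rewrite expr2; exact: within_continuous_mul. Qed.

Lemma within_continuous_inv (A : set R) (f1 : R -> R) :
  {within A, continuous f1} -> (forall x, A x -> f1 x != 0) ->
  {within A, continuous (fun x => (f1 x)^-1)}.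
Proof.
move=> c1 n0; apply: (@within_continuous_comp _ _ _ A f1 (@GRing.inv R)) => //.
move=> y; rewrite inE => /= yA; case: yA => x Ax <-; apply: inv_continuous.
exact: n0.
Qed.

Lemma is_derive_cosR (x : R) : is_derive x 1 (@cos R) (- sin x).
Proof. exact: is_derive_cos. Qed.

Lemma is_derive_sinR (x : R) : is_derive x 1 (@sin R) (cos x).
Proof. exact: is_derive_sin. Qed.

Lemma is_derive_expRN (x : R) : is_derive x 1 (fun y => expR (- y)) (- expR (- x)).
Proof.
have := is_derive_chain (is_derive_expR (- x)) (is_derive_opp (is_derive_idfun x)).
by rewrite mulrN1.
Qed.

Lemma AC_scale a b (r : R) (f w : R -> R) : a <= b -> AC a b f w ->
  AC a b (fun x => r * f x) (fun x => r * w x).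
Proof.
move=> ab A; have := AC_mul ab (AC_cst a b r) A.
by apply: eq_AC => x _ //=; rewrite mulr0 addr0.
Qed.

(* [z = exp(-i th) (v1 + i v2)] solves [z' = rho z] with [rho] real, so its
   argument is constant. *)
Lemma AC_angle a b (v1 v2 w1 w2 : R -> R) : a <= b ->
  AC a b v1 w1 -> AC a b v2 w2 ->
  (forall t, t \in `[a, b] -> v1 t ^+ 2 + v2 t ^+ 2 != 0) ->
  exists th, [/\ AC a b th (fun t => (v1 t * w2 t - v2 t * w1 t) / (v1 t ^+ 2 + v2 t ^+ 2)),
    {in `[a, b], forall t, v1 t = Num.sqrt (v1 t ^+ 2 + v2 t ^+ 2) * cos (th t)} &
    {in `[a, b], forall t, v2 t = Num.sqrt (v1 t ^+ 2 + v2 t ^+ 2) * sin (th t)}].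
Proof.
move=> ab A1 A2 N0.
have c1 := AC_continuous ab A1; have c2 := AC_continuous ab A2.
pose N t := v1 t ^+ 2 + v2 t ^+ 2.
have cN : {within `[a, b], continuous N}.
  by apply: within_continuous_add; exact: within_continuous_sqr.
have cNV : {within `[a, b], continuous (fun t => (N t)^-1)} by exact: within_continuous_inv.
pose k t := (v1 t * w2 t - v2 t * w1 t) / N t.
pose rho t := (v1 t * w1 t + v2 t * w2 t) / N t.
have ki : mu.-integrable `[a, b] (EFin \o k).
  rewrite (_ : k = fun t => (v1 t * (N t)^-1) * w2 t - (v2 t * (N t)^-1) * w1 t); last first.
    by apply/funext => t; rewrite /k; ring.
  by apply: integrableBR; (apply: integrable_mul_continuous; [exact: within_continuous_mul|]);
    [exact: A2.1|exact: A1.1].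
have rhoi : mu.-integrable `[a, b] (EFin \o rho).
  rewrite (_ : rho = fun t => (v1 t * (N t)^-1) * w1 t + (v2 t * (N t)^-1) * w2 t); last first.
    by apply/funext => t; rewrite /rho; ring.
  by apply: integrableDR; (apply: integrable_mul_continuous; [exact: within_continuous_mul|]);
    [exact: A1.1|exact: A2.1].
have aab : a \in `[a, b] by rewrite in_itv/= lexx.
have N_gt0 t : t \in `[a, b] -> 0 < N t.
  by move=> /N0; rewrite lt_def => ->; rewrite addr_ge0// sqr_ge0.
have s_gt0 t : t \in `[a, b] -> 0 < Num.sqrt (N t) by move=> /N_gt0; rewrite sqrtr_gt0.
have [al [cal sal]] : exists al, cos al = v1 a / Num.sqrt (N a) /\ sin al = v2 a / Num.sqrt (N a).
  apply: unit_vector_angle; rewrite !expr_div_n !sqr_sqrtr ?ltW ?N_gt0//.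
  by rewrite -mulrDl divff// N0.
pose th t := al + \int[mu]_(x in `[a, t]) k x.
pose P t := \int[mu]_(x in `[a, t]) rho x.
have Ath : AC a b th k by split=> // t tab; rewrite /th set_itv1 Rintegral_set1 addr0.
have AP : AC a b P rho by split=> // t tab; rewrite /P set_itv1 Rintegral_set1 add0r.
have AcN : AC a b (fun x => expR (- P x)) (fun x => - expR (- P x) * rho x).
  apply: (@AC_comp _ a b (fun y => expR (- y)) (fun y => - expR (- y)) P rho) => //.
    by move=> x; exact: is_derive_expRN.
  move=> x; apply: cvgN; apply: continuous_comp; last exact: continuous_expR.
  by apply: cvgN; exact: cvg_id.
have Acos : AC a b (fun x => cos (th x)) (fun x => - sin (th x) * k x).
  apply: (@AC_comp _ a b (@cos R) (fun y => - sin y) th k) => //.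
  by move=> x; apply: cvgN; exact: continuous_sin.
have Asin : AC a b (fun x => sin (th x)) (fun x => cos (th x) * k x).
  by apply: (@AC_comp _ a b (@sin R) (@cos R) th k) => //; exact: continuous_cos.
(* The imaginary part of [z], multiplied by the integrating factor [expR (- P)], has zero density;
   it vanishes at [a] by the choice of [al]. *)
have AS := AC_mul ab (AC_add ab (AC_mul ab A2 Acos) (AC_scale (-1) ab (AC_mul ab A1 Asin))) AcN.
have S0 : {in `[a, b], forall t, v2 t * cos (th t) - v1 t * sin (th t) = 0}.
  move=> t tab.
  have := AC_eq0 _ AS; rewrite /= => /(_ _ t tab).
  have tha : th a = al by rewrite /th set_itv1 Rintegral_set1 addr0.
  rewrite tha cal sal [X in _ = X](_ : _ = 0); last by ring.
  rewrite mulN1r => H.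
  have /eqP : (v2 t * cos (th t) - v1 t * sin (th t)) * expR (- P t) = 0.
    apply: H => s; rewrite in_itv/= => /andP[as_ sb].
    have sab : s \in `[a, b] by rewrite in_itv/= !ltW.
    have /N0 Ns := sab.
    by rewrite /k /rho /N; field.
  by rewrite mulf_eq0 (gt_eqF (expR_gt0 _)) orbF => /eqP.
have cth := AC_continuous ab Ath.
pose C t := v1 t * cos (th t) + v2 t * sin (th t).
have cC : {within `[a, b], continuous C}.
  apply: within_continuous_add; apply: within_continuous_mul => //.
    by apply: within_continuous_comp => // x _; exact: continuous_cos.
  by apply: within_continuous_comp => // x _; exact: continuous_sin.
have C2 t : t \in `[a, b] -> C t ^+ 2 = N t.
  move=> tab; rewrite /N.
  have -> : v1 t ^+ 2 + v2 t ^+ 2 = (v1 t ^+ 2 + v2 t ^+ 2) * (cos (th t) ^+ 2 + sin (th t) ^+ 2).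
    by rewrite cos2Dsin2 mulr1.
  have -> : (v1 t ^+ 2 + v2 t ^+ 2) * (cos (th t) ^+ 2 + sin (th t) ^+ 2) =
    C t ^+ 2 + (v2 t * cos (th t) - v1 t * sin (th t)) ^+ 2 by rewrite /C; ring.
  by rewrite S0// expr0n/= addr0.
have Ca : C a = Num.sqrt (N a).
  rewrite /C (_ : th a = al); last by rewrite /th set_itv1 Rintegral_set1 addr0.
  rewrite cal sal !mulrA -mulrDl -!expr2 -/(N a).
  by rewrite -{1}(sqr_sqrtr (ltW (N_gt0 a aab))) expr2 mulfK// gt_eqF// s_gt0.
(* The real part [C] of [z] satisfies [C^2 = N > 0], so it cannot change the sign it has at [a]. *)
have C0 t : t \in `[a, b] -> 0 <= C t.
  move=> tab; rewrite leNgt; apply/negP => Ct.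
  move: (tab); rewrite in_itv/= => /andP[at_ tb].
  have [|s sat Cs] := @IVT _ C a t 0 at_ (within_continuous_subitv (lexx a) tb cC).
    by rewrite ge_min le_max (ltW Ct) Ca sqrtr_ge0 orbT.
  have sab : s \in `[a, b].
    by move: sat; rewrite !in_itv/= => /andP[-> st]; rewrite (le_trans st tb).
  by have := N_gt0 s sab; rewrite -C2// Cs expr0n ltxx.
have CE t : t \in `[a, b] -> C t = Num.sqrt (N t).
  by move=> tab; rewrite -C2// sqrtr_sqr ger0_norm// C0.
have cs t : cos (th t) ^+ 2 = 1 - sin (th t) ^+ 2 by rewrite -(cos2Dsin2 (th t)) addrK.
exists th; split=> // t tab; rewrite -/(N t) -CE// /C.
  transitivity (v1 t + sin (th t) * (v2 t * cos (th t) - v1 t * sin (th t))).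
    by rewrite S0// mulr0 addr0.
  by rewrite mulrDl -mulrA -expr2 cs; ring.
transitivity (v2 t - cos (th t) * (v2 t * cos (th t) - v1 t * sin (th t))).
  by rewrite S0// mulr0 subr0.
by have := cs t; rewrite !expr2; move=> E; rewrite mulrBr mulrCA E; ring.
Qed.

Lemma curvature_tangent_lift g t (v1 v2 w1 w2 : R) :
  (crd1 g)^`()%classic t = v1 -> (crd2 g)^`()%classic t = v2 ->
  ((crd1 g)^`()^`())%classic t = w1 -> ((crd2 g)^`()^`())%classic t = w2 ->
  curvature g t = (v1 * w2 - v2 * w1) / Num.sqrt (v1 ^+ 2 + v2 ^+ 2) ^+ 3.
Proof. by move=> <- <- <- <-. Qed.

Lemma W2p_imm_tangent_lift p a b g : 1 < p -> a < b -> W2p_imm p a b g ->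
  exists v th k, tangent_lift p a b g v th k.
Proof.
move=> p1 ab [cg1 cg2 Wg1 Wg2 [v1 [v2 [cv1 cv2 dv1 dv2 vn0]]]].
have [w1 [A1 w1p]] := W2p_AC p1 ab Wg1 cg1 cv1 dv1.
have [w2 [A2 w2p]] := W2p_AC p1 ab Wg2 cg2 cv2 dv2.
have N0 t : t \in `[a, b] -> v1 t ^+ 2 + v2 t ^+ 2 != 0.
  move=> /vn0; apply: contraNN; rewrite paddr_eq0 ?sqr_ge0// !sqrf_eq0.
  by move=> /andP[/eqP -> /eqP ->].
have [th [Ath E1 E2]] := AC_angle (ltW ab) A1 A2 N0.
set N := fun t => v1 t ^+ 2 + v2 t ^+ 2.
pose v t := Num.sqrt (N t).
have N_gt0 t : t \in `[a, b] -> 0 < N t.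
  by move=> /N0; rewrite lt_def => ->; rewrite addr_ge0// sqr_ge0.
have v_gt0 t : t \in `[a, b] -> 0 < v t by move=> /N_gt0; rewrite sqrtr_gt0.
have cv : {within `[a, b], continuous v}.
  apply: within_continuous_comp; first by move=> x _; exact: sqrt_continuous.
  by apply: within_continuous_add; exact: within_continuous_sqr.
pose k t := (v1 t * w2 t - v2 t * w1 t) / N t.
have oocc t : t \in `]a, b[ -> t \in `[a, b].
  by rewrite !in_itv/= => /andP[/ltW -> /ltW ->].
have dE1 t : t \in `]a, b[ -> (crd1 g)^`()%classic t = v1 t.
  by move=> tab; exact: is_derive_derive1 (dv1 t tab).
have dE2 t : t \in `]a, b[ -> (crd2 g)^`()%classic t = v2 t.
  by move=> tab; exact: is_derive_derive1 (dv2 t tab).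
have ki : mu.-integrable `[a, b] (EFin \o k) by exact: Ath.1.
have mk : measurable_fun `[a, b] k by have /integrableP[/measurable_EFinP] := ki.
have cvp : {within `[a, b], continuous (fun t => v t `^ (1 - p))}.
  apply: (@within_continuous_comp _ _ _ `[a, b]%classic v (fun x => x `^ (1 - p))) => // y; rewrite inE => /= yA; case: yA => x xab <-.
  exact: is_derive_continuous (is_derive1_powR (1 - p) (v_gt0 x xab)).
(* With [M] a bound of [1 / v], [|k|] is at most [2 M] times the larger of [|w1|], [|w2|], whose
   p-th power is at most the sum of theirs. *)
have kpi : mu.-integrable `[a, b] (EFin \o (fun t => `|k t| `^ p)).
  have cNV : {within `[a, b], continuous (fun t => (v t)^-1)}.
    by apply: within_continuous_inv => // x xab; rewrite gt_eqF// v_gt0.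
  have [M [M0 HM]] := continuous_itv_bounded cNV.
  have ig : mu.-integrable `[a, b] (EFin \o (fun t => (2 * M) `^ p * (`|w1 t| `^ p + `|w2 t| `^ p))).
    by apply: integrableZR; exact: integrableDR.
  apply: le_integrable ig => //.
    apply/measurable_EFinP; apply: measurableT_comp (measurable_powR p) _.
    exact: measurableT_comp.
  move=> t tab /=; rewrite lee_fin [leLHS]ger0_norm ?powR_ge0//.
  rewrite [leRHS]ger0_norm ?mulr_ge0 ?addr_ge0 ?powR_ge0//.
  have tab' : t \in `[a, b] by [].
  have vt := v_gt0 t tab'.
  have kb : `|k t| <= 2 * M * Num.max `|w1 t| `|w2 t|.
    have Nv : N t = v t * v t by rewrite -expr2 sqr_sqrtr// ltW// N_gt0.
    have b1 : `|v1 t| <= v t by rewrite -sqrtr_sqr ler_wsqrtr// lerDl sqr_ge0.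
    have b2 : `|v2 t| <= v t by rewrite -sqrtr_sqr ler_wsqrtr// lerDr sqr_ge0.
    have num : `|v1 t * w2 t - v2 t * w1 t| <= 2 * v t * Num.max `|w1 t| `|w2 t|.
      rewrite -mulrA mulr_natl mulr2n; apply: le_trans (ler_normB _ _) _.
      by rewrite !normrM; apply: lerD; apply: ler_pM => //; rewrite le_max lexx ?orbT.
    rewrite /k normrM normfV (ger0_norm (ltW (N_gt0 t tab'))) Nv invfM.
    apply: (@le_trans _ _ (2 * v t * Num.max `|w1 t| `|w2 t| * ((v t)^-1 * (v t)^-1))).
      by rewrite ler_wpM2r// mulr_ge0// invr_ge0 ltW.
    set m := Num.max _ _.
    have -> : 2 * v t * m * ((v t)^-1 * (v t)^-1) = 2 * (v t)^-1 * m.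
      by field; rewrite gt_eqF.
    apply: ler_wpM2r; first by rewrite le_max normr_ge0.
    by rewrite ler_pM2l//; apply: le_trans (HM t tab'); exact: ler_norm.
  apply: (@le_trans _ _ ((2 * M * Num.max `|w1 t| `|w2 t|) `^ p)).
    have M20 : 0 <= 2 * M * Num.max `|w1 t| `|w2 t|.
      by rewrite mulr_ge0 ?le_max ?normr_ge0// mulr_ge0// ltW.
    have p0 : 0 <= p by rewrite (le_trans ler01)// ltW.
    by apply: (ge0_ler_powR p0 _ _ kb); rewrite nnegrE.
  rewrite powRM; [|by rewrite mulr_ge0// ltW|by rewrite le_max normr_ge0].
  rewrite ler_wpM2l ?powR_ge0//.
  by have [h|h] := leP `|w1 t| `|w2 t|; rewrite ?lerDl ?lerDr powR_ge0.
have kvi : mu.-integrable `[a, b] (EFin \o (fun t => `|k t| `^ p * v t `^ (1 - p))).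
  have := integrable_mul_continuous cvp kpi.
  by rewrite (_ : (fun t => v t `^ (1 - p) * `|k t| `^ p) = (fun t => `|k t| `^ p * v t `^ (1 - p)))//;
    apply/funext => t; rewrite mulrC.
exists v, th, k; split=> //.
- move=> t tab; have := dv1 t tab; rewrite E1//; exact: oocc.
- move=> t tab; have := dv2 t tab; rewrite E2//; exact: oocc.
have D1 := AC_derivable_ae ab A1; have D2 := AC_derivable_ae ab A2.
apply: (@filterS2 _ _ (ae_filter_ringOfSetsType mu) _ _ _ _ D1 D2).
move=> t d1 d2 tab.
have near_ab : \forall y \near t, y \in `]a, b[ by exact: near_in_itvoo.
have c1 : ((crd1 g)^`()^`())%classic t = w1 t.
  apply: is_derive_derive1; apply: is_derive_near (d1 tab).
  by apply: filterS near_ab => y yab; rewrite dE1.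
have c2 : ((crd2 g)^`()^`())%classic t = w2 t.
  apply: is_derive_derive1; apply: is_derive_near (d2 tab).
  by apply: filterS near_ab => y yab; rewrite dE2.
rewrite (curvature_tangent_lift (dE1 t tab) (dE2 t tab) c1 c2) -/(N t) -/(v t).
have vt := v_gt0 t (oocc t tab).
have Nv : N t = v t ^+ 2 by rewrite sqr_sqrtr// ltW// N_gt0// oocc.
by rewrite /k Nv; field; rewrite gt_eqF.
Qed.

Lemma integrable_measurable_oo a b f : mu.-integrable `[a, b] (EFin \o f) -> measurable_fun `]a, b[ f.
Proof.
move=> /integrableP[/measurable_EFinP mf _].
apply: measurable_funS mf => //.
by move=> x /=; rewrite !in_itv/= => /andP[/ltW -> /ltW ->].
Qed.

Section TangentLift.
Variables (p a b : R) (g : R -> R * R) (v th k : R -> R).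
Hypothesis T : tangent_lift p a b g v th k.

Lemma tangent_lift_speed : {in `]a, b[, speed g =1 v}.
Proof.
move=> t tab; have tab' : t \in `[a, b] by move: tab; rewrite !in_itv/= => /andP[/ltW -> /ltW ->].
rewrite /speed (is_derive_derive1 (tl_derive1 T tab)) (is_derive_derive1 (tl_derive2 T tab)).
by rewrite !exprMn -mulrDr cos2Dsin2 mulr1 sqrtr_sqr gtr0_norm// (tl_speed_gt0 T).
Qed.

Lemma tangent_lift_length : curve_length a b g = \int[mu]_(t in `[a, b]) v t.
Proof.
rewrite /curve_length -Rintegral_oo_cc; last exact: integrable_measurable_oo (continuous_itv_integrable (tl_speed T)).
by apply: eq_Rintegral => t; rewrite inE/= => tab; rewrite tangent_lift_speed.
Qed.

(** The pointwise curvature agrees with [k / v] almost everywhere; nonnegativity of both integrands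
    stands in for its measurability. *)
Lemma tangent_lift_bending :
  bending p a b g = \int[mu]_(t in `[a, b]) (`|k t| `^ p * v t `^ (1 - p)).
Proof.
rewrite -Rintegral_oo_cc; last exact: integrable_measurable_oo (tl_integrable T).
rewrite /bending /Rintegral; congr fine.
apply: ge0_ae_eq_integral_nonmeasurable.
- by move=> t _; rewrite lee_fin mulr_ge0 ?powR_ge0 ?sqrtr_ge0.
- by move=> t _; rewrite lee_fin mulr_ge0 ?powR_ge0.
apply: (@filterS _ _ (ae_filter_ringOfSetsType mu) _ _ _ (tl_curvature T)) => t ct tab.
have tab' : t \in `[a, b] by move: tab; rewrite /= !in_itv/= => /andP[/ltW -> /ltW ->].
have vt := tl_speed_gt0 T tab'; congr (_%:E).
rewrite ct// tangent_lift_speed//.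
rewrite normrM normfV (gtr0_norm vt) powRM// ?invr_ge0 ?(ltW vt)//.
rewrite -mulrA; congr (_ * _).
rewrite -powR_inv1 ?ltW// -powRrM -{2}(@powRr1 _ (v t)) ?ltW//.
rewrite -powRD; last by rewrite (gt_eqF vt) implybT.
by congr powR; ring.
Qed.

Lemma tangent_lift_sub c d : a <= c -> c < d -> d <= b -> tangent_lift p c d g v th k.
Proof.
move=> ac cd db; have sub t : t \in `[c, d] -> t \in `[a, b].
  by rewrite !in_itv/= => /andP[ct td]; rewrite (le_trans ac) ?(le_trans td).
have subo t : t \in `]c, d[ -> t \in `]a, b[.
  by rewrite !in_itv/= => /andP[ct td]; rewrite (le_lt_trans ac) ?(lt_le_trans td).
case: T => c1 c2 cv v0 Ath d1 d2 ki kE; split.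
- exact: within_continuous_subitv c1.
- exact: within_continuous_subitv c2.
- exact: within_continuous_subitv cv.
- by move=> t /sub; exact: v0.
- exact: AC_subitv (ltW cd) db Ath.
- by move=> t /subo; exact: d1.
- by move=> t /subo; exact: d2.
- exact: integrable_subitv ki.
- by apply: (@filterS _ _ (ae_filter_ringOfSetsType mu) _ _ _ kE) => t H /subo.
Qed.

End TangentLift.

End TangentAngle.

(** * Potentials and elliptic integrals *)

Section OrientedIntegral.
Context {R : realType}.
Implicit Types (a b c d s t x y : R) (f df F : R -> R).
Local Notation mu := (@lebesgue_measure R).

Lemma derive_ge0_le a b f df : a <= b -> {within `[a, b], continuous f} ->
  {in `]a, b[, forall x, is_derive x 1 f (df x)} ->
  {in `]a, b[, forall x, 0 <= df x} -> f a <= f b.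
Proof.
rewrite le_eqVlt => /predU1P[->//|ab] cf ddf df0.
by have [c cab E] := MVT ab ddf cf; rewrite -subr_ge0 E mulr_ge0 ?df0// subr_ge0 ltW.
Qed.

Lemma derive_gt0_lt a b f df : a < b -> {within `[a, b], continuous f} ->
  {in `]a, b[, forall x, is_derive x 1 f (df x)} ->
  {in `]a, b[, forall x, 0 < df x} -> f a < f b.
Proof.
move=> ab cf ddf df0.
by have [c cab E] := MVT ab ddf cf; rewrite -subr_gt0 E mulr_gt0 ?df0// subr_gt0.
Qed.

Lemma derive_eq0 a b f : {within `[a, b], continuous f} ->
  {in `]a, b[, forall x, is_derive x 1 f 0} -> {in `[a, b], forall x, f x = f a}.
Proof.
move=> cf df x; rewrite in_itv/= => /andP[]; rewrite le_eqVlt => /predU1P[->//|ax] xb.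
have [|c cab E] := @MVT _ f (fun=> 0) a x ax _ (within_continuous_subitv (lexx a) xb cf).
  move=> y; rewrite in_itv/= => /andP[ay yx]; apply: df.
  by rewrite in_itv/= ay (lt_le_trans yx xb).
by apply/eqP; rewrite -subr_eq0 E mul0r.
Qed.

Lemma integrable_itv_cat a b c f : a <= b -> b <= c ->
  mu.-integrable `[a, b] (EFin \o f) -> mu.-integrable `[b, c] (EFin \o f) ->
  mu.-integrable `[a, c] (EFin \o f).
Proof.
move=> ab bc /integrableP[m1 i1] /integrableP[m2 i2].
have E : `[a, c]%classic = `[a, b]%classic `|` `[b, c]%classic.
  apply/seteqP; split=> x /=; rewrite !in_itv/=.
    by move=> /andP[ax xc]; have [xb|bx] := leP x b; [left|right]; rewrite ?ax ?xc ?xb ?ltW.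
  by case=> /andP[h1 h2]; [rewrite h1 (le_trans h2 bc)|rewrite h2 (le_trans ab h1)].
have m : measurable_fun (`[a, b]%classic `|` `[b, c]%classic) (EFin \o f).
  by apply/measurable_funU.
have i1' : mu.-integrable setT (EFin \o (f \_ `[a, b])).
  by rewrite -restrict_EFin -integrable_mkcond//; apply/integrableP.
have i2' : mu.-integrable setT (EFin \o (f \_ `[b, c])).
  by rewrite -restrict_EFin -integrable_mkcond//; apply/integrableP.
have ig : mu.-integrable `[a, c] (EFin \o (fun x => `|(f \_ `[a, b]) x| + `|(f \_ `[b, c]) x|)).
  by apply: integrableDR; [have := integrable_norm i1'|have := integrable_norm i2'];
    apply: integrableS.
apply: le_integrable ig => //; first by rewrite E.
move=> x xac; rewrite /= lee_fin [leRHS]ger0_norm ?addr_ge0//.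
move: xac; rewrite E => -[xi|xi].
  by rewrite [in X in X + _]patchE mem_set// lerDl.
by rewrite [in X in _ + X]patchE mem_set// lerDr.
Qed.

(** An improper integral: [f] may blow up at [a] and [b]. On the intervals [G n] exhausting []a, b[]
    its integral is bounded by [F b - F a], and monotone convergence concludes. *)
Lemma integrable_of_antiderivative a b f F : a < b ->
  {in `]a, b[, forall x, 0 <= f x} -> {in `]a, b[, continuous f} ->
  {within `[a, b], continuous F} -> {in `]a, b[, forall x, is_derive x 1 F (f x)} ->
  mu.-integrable `[a, b] (EFin \o f).
Proof.
move=> ab f0 cf cF dF; apply: integrable_oo_cc.
(* Denominators starting at 3 keep [a + e n] below [b - e n]. *)
pose e n := (b - a) / (n.+3)%:R : R.
have e0 n : 0 < e n by rewrite divr_gt0// subr_gt0.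
have e2 n : e n <= (b - a) / 3.
  by rewrite ler_pM2l ?subr_gt0// lef_pV2 ?posrE// ler_nat.
pose G n := `[a + e n, b - e n]%classic : set R.
have mf : measurable_fun `]a, b[ f.
  apply: open_continuous_measurable_fun; first exact: interval_open.
  by move=> x; rewrite inE => xab; exact: cf.
have GE : \bigcup_n G n = `]a, b[%classic.
  apply/seteqP; split=> [x [n _]|x /=]; rewrite /G /= !in_itv/=.
    by move=> /andP[h1 h2]; rewrite (lt_le_trans _ h1) ?ltrDl// (le_lt_trans h2)// gtrBl.
  move=> /andP[ax xb]; pose m := Num.min (x - a) (b - x).
  have m0 : 0 < m by rewrite lt_min !subr_gt0 ax.
  have [n Hn] : exists n, e n < m.
    exists (Num.truncn ((b - a) / m)); rewrite /e ltr_pdivrMr// mulrC -ltr_pdivrMr//.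
    have h : 0 <= (b - a) / m by rewrite ltW// divr_gt0// subr_gt0.
    have /andP[_ H] := truncn_itv h.
    by apply: lt_trans H _; rewrite ltr_nat.
  exists n => //; rewrite /G/= in_itv/=; move: Hn; rewrite lt_min => /andP[h1 h2].
  by apply/andP; split; lra.
have Gsub n x : G n x -> x \in `]a, b[.
  by rewrite /G /= !in_itv/= => /andP[h1 h2]; rewrite (lt_le_trans _ h1) ?ltrDl// (le_lt_trans h2)// gtrBl.
apply/integrableP; split; first exact/measurable_EFinP.
have -> : (\int[mu]_(x in `]a, b[) `|(EFin \o f) x| = \int[mu]_(x in `]a, b[) (f x)%:E)%E.
  apply: eq_integral => x; rewrite inE/= => xab.
  by rewrite ger0_norm// f0.
have cv : (\int[mu]_(x in G i) (f x)%:E @[i --> \oo] --> \int[mu]_(x in \bigcup_i G i) (f x)%:E)%E.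
  apply: ge0_nondecreasing_set_cvg_integral.
  - move=> n m nm; apply/subsetPset => x; rewrite /G /= !in_itv/= => /andP[h1 h2].
    have : e m <= e n by rewrite ler_pM2l ?subr_gt0// lef_pV2 ?posrE// ler_nat.
    by move=> h; apply/andP; split; lra.
  - by move=> n; exact: measurable_itv.
  - by move=> n; apply/measurable_EFinP; apply: measurable_funS mf => // x /Gsub.
  - by move=> n x Gx; rewrite lee_fin; apply: f0; exact: Gsub Gx.
rewrite GE in cv.
have bound n : (\int[mu]_(x in G n) (f x)%:E <= (F b - F a)%:E)%E.
  have en := e0 n; have e2n := e2 n.
  have lt : a + e n <= b - e n by lra.
  have sub x y z : a <= x -> y <= b -> z \in `]x, y[ -> z \in `]a, b[.
    by rewrite !in_itv/= => ax yb /andP[xz zy]; rewrite (le_lt_trans ax xz) (lt_le_trans zy yb).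
  have cfn : {within `[a + e n, b - e n], continuous f}.
    apply: continuous_in_subspaceT => x; rewrite inE/= => xn.
    by apply: cf; exact: (Gsub n).
  have cFn : {within `[a + e n, b - e n], continuous F}.
    by apply: within_continuous_subitv cF; lra.
  have A : AC (a + e n) (b - e n) F f.
    apply: AC_of_derive => // x xn; apply: dF; apply: (sub _ _ _ _ _ xn); lra.
  have := A.2 (b - e n); rewrite in_itv/= lt lexx => /(_ isT) Fn.
  rewrite -[leLHS]fineK; last exact: integrable_fin_num A.1.
  have E : \int[mu]_(x in G n) f x = F (b - e n) - F (a + e n) by rewrite Fn; ring.
  rewrite lee_fin; apply: (@le_trans _ _ (F (b - e n) - F (a + e n))); first by rewrite -E.
  have F1 : F a <= F (a + e n).
    apply: (@derive_ge0_le _ _ _ f); first by lra.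
    - by apply: within_continuous_subitv cF; lra.
    - by move=> x xn; apply: dF; apply: (sub _ _ _ _ _ xn); lra.
    - by move=> x xn; apply: f0; apply: (sub _ _ _ _ _ xn); lra.
  have F2 : F (b - e n) <= F b.
    apply: (@derive_ge0_le _ _ _ f); first by lra.
    - by apply: within_continuous_subitv cF; lra.
    - by move=> x xn; apply: dF; apply: (sub _ _ _ _ _ xn); lra.
    - by move=> x xn; apply: f0; apply: (sub _ _ _ _ _ xn); lra.
  lra.
have : (\int[mu]_(x in `]a, b[) (f x)%:E <= (F b - F a)%:E)%E.
  rewrite -(cvg_lim _ cv)//; apply: lime_le; last by apply: nearW => n; exact: bound.
  by apply/cvg_ex; eexists; exact: cv.
by move=> /le_lt_trans; apply; rewrite ltry.
Qed.

Lemma oriented_integralB f a x y :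
  (forall s t, mu.-integrable `[s, t] (EFin \o f)) -> a <= 0 -> a <= x ->
  oriented_integral f x = \int[mu]_(t in `[a, x]) f t - \int[mu]_(t in `[a, 0]) f t.
Proof.
move=> fi a0 ax; rewrite /oriented_integral; have [x0|x0] := leP 0 x.
  by rewrite (Rintegral_itv_cat a0 x0)// addrAC subrr add0r.
by rewrite (Rintegral_itv_cat ax (ltW x0))// opprD addrA subrr add0r.
Qed.

Lemma oriented_integral_AC f a b :
  (forall s t, mu.-integrable `[s, t] (EFin \o f)) -> a <= b ->
  AC a b (oriented_integral f) f.
Proof.
move=> fi ab; split=> // t; rewrite in_itv/= => /andP[at_ tb].
pose m := Num.min a 0.
have m0 : m <= 0 by rewrite ge_min lexx orbT.
have ma : m <= a by rewrite ge_min lexx.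
rewrite !(@oriented_integralB f m _ 0)// ?(le_trans ma at_)//.
by rewrite (Rintegral_itv_cat ma at_)//; ring.
Qed.

Lemma oriented_integral_continuous f :
  (forall s t, mu.-integrable `[s, t] (EFin \o f)) -> continuous (oriented_integral f).
Proof.
move=> fi x; have ab : x - 1 < x + 1 by lra.
have := AC_continuous (ltW ab) (oriented_integral_AC fi (ltW ab)).
move=> /(continuous_within_itvP _ ab)[+ _ _]; apply.
by rewrite in_itv/=; apply/andP; split; lra.
Qed.

Lemma oriented_integral_derive f x :
  (forall s t, mu.-integrable `[s, t] (EFin \o f)) -> {for x, continuous f} ->
  is_derive x 1 (oriented_integral f) (f x).
Proof.
move=> fi cf; pose m := Num.min x 0 - 1.
have m0 : m <= 0 by rewrite lerBlDr ge_min; apply/orP; right; lra.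
have mx : m < x by rewrite ltrBlDr gt_min; apply/orP; left; lra.
have xx1 : x < x + 1 by lra.
have [dF dE] := continuous_FTC1_closed xx1 (fi m (x + 1)) mx cf.
have D : is_derive x 1 (fun y => \int[mu]_(t in `[m, y]) f t) (f x).
  exact: is_derive_of_derive1 dF dE.
have := is_derive_sub D (is_derive_const (\int[mu]_(t in `[m, 0]) f t) x).
rewrite subr0; apply: is_derive_near.
by apply: filterS (lt_nbhsr mx) => y my; rewrite (@oriented_integralB f m y)// ltW.
Qed.

Lemma oriented_integral0 f : oriented_integral f 0 = 0.
Proof. by rewrite /oriented_integral lexx set_itv1 Rintegral_set1. Qed.

Lemma continuous_integrable f s t : continuous f -> mu.-integrable `[s, t] (EFin \o f).
Proof. by move=> cf; apply: continuous_itv_integrable; exact: continuous_subspaceT. Qed.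

End OrientedIntegral.

(** * Convexity inequalities for powers *)

Section PowerInequalities.
Context {R : realType}.
Implicit Types (k x y p r e : R).

(** The derivative [dh] of the difference [h] has the sign of [y - 1], so [h] has a strict minimum
    at 1, where it vanishes. The logarithmic form is the one used to compare moduli. *)
Lemma ln_bernoulli_lt k x : k * (k - 1) > 0 -> 0 < x -> 0 < 1 + k * (x - 1) -> x != 1 ->
  ln (1 + k * (x - 1)) < k * ln x.
Proof.
move=> kk x0 kx0 x1.
pose h y := k * ln y - ln (1 + k * (y - 1)).
pose dh y := k * (k - 1) * (y - 1) / (y * (1 + k * (y - 1))).
(* The affine function [1 + k (y - 1)] is positive at 1 and at [x], hence in between. *)
have dom y : Num.min x 1 <= y -> y <= Num.max x 1 -> 0 < y /\ 0 < 1 + k * (y - 1).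
  have [x1'|x1'] := leP x 1 => xy yx; split; [exact: lt_le_trans xy| |lra| ].
    have [k0|k0] := leP 0 k; last by nra.
    apply: lt_le_trans kx0 _; rewrite lerD2l ler_wpM2l//; lra.
  have [k0|k0] := leP 0 k; first by nra.
  by apply: lt_le_trans kx0 _; rewrite lerD2l; nra.
have dhP y : 0 < y -> 0 < 1 + k * (y - 1) -> is_derive y 1 h (dh y).
  move=> y0 ky0.
  have d1 := is_derive_scale k (is_derive1_ln y0).
  have d2 := is_derive_add (is_derive_const 1 y) (is_derive_scale k (is_derive_sub (is_derive_idfun y) (is_derive_const 1 y))).
  have d3 := @is_derive_chain R (@ln R) (fun y => 1 + k * (y - 1)) y _ _ (is_derive1_ln ky0) d2.
  apply: is_derive_eq (is_derive_sub d1 d3) _.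
  by rewrite /dh subr0 add0r; field; rewrite !gt_eqF.
have cont a b : Num.min x 1 <= a -> b <= Num.max x 1 -> {within `[a, b], continuous h}.
  move=> xa bx; apply: derivable_within_continuous => y; rewrite in_itv/= => /andP[ay yb].
  by have [y0 ky0] := dom y (le_trans xa ay) (le_trans yb bx); have [] := dhP y y0 ky0.
have h1 : h 1 = 0 by rewrite /h subrr mulr0 addr0 ln1 mulr0 subrr.
suff : 0 < h x by rewrite subr_gt0.
rewrite -h1; move: x1; rewrite neq_lt => /orP[x1|x1].
  rewrite -ltrN2.
  apply: (@derive_gt0_lt _ _ _ (fun y => - h y) (fun y => - dh y)) => //.
  - move=> y; apply: cvgN; apply: cont; by rewrite ?ge_min ?le_max lexx ?orbT.
  - move=> y; rewrite in_itv/= => /andP[xy y1].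
    have [|| y0 ky0] := dom y; rewrite ?ge_min ?le_max ?(ltW xy) ?(ltW y1) ?orbT//.
    by apply: is_derive_opp; exact: dhP.
  - move=> y; rewrite in_itv/= => /andP[xy y1].
    have [|| y0 ky0] := dom y; rewrite ?ge_min ?le_max ?(ltW xy) ?(ltW y1) ?orbT//.
    rewrite /dh -mulNr -mulrN opprB; apply: divr_gt0; last exact: mulr_gt0.
    by apply: mulr_gt0 => //; rewrite subr_gt0.
apply: (@derive_gt0_lt _ _ _ h dh) => //.
- by apply: cont; rewrite ?ge_min ?le_max lexx ?orbT.
- move=> y; rewrite in_itv/= => /andP[xy y1].
  have [|| y0 ky0] := dom y; rewrite ?ge_min ?le_max ?(ltW xy) ?(ltW y1) ?orbT//.
  exact: dhP.
- move=> y; rewrite in_itv/= => /andP[xy y1].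
  have [|| y0 ky0] := dom y; rewrite ?ge_min ?le_max ?(ltW xy) ?(ltW y1) ?orbT//.
  rewrite /dh; apply: divr_gt0; last exact: mulr_gt0.
  by apply: mulr_gt0 => //; rewrite subr_gt0.
Qed.

Lemma powR_expR_ln x k : 0 < x -> x `^ k = expR (k * ln x).
Proof. by move=> x0; rewrite /powR gt_eqF. Qed.

Lemma bernoulli_lt k x : k * (k - 1) > 0 -> 0 < x -> x != 1 -> 1 + k * (x - 1) < x `^ k.
Proof.
move=> kk x0 x1; have [h|h] := ltP 0 (1 + k * (x - 1)); last first.
  exact: le_lt_trans h (powR_gt0 k x0).
by rewrite powR_expR_ln// -ltr_ln ?posrE ?expR_gt0// expRK ln_bernoulli_lt.
Qed.

(** Bernoulli's inequality for [x / y], rescaled by [y^k]. The condition on [k] covers [k = p], for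
    Young's inequality, and [k = 1 - p], for combining the lengths of the loops. *)
Lemma tangent_powR_lt k x y : k * (k - 1) > 0 -> 0 < x -> 0 < y -> x != y ->
  k * x * y `^ (k - 1) - (k - 1) * y `^ k < x `^ k.
Proof.
move=> kk x0 y0 xy.
have := @bernoulli_lt k (x / y) kk (divr_gt0 x0 y0).
rewrite -subr_eq0 -[X in _ - X](divff (lt0r_neq0 y0)) -mulrBl mulf_eq0 invr_eq0 (gt_eqF y0).
rewrite orbF subr_eq0 xy => /(_ isT).
have -> : x `^ k = (x / y) `^ k * y `^ k.
  by rewrite -powRM ?divfK ?gt_eqF// ltW// divr_gt0.
have yk : 0 < y `^ k by exact: powR_gt0.
rewrite -(ltr_pM2r yk); apply: le_lt_trans.
have -> : y `^ (k - 1) = y `^ k / y.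
  by rewrite powRB ?(gt_eqF y0) ?implybT// powRr1// ltW.
by rewrite le_eqVlt; apply/orP; left; apply/eqP; field; rewrite gt_eqF.
Qed.

Lemma young_powR p x y : 1 < p -> 0 <= x -> 0 <= y ->
  p * x * y `^ (p - 1) - (p - 1) * y `^ p <= x `^ p ?= iff (x == y).
Proof.
move=> p1; have pn0 : p != 0 by rewrite gt_eqF// (lt_trans ltr01).
have p1n0 : p - 1 != 0 by rewrite gt_eqF// subr_gt0.
have kk : p * (p - 1) > 0 by rewrite mulr_gt0 ?subr_gt0// (lt_trans ltr01).
rewrite le_eqVlt => /predU1P[<-|x0]; rewrite le_eqVlt => /predU1P[<-|y0].
- by rewrite !powR0// !mulr0 ?mul0r subrr eqxx; apply/leifP.
- rewrite powR0// mulr0 ?mul0r sub0r (lt_eqF y0); apply/leifP.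
  by rewrite oppr_lt0 mulr_gt0 ?subr_gt0// powR_gt0.
- rewrite !powR0// !mulr0 subrr (gt_eqF x0); apply/leifP.
  exact: powR_gt0.
- case: (eqVneq x y) => [->|xy]; apply/leifP; last exact: tangent_powR_lt.
  have E := mulr_powRB1 (ltW y0) (lt_trans ltr01 p1).
  by apply/eqP; rewrite -E; ring.
Qed.

Lemma powR_max0_cvg0 r : 0 < r -> forall e, 0 < e -> exists d, 0 < d /\
  forall x, `|x| < d -> `|x| `^ r < e.
Proof.
move=> r0 e e0; exists (e `^ r^-1); split; first exact: powR_gt0.
move=> x xd; have -> : e = (e `^ r^-1) `^ r by rewrite -powRrM mulVf ?gt_eqF// powRr1// ltW.
by apply: gt0_ltr_powR => //; rewrite nnegrE// powR_ge0.
Qed.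

Lemma continuous_powR_pos r x : 0 < x -> {for x, continuous (fun y => y `^ r)}.
Proof. by move=> x0; exact: is_derive_continuous (is_derive1_powR r x0). Qed.

Lemma continuous_normr_powR r : 0 < r -> continuous (fun x => `|x| `^ r).
Proof.
move=> r0 x; have [->|x0] := eqVneq x 0.
  rewrite /continuous_at normr0 powR0 ?gt_eqF//; apply/cvgrPdist_lt => e e0.
  have [d [d0 Hd]] := powR_max0_cvg0 r0 e0.
  exists d => //= y; rewrite /= sub0r normrN => yd.
  by rewrite sub0r normrN ger0_norm ?powR_ge0// Hd.
apply: (@continuous_comp _ _ _ (fun x : R => `|x|) (fun y => y `^ r)).
  exact: norm_continuous.
by apply: continuous_powR_pos; rewrite normr_gt0.
Qed.

Lemma continuous_normr_powR_mul r : -1 < r -> continuous (fun x => `|x| `^ r * x).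
Proof.
move=> r1 x; have [->|x0] := eqVneq x 0.
  rewrite /continuous_at mulr0; apply/cvgrPdist_lt => e e0.
  have r10 : 0 < r + 1 by lra.
  have [d [d0 Hd]] := powR_max0_cvg0 r10 e0.
  exists d => //= y; rewrite /= sub0r normrN => yd.
  rewrite sub0r normrN normrM ger0_norm ?powR_ge0//.
  have [->|y0] := eqVneq y 0; first by rewrite normr0 mulr0.
  have := Hd y yd; rewrite powRD; last by rewrite normr_eq0 y0 implybT.
  by rewrite powRr1.
apply: cvgM; last exact: cvg_id.
apply: (@continuous_comp _ _ _ (fun x : R => `|x|) (fun y => y `^ r)).
  exact: norm_continuous.
by apply: continuous_powR_pos; rewrite normr_gt0.
Qed.

End PowerInequalities.

Section Potential.
Context {R : realType}.
Implicit Types (r a x : R).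

(** With [r = 1 - 1 / p] this is the weight of [|k|] in the Young inequality. The positive part
    makes the potential nondecreasing on the whole line, also when the angle ranges beyond [pi]. *)
Definition well r a x := Num.max 0 (cos x + a) `^ r.
Definition potential r a := oriented_integral (well r a).

Lemma well_ge0 r a x : 0 <= well r a x.
Proof. exact: powR_ge0. Qed.

Lemma continuous_well r a : 0 < r -> continuous (well r a).
Proof.
move=> r0.
have cm : continuous (fun x : R => Num.max 0 (cos x + a)).
  apply: continuous_max0 => x; apply: cvgD; [exact: continuous_cos|exact: cvg_cst].
have -> : well r a = (fun x => `|Num.max 0 (cos x + a)| `^ r).
  by apply/funext => x; rewrite /well ger0_norm// le_max lexx.
move=> x; apply: (@continuous_comp _ _ _ (fun x : R => Num.max 0 (cos x + a)) (fun y => `|y| `^ r)); first exact: cm.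
exact: continuous_normr_powR.
Qed.

Lemma potential_derive r a x : 0 < r -> is_derive x 1 (potential r a) (well r a x).
Proof.
move=> r0; apply: oriented_integral_derive; last exact: continuous_well.
by move=> s t; apply: continuous_integrable; exact: continuous_well.
Qed.

Lemma continuous_potential r a : 0 < r -> continuous (potential r a).
Proof. by move=> r0 x; exact: is_derive_continuous (potential_derive a x r0). Qed.

Lemma potentialN r a x : 0 < r -> potential r a (- x) = - potential r a x.
Proof.
move=> r0; apply/eqP; rewrite -subr_eq0 opprK; apply/eqP.
pose h y := potential r a (- y) + potential r a y.
have dh (y : R) : is_derive y 1 h 0.
  have := is_derive_add (is_derive_chain (potential_derive a (- y) r0) (is_derive_opp (is_derive_idfun y)))
    (potential_derive a y r0).
  by rewrite /well cosN mulrN1 addNr.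
rewrite -/(h x) (is_derive_0_is_cst x 0 dh) /h oppr0 /potential.
by rewrite oriented_integral0 addr0.
Qed.

End Potential.

(** * Integrability of powers of the cosine *)

Section EllipticIntegrals.
Context {R : realType}.
Implicit Types (a b c d s t x y p q e : R).
Local Notation mu := (@lebesgue_measure R).

Lemma is_derive_sqrt x : 0 < x -> is_derive x 1 (@Num.sqrt R) ((2 * Num.sqrt x)^-1).
Proof.
move=> x0; have D := is_derive1_powR (2^-1) x0.
have -> : (2 * Num.sqrt x)^-1 = 2^-1 * x `^ (2^-1 - 1).
  rewrite invfM -(powR12_sqrt (ltW x0)) -powRN; congr (_ * _ `^ _).
  by lra.
apply: is_derive_near D.
by apply: filterS (lt_nbhsr x0) => y y0; rewrite powR12_sqrt// ltW.
Qed.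

Lemma is_derive_normr_powR_mul e y : y != 0 ->
  is_derive y 1 (fun y => `|y| `^ e * y) ((e + 1) * `|y| `^ e).
Proof.
have pos (z : R) : 0 < z -> is_derive z 1 (fun y => `|y| `^ e * y) ((e + 1) * `|z| `^ e).
  move=> z0; have D := is_derive1_powR (e + 1) z0; rewrite addrK in D.
  rewrite gtr0_norm//; apply: is_derive_near D.
  apply: filterS (lt_nbhsr z0) => w w0; rewrite gtr0_norm// powRD ?powRr1 ?ltW//.
  by rewrite (gt_eqF w0) implybT.
rewrite neq_lt => /orP[y0|]; last exact: pos.
have ny0 : 0 < - y by rewrite oppr_gt0.
have D := is_derive_opp (is_derive_chain (pos _ ny0) (is_derive_opp (is_derive_idfun y))).
rewrite mulrN1 opprK normrN in D.
have -> : (fun y => `|y| `^ e * y) = (fun y => - (`|- y| `^ e * - y)) => //.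
by apply/funext => w; rewrite normrN mulrN opprK.
Qed.

Lemma cos_neq0_itv (n : nat) x : x \in `]pi *+ n - pi / 2, pi *+ n + pi / 2[ -> cos x != 0.
Proof.
rewrite in_itv/= => /andP[h1 h2].
have -> : x = (x - pi *+ n) + pi *+ n by rewrite subrK.
rewrite (alternatingn (@cosDpi R)) mulf_neq0// ?signr_eq0// gt_eqF// cos_gt0_pihalf//.
by apply/andP; split; lra.
Qed.

Lemma is_derive_normr_cos_powR e x : cos x != 0 ->
  is_derive x 1 (fun x => `|cos x| `^ e * cos x) (- ((e + 1) * `|cos x| `^ e * sin x)).
Proof.
move=> cx; have := @is_derive_chain R (fun y => `|y| `^ e * y) (@cos R) x _ _
  (is_derive_normr_powR_mul e cx) (is_derive_cosR x).
by rewrite mulrN.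
Qed.

Lemma continuous_normr_cos_powR e : 0 < e -> continuous (fun x : R => `|cos x| `^ e).
Proof.
move=> e0 x; apply: (@continuous_comp _ _ _ (@cos R) (fun y => `|y| `^ e)).
  exact: continuous_cos.
exact: continuous_normr_powR.
Qed.

Lemma continuous_normr_cos_powR_neq0 e x : cos x != 0 ->
  {for x, continuous (fun x : R => `|cos x| `^ e)}.
Proof.
move=> cx; apply: (@continuous_comp _ _ _ (fun x : R => `|cos x|) (fun y => y `^ e)).
  by apply: (@continuous_comp _ _ _ (@cos R) (fun y => `|y|)); [exact: continuous_cos|exact: norm_continuous].
by apply: continuous_powR_pos; rewrite normr_gt0.
Qed.

(** For [e < 0] the zeros of the cosine are singular. Integration by parts expresses an
    antiderivative [G] through the regular power [e + 2]; it is continuous across the zeros because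
    [e > -1]. This gives integrability between consecutive zeros, and the pieces are glued. *)
Lemma integrable_normr_cos_powR e s t : -1 < e ->
  mu.-integrable `[s, t] (EFin \o (fun x => `|cos x| `^ e)).
Proof.
move=> e1; pose C := oriented_integral (fun x : R => `|cos x| `^ (e + 2)).
have e2 : 0 < e + 2 by lra.
have e10 : e + 1 != 0 by rewrite gt_eqF//; lra.
have dC x : is_derive x 1 C (`|cos x| `^ (e + 2)).
  apply: oriented_integral_derive; last exact: continuous_normr_cos_powR.
  by move=> ? ?; apply: continuous_integrable; exact: continuous_normr_cos_powR.
pose G x := (e + 1)^-1 * ((e + 2) * C x - `|cos x| `^ e * cos x * sin x).
have cG : continuous G.
  move=> x; apply: cvgM; first exact: cvg_cst.
  apply: cvgB; first by apply: cvgM; [exact: cvg_cst|exact: is_derive_continuous (dC x)].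
  apply: cvgM; last exact: continuous_sin.
  apply: (@continuous_comp _ _ _ (@cos R) (fun y => `|y| `^ e * y)); first exact: continuous_cos.
  exact: continuous_normr_powR_mul.
have dG x : cos x != 0 -> is_derive x 1 G (`|cos x| `^ e).
  move=> cx.
  have D := is_derive_scale (e + 1)^-1 (is_derive_sub (is_derive_scale (e + 2) (dC x))
     (is_derive_mul (is_derive_normr_cos_powR e cx) (is_derive_sinR x))).
  apply: is_derive_eq D _.
  rewrite powRD; last by rewrite normr_eq0 cx implybT.
  rewrite (_ : `|cos x| `^ 2 = 1 - sin x ^+ 2); last first.
    by rewrite (@powR_mulrn _ _ 2)// real_normK ?num_real// -(cos2Dsin2 x) addrK.
  have -> : `|cos x| `^ e * cos x * cos x = `|cos x| `^ e * (1 - sin x ^+ 2).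
    by rewrite -mulrA -expr2 -(cos2Dsin2 x) addrK.
  by field.
have Ipos (n : nat) : mu.-integrable `[pi *+ n - pi / 2, pi *+ n + pi / 2] (EFin \o (fun x => `|cos x| `^ e)).
  apply: (@integrable_of_antiderivative _ _ _ _ G).
  - by rewrite ltrD2l; have := @pi_gt0 R; lra.
  - by move=> x _; exact: powR_ge0.
  - by move=> x /cos_neq0_itv; exact: continuous_normr_cos_powR_neq0.
  - exact: continuous_subspaceT.
  - by move=> x /cos_neq0_itv; exact: dG.
have Ineg (n : nat) : mu.-integrable `[- (pi *+ n) - pi / 2, - (pi *+ n) + pi / 2] (EFin \o (fun x => `|cos x| `^ e)).
  have cn0 x : x \in `]- (pi *+ n) - pi / 2, - (pi *+ n) + pi / 2[ -> cos x != 0.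
    rewrite in_itv/= => /andP[h1 h2]; rewrite -cosN; apply: (@cos_neq0_itv n).
    by rewrite in_itv/=; apply/andP; split; lra.
  apply: (@integrable_of_antiderivative _ _ _ _ G).
  - by rewrite ltrD2l; have := @pi_gt0 R; lra.
  - by move=> x _; exact: powR_ge0.
  - by move=> x /cn0; exact: continuous_normr_cos_powR_neq0.
  - exact: continuous_subspaceT.
  - by move=> x /cn0; exact: dG.
have pi0 := @pi_gt0 R.
have Jpos (n : nat) : mu.-integrable `[- pi / 2, pi *+ n + pi / 2] (EFin \o (fun x => `|cos x| `^ e)).
  elim: n => [|n IH]; first by have := Ipos 0%N; rewrite mulr0n !add0r mulNr.
  apply: (integrable_itv_cat _ _ IH); last first.
  - have := Ipos n.+1; rewrite (_ : pi *+ n.+1 - pi / 2 = pi *+ n + pi / 2)//.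
    by rewrite mulrS; lra.
  - by rewrite mulrS; lra.
  - have := mulrn_wge0 n (ltW pi0); lra.
have Jneg (n : nat) : mu.-integrable `[- (pi *+ n) - pi / 2, pi / 2] (EFin \o (fun x => `|cos x| `^ e)).
  elim: n => [|n IH]; first by have := Ineg 0%N; rewrite mulr0n oppr0 !add0r.
  apply: (@integrable_itv_cat _ _ (- (pi *+ n) - pi / 2)) IH.
  - by rewrite mulrS; lra.
  - have := mulrn_wge0 n (ltW pi0); lra.
  - have := Ineg n.+1; rewrite (_ : - (pi *+ n.+1) + pi / 2 = - (pi *+ n) - pi / 2)//.
    by rewrite mulrS; lra.
pose n := (Num.truncn `|s| + Num.truncn `|t|).+1.
have hn : `|s| <= pi *+ n /\ `|t| <= pi *+ n.
  have hh x : 0 <= x -> x <= pi *+ (Num.truncn x).+1.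
    move=> x0; have /andP[_ /ltW H] := truncn_itv x0; apply: le_trans H _.
    by rewrite -[leRHS]mulr_natl ler_peMr// (le_trans _ (@pi_ge2 R))// ler1n.
  have mono (k l : nat) : (k <= l)%N -> pi *+ k <= pi *+ l :> R by move=> kl; rewrite -(subnK kl) mulrnDr lerDr mulrn_wge0// ltW.
  split; apply: le_trans (hh _ (normr_ge0 _)) _; apply: mono; rewrite /n ltnS.
    exact: leq_addr.
  exact: leq_addl.
have J : mu.-integrable `[- (pi *+ n) - pi / 2, pi *+ n + pi / 2] (EFin \o (fun x => `|cos x| `^ e)).
  apply: (@integrable_itv_cat _ _ (pi / 2)) => //.
  - have := mulrn_wge0 n (ltW pi0); lra.
  - have := mulrn_wge0 n (ltW pi0); lra.
  - apply: (integrable_subitv _ (lexx _) (Jpos n)); lra.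
case: hn; rewrite !ler_norml => /andP[h1 h2] /andP[h3 h4].
by apply: (integrable_subitv _ _ J); lra.
Qed.

End EllipticIntegrals.

(** * Incomplete elliptic integrals and the closing condition *)

Section EllipticFunctions.
Context {R : realType}.
Implicit Types (a b c d s t x y p q e : R).
Local Notation mu := (@lebesgue_measure R).

Definition delta q x := Num.sqrt (1 - q ^+ 2 * sin x ^+ 2).

Lemma sqr_sin_le1 x : 0 <= sin x ^+ 2 <= 1.
Proof. by rewrite sqr_ge0 sin2cos2 lerBlDr lerDl sqr_ge0. Qed.

Lemma delta_arg_gt0 q x : 0 <= q < 1 -> 0 < 1 - q ^+ 2 * sin x ^+ 2.
Proof.
move=> /andP[q0 q1]; have /andP[s0 s1] := sqr_sin_le1 x.
have q21 : q ^+ 2 < 1 by rewrite exprn_ilt1.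
rewrite subr_gt0; apply: le_lt_trans q21.
by rewrite -[leRHS]mulr1 ler_wpM2l// sqr_ge0.
Qed.

Lemma delta_gt0 q x : 0 <= q < 1 -> 0 < delta q x.
Proof. by move=> q01; rewrite sqrtr_gt0 delta_arg_gt0. Qed.

Lemma delta_le1 q x : delta q x <= 1.
Proof.
by rewrite -[leRHS]sqrtr1 ler_wsqrtr// lerBlDr lerDl mulr_ge0// sqr_ge0.
Qed.

Lemma sqr_delta q x : 0 <= q < 1 -> delta q x ^+ 2 = 1 - q ^+ 2 * sin x ^+ 2.
Proof. by move=> q01; rewrite sqr_sqrtr// ltW// delta_arg_gt0. Qed.

Lemma continuous_delta q : continuous (delta q).
Proof.
move=> x; apply: (@continuous_comp _ _ _ (fun x => 1 - q ^+ 2 * sin x ^+ 2) (@Num.sqrt R)); last exact: sqrt_continuous.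
apply: cvgB; first exact: cvg_cst.
by apply: cvgM; [exact: cvg_cst|apply: cvg_exprn; exact: continuous_sin].
Qed.

Lemma is_derive_delta q x : 0 < 1 - q ^+ 2 * sin x ^+ 2 ->
  is_derive x 1 (delta q) (- (q ^+ 2 * sin x * cos x) / delta q x).
Proof.
move=> h0.
have D := @is_derive_chain R (@Num.sqrt R) (fun x => 1 - q ^+ 2 * sin x ^+ 2) x _ _ (is_derive_sqrt h0)
  (is_derive_sub (is_derive_const 1 x) (is_derive_scale (q ^+ 2) (is_derive_pow 2 (is_derive_sinR x)))).
apply: is_derive_eq D _; rewrite -/(delta q x) sub0r /= expr1; field.
by rewrite gt_eqF// sqrtr_gt0.
Qed.

Lemma continuous_deltaV q : 0 <= q < 1 -> continuous (fun x => (delta q x)^-1).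
Proof.
move=> q01 x; apply: (@continuous_comp _ _ _ (delta q) (@GRing.inv R)).
  exact: continuous_delta.
by apply: inv_continuous; rewrite gt_eqF// delta_gt0.
Qed.

Lemma F1E p x q : F1 p x q = oriented_integral (fun th => `|cos th| `^ (1 - 2 / p) / delta q th) x.
Proof. by []. Qed.

Lemma exponent_bounds p : 1 < p -> -1 < 1 - 2 / p < 1.
Proof.
move=> p1; have p0 : 0 < p by lra.
have h : 2 / p < 2 by rewrite ltr_pdivrMr//; lra.
have h' : 0 < 2 / p by rewrite divr_gt0.
by apply/andP; split; lra.
Qed.

Lemma integrable_F1 p q s t : 1 < p -> 0 <= q < 1 ->
  mu.-integrable `[s, t] (EFin \o (fun th => `|cos th| `^ (1 - 2 / p) / delta q th)).
Proof.
move=> p1 q01; have /andP[e1 _] := exponent_bounds p1.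
rewrite (_ : (fun th => _) = (fun th => (delta q th)^-1 * `|cos th| `^ (1 - 2 / p))); last first.
  by apply/funext => th; rewrite mulrC.
apply: integrable_mul_continuous; last exact: integrable_normr_cos_powR.
by apply: continuous_subspaceT; exact: continuous_deltaV.
Qed.

Lemma integrable_E1 p q s t : 1 < p ->
  mu.-integrable `[s, t] (EFin \o (fun th => delta q th * `|cos th| `^ (1 - 2 / p))).
Proof.
move=> p1; have /andP[e1 _] := exponent_bounds p1.
apply: integrable_mul_continuous; last exact: integrable_normr_cos_powR.
by apply: continuous_subspaceT; exact: continuous_delta.
Qed.

Lemma continuous_F1 p q : 1 < p -> 0 <= q < 1 -> continuous (F1 p ^~ q).
Proof. by move=> p1 q01; apply: oriented_integral_continuous => s t; exact: integrable_F1. Qed.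

Lemma continuous_E1 p q : 1 < p -> continuous (E1 p ^~ q).
Proof. by move=> p1; apply: oriented_integral_continuous => s t; exact: integrable_E1. Qed.

Lemma is_derive_F1 p q x : 1 < p -> 0 <= q < 1 -> cos x != 0 ->
  is_derive x 1 (F1 p ^~ q) (`|cos x| `^ (1 - 2 / p) / delta q x).
Proof.
move=> p1 q01 cx; apply: oriented_integral_derive.
  by move=> s t; exact: integrable_F1.
by apply: cvgM; [exact: continuous_normr_cos_powR_neq0|exact: continuous_deltaV].
Qed.

Lemma is_derive_E1 p q x : 1 < p -> cos x != 0 ->
  is_derive x 1 (E1 p ^~ q) (delta q x * `|cos x| `^ (1 - 2 / p)).
Proof.
move=> p1 cx; apply: oriented_integral_derive.
  by move=> s t; exact: integrable_E1.
by apply: cvgM; [exact: continuous_delta|exact: continuous_normr_cos_powR_neq0].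
Qed.

Lemma F1_0 p q : F1 p 0 q = 0. Proof. exact: oriented_integral0. Qed.
Lemma E1_0 p q : E1 p 0 q = 0. Proof. exact: oriented_integral0. Qed.

Lemma cos_neq0_pihalf x : x \in `]- (pi / 2), pi / 2[ -> cos x != 0.
Proof. by rewrite in_itv/= => /cos_gt0_pihalf; rewrite lt0r => /andP[]. Qed.

Lemma exists_cos_neq0 x y : x < y -> exists t, t \in `[x, y] /\ cos t != 0.
Proof.
move=> xy; apply: contrapT => H.
have c0 t : t \in `[x, y] -> cos t = 0.
  by move=> tx; apply/eqP; apply: contrapT => ct; apply: H; exists t; split=> //; apply/negP.
pose m := (x + y) / 2.
have mxy : m \in `]x, y[ by rewrite in_itv/= /m; apply/andP; split; lra.
have D : is_derive m 1 (@cos R) 0.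
  apply: is_derive_near (is_derive_const 0 m).
  have : nbhs m `]x, y[%classic by apply: near_in_itvoo.
  apply: filterS => z /=; rewrite in_itv/= => /andP[h1 h2]; rewrite c0// in_itv/=.
  by rewrite !ltW.
have := is_derive1_uniq D (is_derive_cosR m) => /esym/eqP; rewrite oppr_eq0 => /eqP s0.
have := cos2Dsin2 m; rewrite s0 c0; last by move: mxy; rewrite !in_itv/= => /andP[/ltW -> /ltW ->].
by rewrite !expr0n/= addr0 => /esym/eqP; rewrite oner_eq0.
Qed.

Lemma normr_cos_le_powR e x : e < 1 -> `|cos x| <= `|cos x| `^ e.
Proof.
move=> e1; have [->|c0] := eqVneq (cos x) 0; first by rewrite normr0 powR_ge0.
by apply: ger1_powR; rewrite ?normr_gt0 ?c0 ?cos_max// ltW.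
Qed.

(** The density is at least [|cos|], since the exponent is below 1 and [delta] is at most 1; and
    [|cos|] does not vanish identically on any interval. *)
Lemma F1_lt p q x y : 1 < p -> 0 <= q < 1 -> x < y -> F1 p x q < F1 p y q.
Proof.
move=> p1 q01 xy; have /andP[_ e1] := exponent_bounds p1.
have A := oriented_integral_AC (fun s t => integrable_F1 s t p1 q01) (ltW xy).
rewrite -subr_gt0 !F1E (AC_sub A)// ?ltW//.
have cc : continuous (fun t : R => `|cos t|).
  by move=> t; apply: (@continuous_comp _ _ _ (@cos R) (fun y => `|y|)); [exact: continuous_cos|exact: norm_continuous].
have [t [txy ct]] := exists_cos_neq0 xy.
apply: (@lt_le_trans _ _ (\int[mu]_(t in `[x, y]) `|cos t|)).
  apply: (@Rintegral_gt0 _ _ _ _ t) => //; last by rewrite normr_gt0.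
  exact: continuous_subspaceT.
apply: le_Rintegral_itv; [exact: continuous_integrable|exact: integrable_F1|].
move=> z _; apply: le_trans (normr_cos_le_powR z e1) _.
rewrite ler_pdivlMr ?delta_gt0// -[leRHS]mulr1.
by rewrite ler_wpM2l ?powR_ge0// delta_le1.
Qed.

Lemma am1_F1 p q x : 1 < p -> 0 <= q < 1 -> am1 p (F1 p x q) q = x.
Proof.
move=> p1 q01; rewrite /am1; case: xgetP => [y _ /= E|/(_ x)]; last by elim.
have [xy|yx|//] := ltgtP x y.
  by have := F1_lt p1 q01 xy; rewrite E ltxx.
by have := F1_lt p1 q01 yx; rewrite E ltxx.
Qed.

(** Derivatives are available where the cosine does not vanish, hence the restriction to a quarter
    period; continuity takes care of its end. *)
Lemma odd_on_pihalf (f df : R -> R) : continuous f -> f 0 = 0 ->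
  (forall x, df (- x) = df x) ->
  (forall x, cos x != 0 -> is_derive x 1 f (df x)) ->
  forall x, x \in `[0, pi / 2] -> f (- x) = - f x.
Proof.
move=> cf f0 dfN ddf x xp; apply/eqP; rewrite -subr_eq0 opprK; apply/eqP.
rewrite (@derive_eq0 _ 0 (pi / 2) (fun x => f (- x) + f x) _ _ x xp) ?oppr0 ?f0 ?addr0//.
  apply: continuous_subspaceT => y; apply: cvgD; last exact: cf.
  by apply: (@continuous_comp _ _ _ (fun y : R => - y) f); [apply: cvgN; exact: cvg_id|exact: cf].
move=> y; rewrite in_itv/= => /andP[y0 yp].
have cy : cos y != 0.
  by apply: cos_neq0_pihalf; rewrite in_itv/= yp (lt_trans _ y0)// oppr_lt0; have := @pi_gt0 R; lra.
have cNy : cos (- y) != 0 by rewrite cosN.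
have := is_derive_add (is_derive_chain (ddf _ cNy) (is_derive_opp (is_derive_idfun y))) (ddf _ cy).
by rewrite mulrN1 dfN addNr.
Qed.

Lemma deltaN q x : delta q (- x) = delta q x.
Proof. by rewrite /delta sinN sqrrN. Qed.

Lemma F1N p q x : 1 < p -> 0 <= q < 1 -> x \in `[0, pi / 2] -> F1 p (- x) q = - F1 p x q.
Proof.
move=> p1 q01; apply: (@odd_on_pihalf _ (fun x => `|cos x| `^ (1 - 2 / p) / delta q x)).
- exact: continuous_F1.
- exact: F1_0.
- by move=> y; rewrite cosN deltaN.
- by move=> y cy; exact: is_derive_F1.
Qed.

Lemma E1N p q x : 1 < p -> x \in `[0, pi / 2] -> E1 p (- x) q = - E1 p x q.
Proof.
move=> p1; apply: (@odd_on_pihalf _ (fun x => delta q x * `|cos x| `^ (1 - 2 / p))).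
- exact: continuous_E1.
- exact: E1_0.
- by move=> y; rewrite cosN deltaN.
- by move=> y cy; exact: is_derive_E1.
Qed.

(** The first coordinate of [gamma_w] at amplitude [x], its parameter being [F1 p x q]. At
    [x = pi / 2] it vanishes if and only if [2 E = K]. *)
Definition closing p x q := 2 * E1 p x q - F1 p x q.

Lemma is_derive_closing p q x : 1 < p -> 0 <= q < 1 -> cos x != 0 ->
  is_derive x 1 (closing p ^~ q)
   (`|cos x| `^ (1 - 2 / p) * (1 - 2 * (q ^+ 2 * sin x ^+ 2)) / delta q x).
Proof.
move=> p1 q01 cx.
have D := is_derive_sub (is_derive_scale 2 (is_derive_E1 q p1 cx)) (is_derive_F1 p1 q01 cx).
apply: is_derive_eq D _.
have d0 : delta q x != 0 by rewrite gt_eqF// delta_gt0.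
have -> : 1 - 2 * (q ^+ 2 * sin x ^+ 2) = 2 * delta q x ^+ 2 - 1 by rewrite sqr_delta//; ring.
by field.
Qed.

Lemma continuous_closing p q : 1 < p -> 0 <= q < 1 -> continuous (closing p ^~ q).
Proof.
move=> p1 q01 x; apply: cvgB; last exact: continuous_F1.
by apply: cvgM; [exact: cvg_cst|exact: continuous_E1].
Qed.

(** For [q^2 <= 1 / 2] the factor [1 - 2 q^2 sin^2] of the density is positive on the open quarter
    period. *)
Lemma closing_gt0 p q : 1 < p -> 0 <= q < 1 -> q ^+ 2 <= 1 / 2 -> 0 < closing p (pi / 2) q.
Proof.
move=> p1 q01 q2; have pi2 : 0 < pi / 2 :> R by rewrite divr_gt0// pi_gt0.
have -> : 0 = closing p 0 q by rewrite /closing E1_0 F1_0 mulr0 subr0.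
apply: (@derive_gt0_lt _ _ _ (closing p ^~ q) _ pi2).
- by apply: continuous_subspaceT; exact: continuous_closing.
- move=> x; rewrite in_itv/= => /andP[x0 xp]; apply: is_derive_closing => //.
  by apply: cos_neq0_pihalf; rewrite in_itv/= xp (lt_trans _ x0)// oppr_lt0.
- move=> x; rewrite in_itv/= => /andP[x0 xp].
  have cx : 0 < cos x by rewrite cos_gt0_pihalf// xp (lt_trans _ x0)// oppr_lt0.
  rewrite divr_gt0 ?delta_gt0// mulr_gt0//; first by rewrite powR_gt0// normr_gt0 gt_eqF.
  have s1 : sin x ^+ 2 < 1 by rewrite sin2cos2 ltrBlDr ltrDl exprn_gt0.
  have s0 := sqr_ge0 (sin x).
  rewrite subr_gt0 mulrA; apply: le_lt_trans s1.
  by rewrite -[leRHS]mul1r ler_wpM2r//; lra.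
Qed.

End EllipticFunctions.

(** * The modulus of the figure-eight *)

Section ClosingModulus.
Context {R : realType}.
Implicit Types (a b c d s t x y p q e : R).
Local Notation mu := (@lebesgue_measure R).

Lemma closingE p q : 1 < p -> 0 <= q < 1 ->
  closing p (pi / 2) q =
  \int[mu]_(t in `[0, pi / 2]) (2 * (delta q t * `|cos t| `^ (1 - 2 / p)) - `|cos t| `^ (1 - 2 / p) / delta q t).
Proof.
move=> p1 q01; have pi2 : 0 <= pi / 2 :> R by rewrite divr_ge0// pi_ge0.
rewrite Rintegral_itvB_fun; last 2 first.
- by apply: integrableZR; exact: integrable_E1.
- exact: integrable_F1.
rewrite Rintegral_itvZ; last exact: integrable_E1.
by rewrite /closing /F1 /E1 /oriented_integral pi2.
Qed.

(** Continuity in the modulus, for the intermediate value theorem. The difference of the densities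
    factors through [u - v], and [u^2 - v^2] is explicit in [q] and [q']; away from modulus 1,
    [delta] is bounded below by [m]. *)
Lemma closing_lipschitz p q1 : 1 < p -> 0 <= q1 < 1 -> exists C, 0 <= C /\
  forall q q', 0 <= q <= q1 -> 0 <= q' <= q1 ->
  `|closing p (pi / 2) q - closing p (pi / 2) q'| <= C * `|q - q'|.
Proof.
move=> p1 /andP[q10 q11]; have /andP[e1 _] := exponent_bounds p1.
pose m := Num.sqrt (1 - q1 ^+ 2).
have q12 : q1 ^+ 2 < 1 by rewrite exprn_ilt1.
have m0 : 0 < m by rewrite sqrtr_gt0 subr_gt0.
have dm q t : 0 <= q <= q1 -> m <= delta q t.
  move=> /andP[q0 qq1]; rewrite ler_wsqrtr// lerD2l lerN2.
  have /andP[s0 s1] := sqr_sin_le1 t.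
  apply: (@le_trans _ _ (q ^+ 2)); first by rewrite -[leRHS]mulr1 ler_wpM2l// sqr_ge0.
  by rewrite ler_pXn2r// nnegrE.
pose I := \int[mu]_(t in `[0, pi / 2]) (`|cos t| `^ (1 - 2 / p)).
have ici : mu.-integrable `[0, pi / 2] (EFin \o (fun t : R => `|cos t| `^ (1 - 2 / p))).
  exact: integrable_normr_cos_powR.
have I0 : 0 <= I by apply: Rintegral_ge0 => x _; exact: powR_ge0.
pose K := (2 + m ^- 2) / m.
have m2 : 0 < m ^- 2 by rewrite invr_gt0 exprn_gt0.
have K0 : 0 <= K by rewrite divr_ge0 ?(ltW m0)// addr_ge0// ltW.
exists (K * I); split; first exact: mulr_ge0.
move=> q q' hq hq'.
have q01 : 0 <= q < 1 by case/andP: hq => -> /le_lt_trans ->.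
have q01' : 0 <= q' < 1 by case/andP: hq' => -> /le_lt_trans ->.
rewrite !closingE//.
have int r : 0 <= r < 1 -> mu.-integrable `[0, pi / 2] (EFin \o (fun t =>
    2 * (delta r t * `|cos t| `^ (1 - 2 / p)) - `|cos t| `^ (1 - 2 / p) / delta r t)).
  by move=> r01; apply: integrableBR; [apply: integrableZR; exact: integrable_E1|exact: integrable_F1].
rewrite -Rintegral_itvB_fun; [|exact: int|exact: int].
apply: le_trans (le_normr_Rintegral _ (integrableBR (int _ q01) (int _ q01'))) _ => //.
rewrite mulrAC -Rintegral_itvZ//; apply: le_Rintegral_itv.
- exact: (integrable_norm (integrableBR (int _ q01) (int _ q01'))).
- exact: integrableZR.
move=> t _; have d1 := dm q t hq; have d2 := dm q' t hq'.
have d10 := delta_gt0 t q01; have d20 := delta_gt0 t q01'.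
have S1 := sqr_delta t q01; have S2 := sqr_delta t q01'.
set u := delta q t in d1 d10 S1 *; set v := delta q' t in d2 d20 S2 *.
set c := `|cos t| `^ _.
have -> : 2 * (u * c) - c / u - (2 * (v * c) - c / v) = (u - v) * (2 + (u * v)^-1) * c.
  by field; rewrite !gt_eqF.
rewrite !normrM [`|c|]ger0_norm ?powR_ge0// ler_wpM2r ?powR_ge0//.
have uv0 : 0 < u * v by rewrite mulr_gt0.
rewrite [`|2 + _|]ger0_norm ?addr_ge0 ?invr_ge0 ?(ltW uv0)//.
have b1 : 2 + (u * v)^-1 <= 2 + m ^- 2.
  rewrite lerD2l lef_pV2 ?posrE ?exprn_gt0//.
  by rewrite expr2 ler_pM// ltW.
have b2 : `|u - v| <= `|q - q'| / m.
  rewrite ler_pdivlMr//.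
  apply: (@le_trans _ _ (`|u - v| * ((u + v) / 2))).
    by rewrite ler_wpM2l//; lra.
  have E : (u + v) / 2 = `|(u + v) / 2| by rewrite ger0_norm// divr_ge0// addr_ge0// ltW.
  rewrite E.
  rewrite -normrM (_ : (u - v) * _ = (q' - q) * ((q + q') / 2 * sin t ^+ 2)); last first.
    transitivity ((u ^+ 2 - v ^+ 2) / 2); first by field.
    by rewrite S1 S2; field.
  rewrite normrM distrC -[leRHS]mulr1 ler_wpM2l//.
  have /andP[s0 s1] := sqr_sin_le1 t.
  case/andP: q01 => q0 q1'; case/andP: q01' => q0' q1''.
  rewrite ger0_norm; last by rewrite mulr_ge0// divr_ge0// addr_ge0.
  by rewrite -[leRHS]mulr1 ler_pM// ?divr_ge0// ?addr_ge0//; lra.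
rewrite /K mulrC [leRHS]mulrC mulrA [leRHS]mulrC mulrC.
rewrite [leRHS](_ : _ = (`|q - q'| / m) * (2 + m ^- 2)); last by ring.
by rewrite ler_pM// addr_ge0// invr_ge0 ltW.
Qed.

(** The density of [closing] is [cos (1 - 2 q^2 sin^2) / delta] times the weight [|cos|^(e-1)]. With
    a constant weight [mq] its integral is elementary, [mq sin x delta q x], which at [pi / 2] tends
    to zero as [q] tends to 1. Taking for [mq] the weight at the sign change of [1 - 2 q^2 sin^2]
    makes the replacement an overestimate at every amplitude. The gain [g] does not depend on [q],
    so it wins for [q] close to 1. *)
Lemma closing_lt0 p : 1 < p -> exists q, 1 / 2 <= q < 1 /\ closing p (pi / 2) q < 0.
Proof.
move=> p1; have /andP[_ e1] := exponent_bounds p1.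
set e := 1 - 2 / p in e1.
have pi2 : 0 < pi / 2 :> R by rewrite divr_gt0// pi_gt0.
have e1' : 0 < 1 - e by rewrite subr_gt0.
have cpow (y : R) : 0 < y -> y * y `^ (e - 1) = y `^ e.
  by move=> y0; rewrite -{1}(powRr1 (ltW y0)) -powRD ?(gt_eqF y0) ?implybT//; congr powR; ring.
(* Below, [q^2 >= 9 / 10] puts the critical cosine [c0] above [2 / 3]. Amplitudes with cosine in
   [[1 / 5, 2 / 5]] stay away from it, and [d] bounds the gap between the two weights there,
   uniformly in such [q]. *)
pose m := (2 / 3 : R) `^ (e - 1).
pose d := (2 / 5 : R) `^ (e - 1) - m.
have decr (x y : R) : 0 < x -> x <= y -> y `^ (e - 1) <= x `^ (e - 1).
  move=> x0 xy; have y0 := lt_le_trans x0 xy.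
  rewrite -opprB !powRN lef_pV2 ?posrE ?powR_gt0//.
  by apply: ge0_ler_powR => //; rewrite ?nnegrE ltW.
have d0 : 0 < d.
  rewrite subr_gt0 /m -opprB !powRN ltf_pV2 ?posrE ?powR_gt0//.
  by apply: gt0_ltr_powR => //; rewrite ?nnegrE; lra.
have m0 : 0 < m by rewrite powR_gt0.
pose x1 := acos (2 / 5 : R); pose x2 := acos (1 / 5 : R).
have r25 : -1 <= (2 / 5 : R) <= 1 by apply/andP; split; lra.
have r15 : -1 <= (1 / 5 : R) <= 1 by apply/andP; split; lra.
have x1pi : x1 \in `[0, pi] by rewrite in_itv/= acos_ge0 ?acos_lepi.
have x2pi : x2 \in `[0, pi] by rewrite in_itv/= acos_ge0 ?acos_lepi.
have c1 : cos x1 = 2 / 5 by rewrite /x1 acosK.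
have c2 : cos x2 = 1 / 5 by rewrite /x2 acosK.
have ppi : (pi / 2 : R) \in `[0, pi] by rewrite in_itv/=; apply/andP; split; [exact: ltW|have := @pi_gt0 R; lra].
have x10 : 0 <= x1 by exact: acos_ge0.
have x12 : x1 < x2 by rewrite -ltr_cos// c1 c2; lra.
have x2p : x2 < pi / 2 by rewrite -ltr_cos// cos_pihalf c2; lra.
pose g := d / 10 * (x2 - x1).
have g0 : 0 < g by rewrite mulr_gt0 ?divr_gt0// subr_gt0.
(* As [delta q (pi / 2)] is the square root of [h], the boundary term is at most
   [m (g / (2 m)) = g / 2]. The cap [1 / 10] keeps [q] close to 1. *)
pose h := Num.min (1 / 10) (g / (2 * m)) ^+ 2.
have k0 : 0 < Num.min (1 / 10) (g / (2 * m)) by rewrite lt_min !divr_gt0// mulr_gt0.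
have h0 : 0 < h by rewrite exprn_gt0.
have h1 : h <= 1 / 100.
  rewrite /h (_ : 1 / 100 = (1 / 10) ^+ 2); last by field.
  have k1 : Num.min (1 / 10) (g / (2 * m)) <= 1 / 10 by rewrite ge_min lexx.
  by rewrite !expr2 ler_pM// ltW.
pose q := Num.sqrt (1 - h).
have Q : q ^+ 2 = 1 - h by rewrite sqr_sqrtr//; lra.
have q0 : 0 < q by rewrite sqrtr_gt0; lra.
have q1 : q < 1 by rewrite -(@ltr_pXn2r _ 2) ?nnegrE ?ltW// Q expr1n; lra.
have q01 : 0 <= q < 1 by rewrite ltW.
have q12 : 1 / 2 <= q.
  by rewrite -(@ler_pXn2r _ 2) ?nnegrE ?ltW// Q; lra.
exists q; rewrite q12 q1; split=> //.
have Q0 : 0 < q ^+ 2 by rewrite exprn_gt0.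
have Q1 : 9 / 10 <= q ^+ 2 by rewrite Q; lra.
(* The squared cosine at which [2 q^2 sin^2 = 1]. *)
pose cc := 1 - (2 * q ^+ 2)^-1.
have cc4 : 4 / 9 <= cc.
  rewrite /cc lerBrDl -lerBrDr -[leRHS]invrK lef_pV2 ?posrE ?mulr_gt0//; last by rewrite invr_gt0; lra.
  by apply: (@le_trans _ _ (9 / 5)); [rewrite -[leRHS]invrK lef_pV2 ?posrE//; lra|lra].
pose c0 := Num.sqrt cc.
have c02 : c0 ^+ 2 = cc by rewrite sqr_sqrtr//; lra.
have c00 : 0 < c0 by rewrite sqrtr_gt0; lra.
have c023 : 2 / 3 <= c0.
  rewrite -(@ler_pXn2r _ 2) ?nnegrE ?(ltW c00)// c02 (_ : (2 / 3) ^+ 2 = 4 / 9)//; by field.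
pose mq := c0 `^ (e - 1).
have mqm : mq <= m by apply: decr => //; lra.
have mq0 : 0 < mq by rewrite powR_gt0.
pose B x := mq * (sin x * delta q x) - closing p x q.
pose dB x := (2 * (q ^+ 2 * sin x ^+ 2) - 1) / delta q x * (cos x * (`|cos x| `^ (e - 1) - mq)).
have cB : continuous B.
  move=> x; apply: cvgB; last exact: continuous_closing.
  by apply: cvgM; [exact: cvg_cst|apply: cvgM; [exact: continuous_sin|exact: continuous_delta]].
have dBP x : 0 < cos x -> is_derive x 1 B (dB x).
  move=> cx0; have cx : cos x != 0 by rewrite gt_eqF.
  have D := is_derive_sub (is_derive_scale mq (is_derive_mul (is_derive_sinR x) (is_derive_delta (delta_arg_gt0 x q01))))
    (is_derive_closing p1 q01 cx).
  apply: is_derive_eq D _; rewrite /dB -/e gtr0_norm// -(cpow _ cx0).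
  have dn0 : delta q x != 0 by rewrite gt_eqF// delta_gt0.
  have S := sqr_delta x q01.
  set u := delta q x in dn0 S *.
  have -> : mq * (sin x * (- (q ^+ 2 * sin x * cos x) / u) + u * cos x) =
      mq * cos x * (u ^+ 2 - q ^+ 2 * sin x ^+ 2) / u by field.
  by rewrite S; field.
have cos0 x : 0 < x -> x < pi / 2 -> 0 < cos x.
  by move=> xp0 xp; rewrite cos_gt0_pihalf// xp (lt_trans _ xp0)// oppr_lt0.
have sgn x : 2 * (q ^+ 2 * sin x ^+ 2) - 1 = 2 * q ^+ 2 * (cc - cos x ^+ 2).
  by rewrite sin2cos2 /cc; field; rewrite gt_eqF.
have dB0 x : 0 < x -> x < pi / 2 -> 0 <= dB x.
  move=> xp0 xp; have cx := cos0 x xp0 xp.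
  have db := delta_gt0 x q01.
  rewrite /dB gtr0_norm// sgn -c02.
  have [l|l] := leP (cos x) c0.
    have l2 : 0 <= c0 ^+ 2 - cos x ^+ 2 by rewrite subr_ge0 !expr2; apply: ler_pM => //; exact: ltW.
    apply: mulr_ge0.
      by apply: divr_ge0; [apply: mulr_ge0 => //; apply: mulr_ge0 => //; exact: ltW|exact: ltW].
    by apply: mulr_ge0; [exact: ltW|rewrite subr_ge0 decr].
  have l2 : c0 ^+ 2 - cos x ^+ 2 <= 0 by rewrite subr_le0 !expr2; apply: ler_pM; exact: ltW.
  apply: mulr_le0; first by rewrite pmulr_lle0 ?invr_gt0// pmulr_rle0// mulr_gt0.
  by rewrite pmulr_rle0// subr_le0 decr// ltW.
have dBg x : x \in `]x1, x2[ -> d / 10 <= dB x.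
  rewrite in_itv/= => /andP[xx1 xx2].
  have xp0 : 0 < x by exact: le_lt_trans xx1.
  have xp := lt_trans xx2 x2p.
  have xpi : x \in `[0, pi] by rewrite in_itv/= (ltW xp0)/= (le_trans (ltW xp))//; have := @pi_gt0 R; lra.
  have cx1 : cos x <= 2 / 5 by rewrite -c1 leNgt ltr_cos// -leNgt ltW.
  have cx2 : 1 / 5 <= cos x by rewrite -c2 leNgt ltr_cos// -leNgt ltW.
  have cx := cos0 x xp0 xp.
  rewrite /dB gtr0_norm//.
  have db := delta_gt0 x q01.
  have h2 : 1 / 2 <= (2 * (q ^+ 2 * sin x ^+ 2) - 1) / delta q x.
    rewrite ler_pdivlMr//; apply: (@le_trans _ _ (1 / 2)).
      by rewrite -[leRHS]mulr1 ler_wpM2l// delta_le1.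
    have : cos x ^+ 2 <= (2 / 5) ^+ 2 by rewrite !expr2; apply: ler_pM => //; exact: ltW.
    rewrite sin2cos2 => hc.
    have : 9 / 10 * (1 - (2 / 5) ^+ 2) <= q ^+ 2 * (1 - cos x ^+ 2).
      by apply: ler_pM; [|rewrite subr_ge0|exact: Q1|rewrite lerD2l lerN2]; rewrite ?expr2; lra.
    by rewrite (_ : (2 / 5 : R) ^+ 2 = 4 / 25); [lra|field].
  have h3 : d <= cos x `^ (e - 1) - mq.
    rewrite /d; apply: lerB => //; exact: decr.
  have -> : d / 10 = 1 / 2 * (1 / 5 * d) by field.
  apply: ler_pM => //; first by rewrite mulr_ge0// ltW.
  by apply: ler_pM => //; exact: ltW.
have cBs a b : {within `[a, b], continuous B} by exact: continuous_subspaceT.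
have B0 : B 0 = 0 by rewrite /B /closing sin0 E1_0 F1_0; ring.
have s1 : B 0 <= B x1.
  apply: (@derive_ge0_le _ _ _ B dB) => // x; rewrite in_itv/= => /andP[xa xb].
    by apply: dBP; apply: cos0 => //; exact: lt_trans xb (lt_trans x12 x2p).
  by apply: dB0 => //; exact: lt_trans xb (lt_trans x12 x2p).
have s2 : B x1 - d / 10 * x1 <= B x2 - d / 10 * x2.
  apply: (@derive_ge0_le _ _ _ (fun x => B x - d / 10 * x) (fun x => dB x - d / 10 * 1)); first exact: ltW.
  - apply: continuous_subspaceT => x; apply: cvgB; first exact: cB.
    by apply: cvgM; [exact: cvg_cst|exact: cvg_id].
  - move=> x; rewrite in_itv/= => /andP[xa xb].
    have cx : 0 < cos x by apply: cos0; [exact: le_lt_trans xa|exact: lt_trans xb x2p].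
    exact: is_derive_sub (dBP x cx) (is_derive_scale (d / 10) (is_derive_idfun x)).
  - by move=> x /dBg; rewrite mulr1 subr_ge0.
have s3 : B x2 <= B (pi / 2).
  apply: (@derive_ge0_le _ _ _ B dB) => //; first exact: ltW.
    move=> x; rewrite in_itv/= => /andP[xa xb].
    by apply: dBP; apply: cos0 => //; exact: lt_trans (le_lt_trans x10 x12) xa.
  move=> x; rewrite in_itv/= => /andP[xa xb].
  by apply: dB0 => //; exact: lt_trans (le_lt_trans x10 x12) xa.
have Bg : g <= B (pi / 2).
  move: s1 s2 s3; rewrite B0 /g mulrBr.
  by move: (B x1) (B x2) (B (pi / 2)) (d / 10 * x1) (d / 10 * x2) => *; lra.
have dpi : delta q (pi / 2) = Num.min (1 / 10) (g / (2 * m)).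
  by rewrite /delta sin_pihalf expr1n mulr1 Q opprB addrC subrK sqrtr_sqr gtr0_norm.
have : mq * delta q (pi / 2) <= g / 2.
  have -> : g / 2 = m * (g / (2 * m)) by field; rewrite gt_eqF.
  apply: ler_pM => //; [exact: ltW|by rewrite ltW// delta_gt0|].
  by rewrite dpi ge_min lexx orbT.
move: Bg g0; rewrite /B sin_pihalf mul1r.
by move: (closing _ _ _) (mq * delta q (pi / 2)) (g) => X Y G; lra.
Qed.

(** The intermediate value theorem between the modulus [1 / 2], where [closing] is positive, and the
    one of [closing_lt0] provides a solution, so [xget] does not return its default value. *)
Lemma qstarP p : 1 < p -> 0 < qstar p < 1 /\ closing p (pi / 2) (qstar p) = 0.
Proof.
move=> p1; suff [q [q01 Eq]] : exists q, 0 < q < 1 /\ closing p (pi / 2) q = 0.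
  rewrite /qstar; case: xgetP => [y _ /= [y01 Ey]|/(_ q)].
    by split=> //; apply/eqP; rewrite subr_eq0; apply/eqP.
  by case; split=> //; apply/eqP; rewrite -subr_eq0 -/(closing p (pi / 2) q) Eq.
have [q1 [/andP[q10 q11] neg]] := closing_lt0 p1.
have q101 : 0 <= q1 < 1 by rewrite q11 andbT; lra.
have [C [C0 HC]] := closing_lipschitz p1 q101.
have h12 : 0 <= (1 / 2 : R) < 1 by apply/andP; split; lra.
have pos : 0 < closing p (pi / 2) (1 / 2 : R).
  by apply: closing_gt0 => //; rewrite (_ : (1 / 2 : R) ^+ 2 = 1 / 4); [lra|field].
have cc : {within `[1 / 2, q1], continuous (closing p (pi / 2))}.
  apply: within_continuous_epsP => t tq e e0.
  have C1 : 0 < C + 1 by lra.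
  exists (e / (C + 1)); split; first exact: divr_gt0.
  move=> s sq st; move: tq sq; rewrite !in_itv/= => /andP[t0 t1] /andP[s0 s1].
  apply: le_trans (HC _ _ _ _) _; [apply/andP; split; lra|apply/andP; split; lra|].
  rewrite ltr_pdivlMr// in st; apply: le_trans (ltW st).
  by rewrite mulrC ler_wpM2l//; lra.
have [|q] := @IVT _ _ _ _ 0 q10 cc.
  by rewrite ge_min le_max (ltW neg) (ltW pos) orbT.
rewrite in_itv/= => /andP[qa qb] Eq; exists q; split=> //.
by apply/andP; split; lra.
Qed.

(** Otherwise [closing_gt0] contradicts the closing condition. It makes the constant [A] of the
    optimal modulus positive. *)
Lemma qstar_gt p : 1 < p -> 1 < 2 * qstar p ^+ 2.
Proof.
move=> p1; have [/andP[q0 q1] Eq] := qstarP p1.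
rewrite ltNge; apply/negP => h.
have q01 : 0 <= qstar p < 1 by rewrite (ltW q0) q1.
have h2 : qstar p ^+ 2 <= 1 / 2 by lra.
by have := closing_gt0 p1 q01 h2; rewrite Eq ltxx.
Qed.

End ClosingModulus.

(** * The amplitude as parameter of the tangent angle *)

Section AngleParametrization.
Context {R : realType}.
Implicit Types (x p q r : R).

(* The tangent angle of the p-elastica of modulus [q] where its amplitude is [x]. *)
Definition angle q x := 2 * asin (q * sin x).

Lemma q_sin_lt1 q x : 0 < q <= 1 -> 0 < cos x -> -1 < q * sin x < 1.
Proof.
move=> /andP[q0 q1] cx; rewrite -ltr_norml normrM (gtr0_norm q0).
have s1 : `|sin x| < 1.
  rewrite -(@ltr_pXn2r _ 2) ?nnegrE// expr1n real_normK ?num_real// sin2cos2.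
  by rewrite ltrBlDr ltrDl exprn_gt0.
apply: le_lt_trans s1; rewrite -[leRHS]mul1r.
by rewrite ler_wpM2r.
Qed.

Lemma q_sin_le1 q x : 0 < q <= 1 -> -1 <= q * sin x <= 1.
Proof.
move=> /andP[q0 q1]; rewrite -ler_norml normrM (gtr0_norm q0).
by rewrite -[leRHS]mulr1; apply: ler_pM => //; [exact: ltW|exact: sin_max].
Qed.

Lemma is_derive_angle q x : 0 < q <= 1 -> 0 < cos x ->
  is_derive x 1 (angle q) (2 * q * cos x / delta q x).
Proof.
move=> q01 cx.
have D := is_derive_scale 2 (@is_derive_chain R (@asin R) (fun x => q * sin x) x _ _
  (is_derive1_asin (q_sin_lt1 q01 cx)) (is_derive_scale q (is_derive_sinR x))).
apply: is_derive_eq D _; rewrite exprMn -/(delta q x).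
by ring.
Qed.

Lemma cos_angle q x : 0 < q <= 1 -> cos (angle q x) = 1 - 2 * (q ^+ 2 * sin x ^+ 2).
Proof.
move=> q01; rewrite /angle mulr_natl cos_mulr2n cos2sin2 asinK ?in_itv/= ?q_sin_le1//.
by rewrite exprMn; ring.
Qed.

Lemma sin_angle q x : 0 < q <= 1 -> sin (angle q x) = 2 * (q * sin x * delta q x).
Proof.
move=> q01; rewrite /angle mulr_natl sin_mulr2n asinK ?in_itv/= ?q_sin_le1//.
rewrite cos_asin ?q_sin_le1// exprMn -/(delta q x).
by ring.
Qed.

Lemma angle_pihalf q : angle q (pi / 2) = 2 * asin q.
Proof. by rewrite /angle sin_pihalf mulr1. Qed.

Lemma angle0 q : angle q 0 = 0.
Proof.
have a0 : asin 0 = 0 :> R.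
  rewrite -[X in asin X](@sin0 R) sinK// in_itv/=.
  by have := @pi_gt0 R => p0; apply/andP; split; lra.
by rewrite /angle sin0 mulr0 a0 mulr0.
Qed.

Lemma cos_ge0_itv0 x : x \in `]0, pi / 2[ -> 0 < cos x.
Proof.
rewrite in_itv/= => /andP[x0 xp]; rewrite cos_gt0_pihalf// xp andbT (lt_trans _ x0)//.
by rewrite oppr_lt0; exact: lt_trans x0 xp.
Qed.

Lemma continuous_angle q : 0 < q <= 1 ->
  {within `[- (pi / 2), pi / 2], continuous (angle q)}.
Proof.
move=> /andP[q0]; rewrite le_eqVlt => /predU1P[->|q1].
  (* Modulus 1 is the case of an angle range cut off at [pi]; the angle is then twice the
     amplitude. *)
  apply: (@subspace_eq_continuous _ _ _ (fun x => 2 * x)).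
    by move=> x; rewrite inE/= => xp; change (2 * x = 2 * asin (1 * sin x)); rewrite mul1r sinK.
  by apply: continuous_subspaceT => x; apply: cvgM; [exact: cvg_cst|exact: cvg_id].
apply: continuous_subspaceT => x; apply: cvgM; first exact: cvg_cst.
apply: (@continuous_comp _ _ _ (fun x => q * sin x) (@asin R)).
  by apply: cvgM; [exact: cvg_cst|exact: continuous_sin].
apply: continuous_asin; rewrite -ltr_norml normrM (gtr0_norm q0).
by apply: le_lt_trans q1; rewrite -[leRHS]mulr1; apply: ler_pM; [exact: ltW| | |exact: sin_max].
Qed.

Lemma continuous_angle_lt1 q : 0 <= q < 1 -> continuous (angle q).
Proof.
move=> /andP[q0 q1] x; apply: cvgM; first exact: cvg_cst.
apply: (@continuous_comp _ _ _ (fun x => q * sin x) (@asin R)).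
  by apply: cvgM; [exact: cvg_cst|exact: continuous_sin].
apply: continuous_asin; rewrite -ltr_norml normrM (ger0_norm q0).
by apply: le_lt_trans q1; rewrite -[leRHS]mulr1 ler_pM// sin_max.
Qed.

(** For [A = 2 q^2 - 1] the amplitude turns [cos th + A] into a multiple of a square, and the
    positive part disappears. *)
Lemma well_angle r q x : 0 < q <= 1 ->
  well r (2 * q ^+ 2 - 1) (angle q x) = (2 * q ^+ 2 * cos x ^+ 2) `^ r.
Proof.
move=> q01; rewrite /well cos_angle//; congr (_ `^ _).
have -> : 1 - 2 * (q ^+ 2 * sin x ^+ 2) + (2 * q ^+ 2 - 1) = 2 * q ^+ 2 * cos x ^+ 2.
  by rewrite cos2sin2; ring.
by rewrite max_r//; apply: mulr_ge0; rewrite ?sqr_ge0// mulr_ge0 ?sqr_ge0.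
Qed.

End AngleParametrization.

(** * Comparison of moduli *)

Section WellComparison.
Context {R : realType}.
Implicit Types (x p q r : R).

Lemma delta_gt0' q x : 0 < q <= 1 -> 0 < cos x -> 0 < delta q x.
Proof.
move=> q01 cx; rewrite sqrtr_gt0 subr_gt0 -exprMn.
have /andP[h1 h2] := q_sin_lt1 q01 cx.
by rewrite -real_normK ?num_real// exprn_ilt1// ltr_norml h1.
Qed.

(* The normalized potential density is log-convex in [ln (q ^ 2)], hence lies above
   its tangent line at [q0]. *)
Lemma rate_comparison r q q0 (s : R) : 0 < r -> 0 < s ->
  0 < q -> 0 < q0 -> 1 < 2 * q ^+ 2 -> 1 < 2 * q0 ^+ 2 -> q != q0 ->
  0 < 1 - q ^+ 2 * s -> 0 < 1 - q0 ^+ 2 * s ->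
  (2 * q0 ^+ 2 - 1) `^ (- r) * ((2 * q0 ^+ 2) `^ r * (2 * q0)) / Num.sqrt (1 - q0 ^+ 2 * s) *
   (1 + ln (q ^+ 2 / q0 ^+ 2) * (r + 1 / 2 - r * (2 * q0 ^+ 2 / (2 * q0 ^+ 2 - 1)) +
      1 / 2 * (q0 ^+ 2 * s / (1 - q0 ^+ 2 * s)))) <
  (2 * q ^+ 2 - 1) `^ (- r) * ((2 * q ^+ 2) `^ r * (2 * q)) / Num.sqrt (1 - q ^+ 2 * s).
Proof.
move=> r0 s0 q_gt0 q0_gt0 Q1 Q01 qq0 S S0.
pose g (y : R) := - r * ln (2 * y ^+ 2 - 1) + r * ln (2 * y ^+ 2) + 1 / 2 * ln (y ^+ 2) - 1 / 2 * ln (1 - y ^+ 2 * s).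
have gE y : 0 < y -> 1 < 2 * y ^+ 2 -> 0 < 1 - y ^+ 2 * s ->
    (2 * y ^+ 2 - 1) `^ (- r) * ((2 * y ^+ 2) `^ r * (2 * y)) / Num.sqrt (1 - y ^+ 2 * s) = 2 * expR (g y).
  move=> y0 Y1 YS; have Y2 : 0 < y ^+ 2 by rewrite exprn_gt0.
  have yE : y = expR (1 / 2 * ln (y ^+ 2)).
    by rewrite -{1}(lnK y0); congr expR; rewrite lnXn// -[ln y *+ 2]mulr_natl; field.
  have sE : (Num.sqrt (1 - y ^+ 2 * s))^-1 = expR (- (1 / 2 * ln (1 - y ^+ 2 * s))).
    by rewrite -(powR12_sqrt (ltW YS)) -powRN powR_expR_ln// div1r mulNr.
  rewrite sE !powR_expR_ln; [|lra|lra].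
  by rewrite /g !expRD -yE; ring.
rewrite !gE//.
set L := ln _; set l := (X in L * X).
have q2 : 0 < q ^+ 2 by rewrite exprn_gt0.
have q02 : 0 < q0 ^+ 2 by rewrite exprn_gt0.
set rho := q ^+ 2 / q0 ^+ 2 in L *.
have rho0 : 0 < rho by rewrite divr_gt0.
have rho1 : rho != 1.
  rewrite -subr_eq0 -[X in _ - X](divff (lt0r_neq0 q02)) -mulrBl mulf_eq0 invr_eq0 (gt_eqF q02) orbF.
  by rewrite subr_eq0 eqrXn2 ?ltW.
have d0 : 0 < 2 * q0 ^+ 2 - 1 by rewrite subr_gt0.
have d1 : 0 < 2 * q ^+ 2 - 1 by rewrite subr_gt0.
(* [k] and [- m] are the logarithmic slopes at [q0] of [2 y^2 - 1] and [1 - y^2 s] with respect to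
   [ln (y^2)]. Both functions are affine in [y^2], so their ratios have the form
   [1 + slope (rho - 1)], and Bernoulli's inequality applies with slopes [k > 1] and [- m < 0]. *)
pose k := 2 * q0 ^+ 2 / (2 * q0 ^+ 2 - 1).
pose m := q0 ^+ 2 * s / (1 - q0 ^+ 2 * s).
have k1 : 1 < k by rewrite ltr_pdivlMr// mul1r; lra.
have m0 : 0 < m by rewrite divr_gt0// mulr_gt0.
have e1 : 1 + k * (rho - 1) = (2 * q ^+ 2 - 1) / (2 * q0 ^+ 2 - 1).
  by rewrite /k /rho; field; rewrite !gt_eqF.
have e2 : 1 + (- m) * (rho - 1) = (1 - q ^+ 2 * s) / (1 - q0 ^+ 2 * s).
  by rewrite /m /rho; field; rewrite !gt_eqF.
have b1 : ln (2 * q ^+ 2 - 1) - ln (2 * q0 ^+ 2 - 1) < k * L.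
  rewrite -ln_div// -e1; apply: ln_bernoulli_lt => //.
    by rewrite mulr_gt0 ?subr_gt0// (lt_trans ltr01).
  by rewrite e1 divr_gt0.
have b2 : ln (1 - q ^+ 2 * s) - ln (1 - q0 ^+ 2 * s) < - m * L.
  rewrite -ln_div// -e2; apply: ln_bernoulli_lt => //.
    by rewrite -opprD mulrNN mulr_gt0// addr_gt0.
  by rewrite e2 divr_gt0.
have LE : L = ln (q ^+ 2) - ln (q0 ^+ 2) by rewrite /L ln_div.
have lt : L * l < g q - g q0.
  have L2 : ln (2 * q ^+ 2) - ln (2 * q0 ^+ 2) = L by rewrite (@lnM _ 2 (q ^+ 2)) ?posrE// (@lnM _ 2 (q0 ^+ 2)) ?posrE// LE; ring.
  have -> : g q - g q0 = - (r * (ln (2 * q ^+ 2 - 1) - ln (2 * q0 ^+ 2 - 1))) + r * L + 1 / 2 * L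
     - 1 / 2 * (ln (1 - q ^+ 2 * s) - ln (1 - q0 ^+ 2 * s)).
    by rewrite -{1}L2 LE /g; ring.
  have {}b1 : r * (ln (2 * q ^+ 2 - 1) - ln (2 * q0 ^+ 2 - 1)) < r * (k * L) by rewrite ltr_pM2l.
  rewrite /l -/k -/m.
  rewrite (_ : L * (_ + _) = - (r * (k * L)) + r * L + 1 / 2 * L - 1 / 2 * (- m * L)); last by ring.
  by lra.
rewrite -mulrA ltr_pM2l//.
have -> : g q = g q0 + (g q - g q0) by rewrite addrC subrK.
rewrite (expRD (g q0)) ltr_pM2l ?expR_gt0//.
(* The exponential lies above its tangent line at 0, which turns the logarithmic bound [lt] into the
   linear one. *)
by apply: le_lt_trans (expR_ge1Dx _) _; rewrite ltr_expR.
Qed.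

End WellComparison.

(** * Optimality of the modulus [qstar] *)

Section OptimalModulus.
Context {R : realType}.
Implicit Types (x p q r : R).

Lemma within_continuous_sub (A : set R) (f1 f2 : R -> R) :
  {within A, continuous f1} -> {within A, continuous f2} ->
  {within A, continuous (fun x => f1 x - f2 x)}.
Proof. by move=> c1 c2 x; apply: cvgB; [exact: c1|exact: c2]. Qed.

(** Half of the oscillation of the potential over the angle range from [- 2 asin q] to [2 asin q],
    written with the amplitude [pi / 2] so that it can be differentiated in the amplitude. *)
Definition half_well p q := potential (1 - 1 / p) (2 * q ^+ 2 - 1) (angle q (pi / 2)).

Lemma is_derive_potential_angle p q x : 1 < p -> 0 < q <= 1 -> 0 < cos x ->
  is_derive x 1 (fun x => potential (1 - 1 / p) (2 * q ^+ 2 - 1) (angle q x))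
    ((2 * q ^+ 2) `^ (1 - 1 / p) * (2 * q) / delta q x * (`|cos x| `^ (1 - 2 / p) * cos x ^+ 2)).
Proof.
move=> p1 q01 cx; have p0 : 0 < p by lra.
have q2 : 0 <= 2 * q ^+ 2 by rewrite mulr_ge0// sqr_ge0.
have r0 : 0 < 1 - 1 / p by rewrite subr_gt0 ltr_pdivrMr// mul1r.
have D := is_derive_chain (potential_derive (2 * q ^+ 2 - 1) (angle q x) r0) (is_derive_angle q01 cx).
apply: is_derive_eq D _; rewrite well_angle// powRM// ?sqr_ge0//.
have -> : (cos x ^+ 2) `^ (1 - 1 / p) = `|cos x| `^ (1 - 2 / p) * cos x.
  rewrite (gtr0_norm cx) -powR_mulrn ?ltW// -powRrM -{3}(powRr1 (ltW cx)) -powRD ?(gt_eqF cx) ?implybT//.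
  by congr powR; field; rewrite gt_eqF.
by ring.
Qed.

(* Antiderivative in [x] of the derivative with respect to [ln (q ^ 2)] of the
   normalized potential density. At [x = pi / 2] it vanishes exactly under the
   closing condition [2 E = K]: this is how [qstar] becomes the optimal modulus. *)
Definition criticality p q x :=
  (2 * q ^+ 2) `^ (1 - 1 / p) * (2 * q) *
  (1 / 2 * (sin x * (`|cos x| `^ (1 - 2 / p) * cos x) / delta q x) -
   (1 - 1 / p) / (2 * q ^+ 2 - 1) * closing p x q).

Lemma is_derive_criticality p q x : 1 < p -> 0 < q < 1 -> 1 < 2 * q ^+ 2 -> 0 < cos x ->
  is_derive x 1 (criticality p q)
   ((2 * q ^+ 2) `^ (1 - 1 / p) * (2 * q) / delta q x * (`|cos x| `^ (1 - 2 / p) * cos x ^+ 2) *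
    (1 - 1 / p + 1 / 2 - (1 - 1 / p) * (2 * q ^+ 2 / (2 * q ^+ 2 - 1)) +
      1 / 2 * (q ^+ 2 * sin x ^+ 2 / (1 - q ^+ 2 * sin x ^+ 2)))).
Proof.
move=> p1 /andP[q0 q1] Q1 cx; have p0 : 0 < p by lra.
have q01 : 0 <= q < 1 by rewrite (ltW q0).
have cx0 : cos x != 0 by rewrite gt_eqF.
have d0 := delta_gt0 x q01; have S := sqr_delta x q01.
have dV : is_derive x 1 (fun x => (delta q x)^-1) (q ^+ 2 * sin x * cos x / delta q x ^+ 3).
  have D := @is_deriveV R (delta q) x _ _ (lt0r_neq0 d0) (is_derive_delta (delta_arg_gt0 x q01)).
  apply: is_derive_eq D _; rewrite /GRing.scale/=; field.
  by rewrite gt_eqF.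
have D := is_derive_scale ((2 * q ^+ 2) `^ (1 - 1 / p) * (2 * q)) (is_derive_sub
  (is_derive_scale (1 / 2) (is_derive_mul (is_derive_mul (is_derive_sinR x)
      (is_derive_normr_cos_powR (1 - 2 / p) cx0)) dV))
  (is_derive_scale ((1 - 1 / p) / (2 * q ^+ 2 - 1)) (is_derive_closing p1 q01 cx0))).
apply: is_derive_eq D _.
set y := `|cos x| `^ _; set C := (2 * q ^+ 2) `^ (1 - 1 / p) * (2 * q).
have S2 : 1 - q ^+ 2 * sin x ^+ 2 = delta q x ^+ 2 by rewrite S.
have s2 := sin2cos2 x.
have Q1' : 2 * q ^+ 2 - 1 != 0 by rewrite gt_eqF// subr_gt0.
rewrite S2; set u := delta q x in d0 S S2 *.
have un0 : u != 0 by rewrite gt_eqF.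
have pn0 : p != 0 by rewrite gt_eqF.
set c := cos x in s2 cx0 *; set s := sin x in s2 S S2 *.
have U : u ^+ 2 = 1 - q ^+ 2 * (1 - c ^+ 2) by rewrite S s2.
transitivity (C * (u^-1 * (y * c ^+ 2 * (1 - 1 / p + 1 / 2 - (1 - 1 / p) * (2 * q ^+ 2 / (2 * q ^+ 2 - 1)) + 1 / 2 * (q ^+ 2 * s ^+ 2 / u ^+ 2))))); last by ring.
congr (_ * _).
apply: (mulIf (expf_neq0 3 un0)).
have -> : (1 / 2 * (s * (y * c) * (q ^+ 2 * s * c / u ^+ 3) + u^-1 * (s * - ((1 - 2 / p + 1) * y * s) + y * c * c)) -
 (1 - 1 / p) / (2 * q ^+ 2 - 1) * (y * (1 - 2 * (q ^+ 2 * s ^+ 2)) / u)) * u ^+ 3 =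
 1 / 2 * (s ^+ 2 * y * q ^+ 2 * c ^+ 2 + u ^+ 2 * (- ((1 - 2 / p + 1) * y * s ^+ 2) + y * c ^+ 2)) -
   (1 - 1 / p) / (2 * q ^+ 2 - 1) * (y * (1 - 2 * (q ^+ 2 * s ^+ 2)) * u ^+ 2).
  by field; rewrite ?pn0 ?Q1' ?un0.
have -> : u^-1 * (y * c ^+ 2 * (1 - 1 / p + 1 / 2 - (1 - 1 / p) * (2 * q ^+ 2 / (2 * q ^+ 2 - 1)) + 1 / 2 * (q ^+ 2 * s ^+ 2 / u ^+ 2))) * u ^+ 3
  = y * c ^+ 2 * (u ^+ 2 * (1 - 1 / p + 1 / 2 - (1 - 1 / p) * (2 * q ^+ 2 / (2 * q ^+ 2 - 1))) + 1 / 2 * (q ^+ 2 * s ^+ 2)).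
  by field; rewrite ?pn0 ?Q1' ?un0.
rewrite U s2; field.
by rewrite pn0 Q1'.
Qed.

Lemma continuous_criticality p q : 1 < p -> 0 < q < 1 -> continuous (criticality p q).
Proof.
move=> p1 /andP[q0 q1]; have q01 : 0 <= q < 1 by rewrite (ltW q0).
have /andP[e1 _] := exponent_bounds p1.
move=> x; apply: cvgM; first exact: cvg_cst.
apply: cvgB.
  apply: cvgM; first exact: cvg_cst.
  apply: cvgM; last exact: continuous_deltaV.
  apply: cvgM; first exact: continuous_sin.
  apply: (@continuous_comp _ _ _ (@cos R) (fun y => `|y| `^ (1 - 2 / p) * y)); first exact: continuous_cos.
  exact: continuous_normr_powR_mul.
by apply: cvgM; [exact: cvg_cst|exact: continuous_closing].
Qed.

(** [rate_comparison] is integrated over the amplitudes from 0 to [pi / 2]: [D] is the normalized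
    potential for [q] minus its tangent approximation at [q0]. The linear term contributes
    [criticality p q0 (pi / 2)], which vanishes by the closing condition. *)
Lemma half_well_min p q q0 : 1 < p -> 0 < q0 < 1 -> 1 < 2 * q0 ^+ 2 ->
  closing p (pi / 2) q0 = 0 -> 0 < q <= 1 -> 1 < 2 * q ^+ 2 -> q != q0 ->
  (2 * q0 ^+ 2 - 1) `^ (- (1 - 1 / p)) * half_well p q0 <
  (2 * q ^+ 2 - 1) `^ (- (1 - 1 / p)) * half_well p q.
Proof.
move=> p1 /andP[q0_gt0 q01] Q01 C0 q1 Q1 qq0; have p0 : 0 < p by lra.
have q0i : 0 < q0 < 1 by rewrite q0_gt0.
have q0j : 0 < q0 <= 1 by rewrite q0_gt0 ltW.
have q_gt0 : 0 < q by case/andP: q1.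
set r := 1 - 1 / p.
have r0 : 0 < r by rewrite subr_gt0 ltr_pdivrMr// mul1r.
have pi2 : 0 < pi / 2 :> R by rewrite divr_gt0// pi_gt0.
pose L := ln (q ^+ 2 / q0 ^+ 2).
pose a := (2 * q ^+ 2 - 1) `^ (- r); pose a0 := (2 * q0 ^+ 2 - 1) `^ (- r).
pose D x := a * potential r (2 * q ^+ 2 - 1) (angle q x) -
  (a0 * potential r (2 * q0 ^+ 2 - 1) (angle q0 x) + a0 * L * criticality p q0 x).
have D0 : D 0 = 0.
  rewrite /D !angle0 /potential !oriented_integral0 /criticality sin0 /closing E1_0 F1_0.
  by ring.
have Dpi : D (pi / 2) = a * half_well p q - a0 * half_well p q0.
  have E : criticality p q0 (pi / 2) = 0.
    by rewrite /criticality cos_pihalf C0 !mulr0 mul0r mulr0 subr0 mulr0.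
  by rewrite /D E (mulr0 (a0 * L)); congr (_ - _); exact: addr0.
rewrite -subr_gt0 -/a -/a0 -Dpi -D0.
have cpa y : 0 < y <= 1 -> {within `[0, pi / 2], continuous (fun x => potential r (2 * y ^+ 2 - 1) (angle y x))}.
  move=> y1; apply: within_continuous_comp; first by move=> z _; exact: continuous_potential.
  by apply: within_continuous_subitv (continuous_angle y1); rewrite ?lexx// oppr_le0 ltW.
have ccst (k : R) : {within `[0, (pi : R) / 2], continuous (fun=> k)}.
  by apply: continuous_subspaceT => z; exact: cvg_cst.
have dD x (cx : 0 < cos x) := is_derive_sub (is_derive_scale a (is_derive_potential_angle p1 q1 cx))
   (is_derive_add (is_derive_scale a0 (is_derive_potential_angle p1 q0j cx))
      (is_derive_scale (a0 * L) (is_derive_criticality p1 q0i Q01 cx))).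
apply: (derive_gt0_lt pi2) (fun x xp => dD x (cos_ge0_itv0 xp)) _.
  apply: within_continuous_sub.
    exact: within_continuous_mul (ccst a) (cpa q q1).
  apply: within_continuous_add; first exact: within_continuous_mul (ccst a0) (cpa q0 q0j).
  apply: within_continuous_mul (ccst (a0 * L)) _.
  by apply: continuous_subspaceT; exact: continuous_criticality.
move=> x xp; have cx := cos_ge0_itv0 xp.
have sx : 0 < sin x ^+ 2.
  by rewrite exprn_gt0// sin_gt0_pihalf//; move: xp; rewrite in_itv.
have T0 : 0 < `|cos x| `^ (1 - 2 / p) * cos x ^+ 2.
  by rewrite mulr_gt0 ?exprn_gt0// powR_gt0// normr_gt0 gt_eqF.
set T := _ * cos x ^+ 2 in T0 *.
have dq := delta_gt0' q1 cx; have dq0 := delta_gt0' q0j cx.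
have := @rate_comparison _ r q q0 (sin x ^+ 2) r0 sx q_gt0 q0_gt0 Q1 Q01 qq0.
move: (dq) (dq0); rewrite !sqrtr_gt0 => h h0 /(_ h h0).
rewrite -/(delta q x) -/(delta q0 x) -/a -/a0 -/L.
rewrite -(ltr_pM2r T0) -subr_gt0.
by rewrite -/r; congr (0 < _); ring.
Qed.

End OptimalModulus.

(** * Energy of a loop *)

Section LoopInequality.
Context {R : realType}.
Implicit Types (a b c s t x p q r : R) (v k th eta : R -> R).
Local Notation mu := (@lebesgue_measure R).

(* The lower bound for a loop whose tangent angle has half-range [2 asin q]. *)
Definition leaf_energy p q := ((2 * q ^+ 2 - 1) `^ (- (1 - 1 / p)) * (2 * half_well p q)) `^ p.

Lemma potential_le r a x y : 0 < r -> x <= y -> potential r a x <= potential r a y.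
Proof.
move=> r0 xy; apply: (@derive_ge0_le _ _ _ (potential r a) (well r a)) => //.
- by apply: continuous_subspaceT; exact: continuous_potential.
- by move=> z _; exact: potential_derive.
- by move=> z _; exact: well_ge0.
Qed.

Lemma potential_gt0 r a x : 0 < r -> 0 < a -> 0 < x -> 0 < potential r a x.
Proof.
move=> r0 a0 x0; have pi2 : 0 < pi / 2 :> R by rewrite divr_gt0// pi_gt0.
pose y := Num.min x (pi / 2).
have y0 : 0 < y by rewrite lt_min x0.
apply: (@lt_le_trans _ _ (potential r a y)); last by apply: potential_le => //; rewrite ge_min lexx.
have -> : 0 = potential r a 0 by rewrite /potential oriented_integral0.
apply: (@derive_gt0_lt _ _ _ (potential r a) (well r a)) => //.
- by apply: continuous_subspaceT; exact: continuous_potential.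
- by move=> z _; exact: potential_derive.
- move=> z; rewrite in_itv/= lt_min => /and3P[z0 _ zp].
  have cz : 0 < cos z by apply: cos_ge0_itv0; rewrite in_itv/= z0.
  by rewrite powR_gt0// lt_max addr_gt0 ?orbT.
Qed.

Lemma half_well_gt0 p q : 1 < p -> 0 < q <= 1 -> 1 < 2 * q ^+ 2 -> 0 < half_well p q.
Proof.
move=> p1 /andP[q0 q1] Q1; rewrite /half_well angle_pihalf; apply: potential_gt0.
- by rewrite subr_gt0 ltr_pdivrMr ?mul1r//; lra.
- by rewrite subr_gt0.
- have qb : -1 <= q <= 1 by rewrite q1 andbT; lra.
  rewrite mulr_gt0// ltNge; apply/negP => h.
  have : sin (asin q) <= 0.
    have pi0 := @pi_gt0 R; rewrite -(opprK (asin q)) sinN oppr_le0 sin_ge0_pi// oppr_ge0 h/=.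
    by have := asin_geNpi2 qb; lra.
  by rewrite asinK ?in_itv//= leNgt q0.
Qed.

Lemma leaf_energy_min p q : 1 < p -> 0 < q <= 1 -> 1 < 2 * q ^+ 2 ->
  leaf_energy p (qstar p) <= leaf_energy p q ?= iff (q == qstar p).
Proof.
move=> p1 q1 Q1; have [q0 C0] := qstarP p1; have Q0 := qstar_gt p1.
have p0 : 0 < p by lra.
have q0' : 0 < qstar p <= 1 by case/andP: q0 => -> /ltW ->.
have g0 y : 0 < y <= 1 -> 1 < 2 * y ^+ 2 -> 0 < (2 * y ^+ 2 - 1) `^ (- (1 - 1 / p)) * (2 * half_well p y).
  by move=> y1 Y1; rewrite mulr_gt0 ?powR_gt0 ?subr_gt0// mulr_gt0// half_well_gt0.
case: (eqVneq q (qstar p)) => [->|qq]; apply/leifP; first by [].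
apply: gt0_ltr_powR; rewrite ?nnegrE ?(ltW (g0 _ _ _))//.
by rewrite !(mulrCA _ 2) ltr_pM2l// half_well_min.
Qed.

(** Young's inequality for the curvature [x / y] and its optimal value [(c z)^(1/p)], multiplied by
    the speed [y]. *)
Lemma young_density p c x y (z : R) : 1 < p -> 0 <= c -> 0 <= z -> 0 <= x -> 0 < y ->
  p * (c `^ (1 - 1 / p) * (z `^ (1 - 1 / p) * x)) - (p - 1) * (c * (z * y)) <= x `^ p * y `^ (1 - p)
  ?= iff (x == y * (c * z) `^ p^-1).
Proof.
move=> p1 c0 z0 x0 y0; have p0 : 0 < p by lra.
have pn0 : p != 0 by rewrite gt_eqF.
have yn0 : y != 0 by rewrite gt_eqF.
have cz : 0 <= c * z by rewrite mulr_ge0.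
have Y := @young_powR _ p (x / y) ((c * z) `^ p^-1) p1 (divr_ge0 x0 (ltW y0)) (powR_ge0 _ _).
have E1 : ((c * z) `^ p^-1) `^ p = c * z by rewrite -powRrM mulVf// powRr1.
have E2 : ((c * z) `^ p^-1) `^ (p - 1) = c `^ (1 - 1 / p) * z `^ (1 - 1 / p).
  by rewrite -powRrM -powRM//; congr powR; field.
have E3 : (x / y) `^ p * y = x `^ p * y `^ (1 - p).
  rewrite powRM ?invr_ge0 ?(ltW y0)// -powR_inv1 ?(ltW y0)// -powRrM -mulrA.
  by rewrite -{2}(powRr1 (ltW y0)) -powRD ?yn0 ?implybT//; congr (_ * powR _ _); ring.
rewrite E1 E2 in Y.
have -> : (x == y * (c * z) `^ p^-1) = (x / y == (c * z) `^ p^-1).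
  by apply/eqP/eqP => [->|<-]; field.
rewrite -E3.
rewrite (_ : _ - _ = (p * (x / y) * (c `^ (1 - 1 / p) * z `^ (1 - 1 / p)) - (p - 1) * (c * z)) * y); last by field.
by split; [rewrite ler_pM2r// Y|rewrite (inj_eq (mulIf yn0)) Y].
Qed.

(** The value of [c] maximizes the left-hand side: the derivative in [c] vanishes when
    [c^(1/p) = J0 / (A l)]. *)
Lemma best_multiplier p (J0 A l : R) : 1 < p -> 0 < J0 -> 0 < A -> 0 < l ->
  let c := (J0 / (A * l)) `^ p in
  l `^ (p - 1) * (p * (c `^ (1 - 1 / p) * J0) - (p - 1) * (c * (A * l))) =
  (A `^ (- (1 - 1 / p)) * J0) `^ p.
Proof.
move=> p1 J00 A0 l0; set X := J0 / (A * l) => c; have p0 : 0 < p by lra.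
have pn0 : p != 0 by rewrite gt_eqF.
have X0 : 0 < X by rewrite divr_gt0// mulr_gt0.
have J0E : J0 = X * (A * l) by rewrite /X divfK// gt_eqF// mulr_gt0.
have cr : c `^ (1 - 1 / p) * X = X `^ p.
  rewrite /c -powRrM -{2}(powRr1 (ltW X0)) -powRD ?(gt_eqF X0) ?implybT//; congr powR.
  by field.
have -> : p * (c `^ (1 - 1 / p) * J0) - (p - 1) * (c * (A * l)) = A * l * X `^ p.
  by rewrite {1}J0E (_ : c `^ (1 - 1 / p) * _ = c `^ (1 - 1 / p) * X * (A * l)); [rewrite cr /c; ring|ring].
have Al0 : 0 <= (A * l)^-1 by rewrite invr_ge0 mulr_ge0// ltW.
have J0' : 0 <= J0 by exact: ltW.
rewrite J0E !powRM ?mulr_ge0 ?powR_ge0 ?(ltW X0) ?(ltW A0) ?(ltW l0)//.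
rewrite -[in RHS]powRrM.
have -> : - (1 - 1 / p) * p = 1 - p by field.
have -> : l `^ p = l `^ (p - 1) * l.
  by rewrite -{3}(powRr1 (ltW l0)) -powRD ?(gt_eqF l0) ?implybT//; congr powR; ring.
have EA : A `^ (1 - p) * A `^ p = A.
  rewrite -powRD ?(gt_eqF A0) ?implybT// (_ : 1 - p + p = 1); first by rewrite powRr1// ltW.
  by ring.
set Y := J0 `^ p * _.
transitivity (A `^ (1 - p) * A `^ p * (l `^ (p - 1) * l * Y)); last by ring.
by rewrite EA; ring.
Qed.

(** If [B] were at most [pi / 2], then [cos (th - m)] would be nonnegative with zero weighted
    integral, hence identically zero; but [th] takes its middle value [m], where this cosine is
    1. *)
Lemma closed_angle_range a b v th : a < b -> {within `[a, b], continuous v} ->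
  {in `[a, b], forall t, 0 < v t} -> {within `[a, b], continuous th} ->
  \int[mu]_(t in `[a, b]) (v t * cos (th t)) = 0 ->
  \int[mu]_(t in `[a, b]) (v t * sin (th t)) = 0 ->
  exists m B t1 t2, [/\ t1 \in `[a, b], t2 \in `[a, b], th t1 = m - B, th t2 = m + B &
   [/\ {in `[a, b], forall t, `|th t - m| <= B}, pi / 2 < B &
   \int[mu]_(t in `[a, b]) (v t * cos (th t - m)) = 0]].
Proof.
move=> ab cv v0 cth I1 I2.
have [t1 t1ab Ht1] := EVT_min (ltW ab) cth.
have [t2 t2ab Ht2] := EVT_max (ltW ab) cth.
pose m := (th t1 + th t2) / 2; pose B := (th t2 - th t1) / 2.
have e1 : th t1 = m - B by rewrite /m /B; field.
have e2 : th t2 = m + B by rewrite /m /B; field.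
have HB : {in `[a, b], forall t, `|th t - m| <= B}.
  move=> t tab; have := Ht1 t tab; have := Ht2 t tab; rewrite e1 e2 ler_norml => h1 h2.
  by apply/andP; split; lra.
have ccos : {within `[a, b], continuous (fun t => cos (th t))}.
  by apply: within_continuous_comp => // x _; exact: continuous_cos.
have csin : {within `[a, b], continuous (fun t => sin (th t))}.
  by apply: within_continuous_comp => // x _; exact: continuous_sin.
have I : \int[mu]_(t in `[a, b]) (v t * cos (th t - m)) = 0.
  transitivity (\int[mu]_(t in `[a, b]) (cos m * (v t * cos (th t)) + sin m * (v t * sin (th t)))).
    by apply: eq_Rintegral => t _; rewrite cosB; ring.
  have i1 := continuous_itv_integrable (within_continuous_mul cv ccos).
  have i2 := continuous_itv_integrable (within_continuous_mul cv csin).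
  rewrite Rintegral_itvD; [|exact: integrableZR|exact: integrableZR].
  by rewrite !Rintegral_itvZ// I1 I2 !mulr0 addr0.
exists m, B, t1, t2; split=> //; split=> //.
rewrite ltNge; apply/negP => B2.
have cm : {within `[a, b], continuous (fun t => cos (th t - m))}.
  apply: (@within_continuous_comp _ _ _ _ (fun t => th t - m) (@cos R)); first by move=> x _; exact: continuous_cos.
  by apply: within_continuous_sub => //; apply: continuous_subspaceT => x; exact: cvg_cst.
have cosge0 t : t \in `[a, b] -> 0 <= cos (th t - m).
  move=> /HB tB; apply: cos_ge0_pihalf.
  by rewrite -ler_norml; exact: le_trans tB B2.
have cvm := within_continuous_mul cv cm.
have z0 t : t \in `[a, b] -> cos (th t - m) = 0.
  move=> tab; have /eqP : v t * cos (th t - m) = 0.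
    apply: (Rintegral_eq0_continuous ab cvm _ I tab) => x xab.
    by rewrite mulr_ge0 ?cosge0// ltW// v0.
  by rewrite mulf_eq0 gt_eqF ?v0//= => /eqP.
have [s sab Es] : exists2 s, s \in `[a, b] & th s = m.
  have B0 : 0 <= B by have := HB t1 t1ab; rewrite e1; apply: le_trans.
  move: (t1ab) (t2ab); rewrite !in_itv/= => /andP[h1 h2] /andP[h3 h4].
  have [t12|t21] := leP t1 t2.
    have [|s st Es] := @IVT _ th t1 t2 m t12 (within_continuous_subitv h1 h4 cth).
      by rewrite e1 e2 ge_min le_max; apply/andP; split; apply/orP; [left|right]; lra.
    exists s => //; move: st; rewrite !in_itv/= => /andP[h5 h6].
    by apply/andP; split; lra.
  have [|s st Es] := @IVT _ th t2 t1 m (ltW t21) (within_continuous_subitv h3 h2 cth).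
    by rewrite e1 e2 ge_min le_max; apply/andP; split; apply/orP; [right|left]; lra.
  exists s => //; move: st; rewrite !in_itv/= => /andP[h5 h6].
  by apply/andP; split; lra.
by have := z0 s sab; rewrite Es subrr cos0 => /eqP; rewrite oner_eq0.
Qed.

End LoopInequality.

(** * The loop inequality and its equality case *)

Section LoopEquality.
Context {R : realType}.
Implicit Types (a b c s t x p q r : R) (v k th eta : R -> R).
Local Notation mu := (@lebesgue_measure R).

(** The purpose of the cut-off: [- cos (Num.min B pi)] is the largest value of [- cos] on
    [[- B, B]], so [cos + A] is nonnegative along the whole curve. *)
Lemma cos_zone (x B : R) : pi / 2 < B -> `|x| <= B ->
  0 <= cos x - cos (Num.min B pi).
Proof.
move=> B2 xB; have pi0 := @pi_gt0 R; rewrite subr_ge0 -(cos_norm x).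
have [Bpi|piB] := leP B pi; last by rewrite cospi cos_geN1.
have xi : `|x| \in `[0, pi] by rewrite in_itv/= normr_ge0 (le_trans xB).
have Bi : B \in `[0, pi] by rewrite in_itv/= Bpi andbT; lra.
by rewrite leNgt ltr_cos// -leNgt.
Qed.

Lemma modulus_of_range (B : R) : pi / 2 < B ->
  let q := sin (Num.min B pi / 2) in
  [/\ 0 < q <= 1, 1 < 2 * q ^+ 2, 2 * q ^+ 2 - 1 = - cos (Num.min B pi) &
      2 * asin q = Num.min B pi].
Proof.
move=> B2 q; have pi0 := @pi_gt0 R.
set B' := Num.min B pi in q *.
have B'pi : B' <= pi by rewrite ge_min lexx orbT.
have B'2 : pi / 2 < B' by rewrite lt_min B2; lra.
have E : 2 * q ^+ 2 - 1 = - cos B'.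
  have -> : B' = (B' / 2) *+ 2 by rewrite -mulr_natl; field.
  by rewrite cos_mulr2n cos2sin2 -/q; ring.
have q1 : q <= 1 by exact: sin_le1.
have q0 : 0 < q by apply: sin_gt0_pi; apply/andP; split; lra.
have cB : cos B' < 0.
  rewrite -cos_pihalf ltr_cos// in_itv/=; apply/andP; split; lra.
split=> //; first by rewrite q0.
- by rewrite -subr_gt0 E oppr_gt0.
- by rewrite /q sinK ?in_itv/=; [field|apply/andP; split; lra].
Qed.

(** The extreme angles may be reached in either order. The sign [e] records which, and becomes the
    reflection of the leaf in the equality case. *)
Lemma total_variation_potential a b th k r A (t1 t2 : R) : a <= b -> 0 < r -> AC a b th k ->
  t1 \in `[a, b] -> t2 \in `[a, b] ->
  exists e : bool,
    potential r A (th t2) - potential r A (th t1) =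
    \int[mu]_(t in `[Num.min t1 t2, Num.max t1 t2]) (well r A (th t) * ((-1) ^+ e * k t)).
Proof.
move=> ab r0 Ath t1ab t2ab.
have Aw : AC a b (fun t => potential r A (th t)) (fun t => well r A (th t) * k t).
  apply: (@AC_comp _ a b (potential r A) (well r A) th k) => //; last exact: continuous_well.
  by move=> x; exact: potential_derive.
move: t1ab t2ab; rewrite !in_itv/= => /andP[h1 h2] /andP[h3 h4].
have [t12|t21] := leP t1 t2.
  exists false; rewrite (AC_sub Aw)//; apply: eq_Rintegral => t _.
  by rewrite mul1r.
exists true; rewrite -opprB (AC_sub Aw) ?(ltW t21)//.
rewrite -[LHS]mulN1r -Rintegral_itvZ; first by apply: eq_Rintegral => t _; rewrite expr1; ring.
exact: integrable_subitv Aw.1.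
Qed.

Lemma Rintegral_subitv_le a b c d (f : R -> R) : a <= c -> c <= d -> d <= b ->
  mu.-integrable `[a, b] (EFin \o f) -> (forall x, x \in `[a, b] -> 0 <= f x) ->
  \int[mu]_(x in `[c, d]) f x <= \int[mu]_(x in `[a, b]) f x.
Proof.
move=> ac cd db fi f0.
have sub := @integrable_subitv R a b.
have ge0 x y : a <= x -> y <= b -> 0 <= \int[mu]_(z in `[x, y]) f z.
  move=> ax yb; apply: Rintegral_ge0 => z /= zxy; apply: f0.
  by move: zxy; rewrite !in_itv/= => /andP[xz zy]; rewrite (le_trans ax xz) (le_trans zy yb).
rewrite (@Rintegral_itv_cat _ a c b)//; last exact: le_trans cd db.
rewrite (@Rintegral_itv_cat _ c d b)//; last exact: sub ac (lexx b) fi.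
rewrite ler_wpDl//; first exact: ge0 (lexx _) (le_trans cd db).
by rewrite ler_wpDr//; exact: ge0 (le_trans ac cd) (lexx _).
Qed.

Lemma Rintegral_eq0_ae a b (f : R -> R) : mu.-integrable `[a, b] (EFin \o f) ->
  (forall x, x \in `[a, b] -> 0 <= f x) -> \int[mu]_(x in `[a, b]) f x = 0 ->
  {ae mu, forall x, x \in `[a, b] -> f x = 0}.
Proof.
move=> fi f0 I0; have /integrableP[mf _] := fi.
have : (\int[mu]_(x in `[a, b]) `|(EFin \o f) x| = 0)%E.
  rewrite -[RHS]/(0%:E) -I0 /Rintegral fineK; last exact: integrable_fin_num fi.
  by apply: eq_integral => x; rewrite inE/= => xab; rewrite ger0_norm// f0.
move/(ae_eq_integral_abs mu (measurable_itv _) mf) => H0.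
apply: (@filterS _ _ (ae_filter_ringOfSetsType mu) _ _ _ H0).
by move=> x H xab; have [] := H xab.
Qed.

Lemma add_squeeze (x y z w : R) : x = y + w -> x = z -> z <= y -> 0 <= w -> y = z /\ w = 0.
Proof. by move=> -> h1 h2 h3; split; lra. Qed.

(** Equality in Young's inequality gives the equation of the angle almost everywhere; its right-hand
    side is continuous, so it may serve as the density. *)
Lemma AC_ae_eq a b f (w1 w2 : R -> R) : a <= b -> AC a b f w1 ->
  {within `[a, b], continuous w2} -> {ae mu, forall x, x \in `[a, b] -> w1 x = w2 x} ->
  AC a b f w2.
Proof.
move=> ab A c2 H; have i2 := continuous_itv_integrable c2.
split=> // t tab; rewrite A.2//; congr (_ + _); rewrite /Rintegral; congr fine.
move: tab; rewrite in_itv/= => /andP[at_ tb].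
have /integrableP[m1 _] := integrable_subitv (lexx a) tb A.1.
have /integrableP[m2 _] := integrable_subitv (lexx a) tb i2.
apply: ae_eq_integral => //; move: H; apply: filterS; first exact: (ae_filter_ringOfSetsType mu).
move=> x H xat; congr (_%:E); apply: H.
by move: xat; rewrite /= !in_itv/= => /andP[-> h]; rewrite (le_trans h tb).
Qed.

(** Two nonnegative deficits separate the energy from [leaf_energy p q]: the integral of [Y], from
    Young's inequality, and [J - J0], from the variation of the potential. In the equality case both
    vanish, and [leaf_energy_min] forces [q = qstar p]. *)
Lemma loop_inequality p a b v th k : 1 < p -> a < b ->
  {within `[a, b], continuous v} -> {in `[a, b], forall t, 0 < v t} -> AC a b th k ->
  mu.-integrable `[a, b] (EFin \o (fun t => `|k t| `^ p * v t `^ (1 - p))) ->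
  \int[mu]_(t in `[a, b]) (v t * cos (th t)) = 0 ->
  \int[mu]_(t in `[a, b]) (v t * sin (th t)) = 0 ->
  let l := \int[mu]_(t in `[a, b]) v t in
  let bend := \int[mu]_(t in `[a, b]) (`|k t| `^ p * v t `^ (1 - p)) in
  let A := 2 * qstar p ^+ 2 - 1 in
  let c := (2 * half_well p (qstar p) / (A * l)) `^ p in
  leaf_energy p (qstar p) <= l `^ (p - 1) * bend /\
  (l `^ (p - 1) * bend = leaf_energy p (qstar p) ->
   exists (e : bool) (m : R) eta, [/\ {in `[a, b], forall t, th t = m + (-1) ^+ e * eta t},
     AC a b eta (fun t => v t * (c * (cos (eta t) + A)) `^ p^-1),
     {in `[a, b], forall t, `|eta t| <= 2 * asin (qstar p)} &
     exists s t, [/\ s \in `[a, b], t \in `[a, b], eta s = - (2 * asin (qstar p)) &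
                     eta t = 2 * asin (qstar p)]]).
Proof.
move=> p1 ab cv v0 Ath bi I1 I2 l bend A c; have p0 : 0 < p by lra.
have pi0 := @pi_gt0 R.
set r := 1 - 1 / p.
have r0 : 0 < r by rewrite subr_gt0 ltr_pdivrMr// mul1r.
have cth := AC_continuous (ltW ab) Ath.
have [m [B [t1 [t2 [t1ab t2ab e1 e2 [HB B2 I]]]]]] := closed_angle_range ab cv v0 cth I1 I2.
pose q := sin (Num.min B pi / 2).
have [q1 Q1 AE asE] := modulus_of_range B2; rewrite -/q in q1 Q1 AE asE.
pose A' := 2 * q ^+ 2 - 1.
have A'0 : 0 < A' by rewrite subr_gt0.
pose al t := th t - m.
have Aal : AC a b al k.
  have := AC_add (ltW ab) Ath (AC_cst a b (- m)).
  by apply: eq_AC => t _ //=; rewrite addr0.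
have cal := AC_continuous (ltW ab) Aal.
pose z t := cos (al t) + A'.
have z0 t : t \in `[a, b] -> 0 <= z t.
  by move=> tab; have := cos_zone B2 (HB t tab); rewrite /z /A' AE.
have wz t : t \in `[a, b] -> well r A' (al t) = z t `^ r.
  by move=> tab; rewrite /well -/(z t) max_r// z0.
have ccal : {within `[a, b], continuous (fun t => cos (al t))}.
  by apply: within_continuous_comp => // x _; exact: continuous_cos.
have cz : {within `[a, b], continuous z}.
  by apply: within_continuous_add => //; apply: continuous_subspaceT => x; exact: cvg_cst.
have cw : {within `[a, b], continuous (fun t => well r A' (al t))}.
  by apply: within_continuous_comp => // x _; exact: continuous_well.
have aab : a \in `[a, b] by rewrite in_itv/= lexx ltW.
have l0 : 0 < l by apply: (Rintegral_gt0 ab cv _ aab) => [x xab|]; [exact: ltW (v0 x xab)|exact: v0].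
pose J0 := 2 * half_well p q.
have J00 : 0 < J0 by rewrite mulr_gt0// half_well_gt0.
have ki := integrable_norm Aal.1.
have wki : mu.-integrable `[a, b] (EFin \o (fun t => well r A' (al t) * `|k t|)).
  exact: integrable_mul_continuous.
pose J := \int[mu]_(t in `[a, b]) (well r A' (al t) * `|k t|).
have al1 : al t1 = - B by rewrite /al e1; ring.
have al2 : al t2 = B by rewrite /al e2; ring.
have [e TV] := total_variation_potential A' (ltW ab) r0 Aal t1ab t2ab.
rewrite al1 al2 potentialN// opprK in TV.
set m1 := Num.min t1 t2 in TV *; set m2 := Num.max t1 t2 in TV *.
have [am1 m12 m2b] : [/\ a <= m1, m1 <= m2 & m2 <= b].
  move: t1ab t2ab; rewrite !in_itv/= /m1 /m2 => /andP[h1 h2] /andP[h3 h4].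
  by rewrite le_min ge_max ge_min le_max h1 h2 h3 h4 lexx; split=> //; rewrite lexx ?orbT.
(* The part of the angle range beyond the cut-off can only increase the oscillation of the
   potential. *)
have J0B : J0 <= potential r A' B + potential r A' B.
  rewrite /J0 mulr_natl mulr2n; apply: lerD; rewrite /half_well angle_pihalf asE -/r -/A';
    by apply: potential_le => //; rewrite ge_min lexx.
have wsi : mu.-integrable `[m1, m2] (EFin \o (fun t => well r A' (al t) * ((-1) ^+ e * k t))).
  apply: integrable_subitv am1 m2b _; apply: integrable_mul_continuous => //.
  exact: integrableZR Aal.1.
have wabs t : well r A' (al t) * ((-1) ^+ e * k t) <= well r A' (al t) * `|k t|.
  rewrite ler_wpM2l ?well_ge0//; apply: le_trans (ler_norm _) _.
  by rewrite normrM normr_sign mul1r.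
have sJ : \int[mu]_(t in `[m1, m2]) (well r A' (al t) * ((-1) ^+ e * k t)) <= J.
  apply: le_trans (Rintegral_subitv_le am1 m12 m2b wki _); last first.
    by move=> x _; rewrite mulr_ge0 ?well_ge0.
  by apply: le_Rintegral_itv => //; exact: integrable_subitv am1 m2b wki.
have J0J : J0 <= J by apply: le_trans J0B _; rewrite TV.
pose c' := (J0 / (A' * l)) `^ p.
have c'0 : 0 < c' by rewrite powR_gt0// divr_gt0// mulr_gt0.
have yd t (tab : t \in `[a, b]) := young_density p1 (ltW c'0) (z0 t tab) (normr_ge0 (k t)) (v0 t tab).
pose Y t := `|k t| `^ p * v t `^ (1 - p) -
  (p * c' `^ r * (well r A' (al t) * `|k t|) - (p - 1) * c' * (z t * v t)).
have zvi := continuous_itv_integrable (within_continuous_mul cz cv).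
have Yi : mu.-integrable `[a, b] (EFin \o Y).
  by apply: integrableBR => //; apply: integrableBR; exact: integrableZR.
have YE t : t \in `[a, b] -> Y t = `|k t| `^ p * v t `^ (1 - p) -
    (p * (c' `^ r * (z t `^ r * `|k t|)) - (p - 1) * (c' * (z t * v t))).
  by move=> tab; rewrite /Y wz//; ring.
have Y0 t : t \in `[a, b] -> 0 <= Y t.
  by move=> tab; rewrite YE// subr_ge0; have [] := yd t tab.
have zvI : \int[mu]_(t in `[a, b]) (z t * v t) = A' * l.
  transitivity (\int[mu]_(t in `[a, b]) (v t * cos (al t) + A' * v t)).
    by apply: eq_Rintegral => t _; rewrite /z; ring.
  have vi := continuous_itv_integrable cv.
  rewrite Rintegral_itvD ?Rintegral_itvZ ?I ?add0r//.
    exact: continuous_itv_integrable (within_continuous_mul cv ccal).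
  exact: integrableZR.
have YI : \int[mu]_(t in `[a, b]) Y t = bend - (p * (c' `^ r * J) - (p - 1) * (c' * (A' * l))).
  rewrite Rintegral_itvB_fun//; last by apply: integrableBR; exact: integrableZR.
  rewrite Rintegral_itvB_fun; [|exact: integrableZR|exact: integrableZR].
  rewrite !Rintegral_itvZ// zvI -/J -/bend.
  by ring.
have YI0 : 0 <= \int[mu]_(t in `[a, b]) Y t by apply: Rintegral_ge0 => x; exact: Y0.
(* An exact identity, from which both the inequality and its equality case are read off. *)
have BE : l `^ (p - 1) * bend = leaf_energy p q +
    l `^ (p - 1) * (\int[mu]_(t in `[a, b]) Y t + p * (c' `^ r * (J - J0))).
  rewrite /leaf_energy -/A' -/J0 -(best_multiplier p1 J00 A'0 l0) -/c' -/r YI.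
  by ring.
have lp0 : 0 < l `^ (p - 1) by exact: powR_gt0.
have cr0 : 0 < c' `^ r by exact: powR_gt0.
have LE := leaf_energy_min p1 q1 Q1.
have rest0 : 0 <= p * (c' `^ r * (J - J0)).
  by rewrite mulr_ge0 ?(ltW p0)// mulr_ge0 ?(ltW cr0)// subr_ge0.
split.
  rewrite BE; apply: le_trans LE.1 _.
  by rewrite lerDl mulr_ge0 ?(ltW lp0)// addr_ge0.
move=> EQ.
have X0 : 0 <= l `^ (p - 1) * (\int[mu]_(t in `[a, b]) Y t + p * (c' `^ r * (J - J0))).
  by rewrite mulr_ge0 ?(ltW lp0)// addr_ge0.
have [qE XE] : leaf_energy p q = leaf_energy p (qstar p) /\
   l `^ (p - 1) * (\int[mu]_(t in `[a, b]) Y t + p * (c' `^ r * (J - J0))) = 0.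
  exact: add_squeeze BE EQ LE.1 X0.
have {}qE : q = qstar p by apply/eqP; rewrite -LE.2 qE.
have [YI_0 JE] : \int[mu]_(t in `[a, b]) Y t = 0 /\ J = J0.
  move/eqP: XE; rewrite mulf_eq0 (gt_eqF lp0)/= paddr_eq0// => /andP[/eqP -> ].
  by rewrite mulf_eq0 (gt_eqF p0)/= mulf_eq0 (gt_eqF cr0)/= subr_eq0 => /eqP ->.
have A'E : A' = A by rewrite /A' /A qE.
have cE : c' = c by rewrite /c' /c /J0 A'E qE.
(* A range beyond [pi] would give [q = 1], but [qstar p < 1]. *)
have Bq : B = 2 * asin (qstar p).
  rewrite -qE asE; have [//|piB] := leP B pi.
  have [/andP[_ qs1] _] := qstarP p1.
  by move: qs1; rewrite -qE /q min_r ?(ltW piB)// sin_pihalf ltxx.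
have YE0 := Rintegral_eq0_ae Yi Y0 YI_0.
(* The excess of the total variation over the signed variation between the times of the two extreme
   angles. It is nonnegative with zero integral, so it vanishes almost everywhere. *)
pose h t := well r A' (al t) * `|k t| - ((fun t => well r A' (al t) * ((-1) ^+ e * k t)) \_ `[m1, m2]) t.
have wsi' : mu.-integrable `[a, b] (EFin \o ((fun t => well r A' (al t) * ((-1) ^+ e * k t)) \_ `[m1, m2])).
  rewrite -restrict_EFin; apply/integrable_restrict => //.
  rewrite setIidr//; apply: subset_itv; by rewrite bnd_simp.
have hi : mu.-integrable `[a, b] (EFin \o h) by exact: integrableBR.
have h0 t : t \in `[a, b] -> 0 <= h t.
  move=> tab; rewrite /h patchE; case: ifPn => _; first by rewrite subr_ge0.
  by rewrite subr0 mulr_ge0// well_ge0.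
have hI : \int[mu]_(t in `[a, b]) h t = 0.
  rewrite Rintegral_itvB_fun// -Rintegral_mkcondr setIidr; last first.
    by apply: subset_itv; rewrite bnd_simp.
  by apply/eqP; rewrite -/J subr_eq0 eq_le sJ andbT JE (le_trans J0B)// TV.
have hE0 := Rintegral_eq0_ae hi h0 hI.
have key : {ae mu, forall t, t \in `[a, b] -> (-1) ^+ e * k t = v t * (c * (cos ((-1) ^+ e * al t) + A)) `^ p^-1}.
  apply: (@filterS2 _ _ (ae_filter_ringOfSetsType mu) _ _ _ _ YE0 hE0) => t Yt ht tab.
  have cosE : cos ((-1) ^+ e * al t) = cos (al t) by case: (e); rewrite ?expr1 ?expr0 ?mulN1r ?cosN ?mul1r.
  rewrite cosE -cE -A'E -/(z t).
  have kE : `|k t| = v t * (c' * z t) `^ p^-1.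
    have := Yt tab; rewrite YE// => /eqP; rewrite subr_eq0 eq_sym.
    by have [_ ->] := yd t tab => /eqP.
  have := ht tab; rewrite /h patchE wz//.
  (* Where [z] vanishes so does the weight, and [h] says nothing; equality in Young's inequality
     then already gives [k t = 0]. Elsewhere [h t = 0] gives the sign of [k t] within [[m1, m2]],
     and [k t = 0] outside. *)
  have [z_0|z_n0] := eqVneq (z t) 0.
    move=> _; rewrite -kE; move: kE; rewrite z_0 mulr0 powR0 ?mulr0 ?invr_eq0 ?gt_eqF//.
    by move/eqP; rewrite normr_eq0 => /eqP ->; rewrite mulr0 normr0.
  have zr : z t `^ r != 0 by rewrite powR_eq0 negb_and z_n0.
  case: ifPn => _.
    rewrite -mulrBr => /eqP; rewrite mulf_eq0 (negbTE zr)/= subr_eq0 => /eqP <-.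
    by rewrite -kE.
  rewrite subr0 => /eqP; rewrite mulf_eq0 (negbTE zr)/= => k0.
  by rewrite -kE (eqP k0); move: k0; rewrite normr_eq0 => /eqP ->; rewrite mulr0.
exists e, m, (fun t => (-1) ^+ e * al t).
have Aeta := AC_scale ((-1) ^+ e) (ltW ab) Aal.
split.
- by move=> t tab; rewrite mulrA -expr2 sqrr_sign mul1r /al addrC subrK.
- apply: (AC_ae_eq (ltW ab) Aeta _ key).
  apply: within_continuous_mul => //.
  have cpow : continuous (fun x : R => `|x| `^ p^-1) by apply: continuous_normr_powR; rewrite invr_gt0.
  apply: (@subspace_eq_continuous _ _ _ (fun t => `|c' * z t| `^ p^-1)).
    move=> t; rewrite inE => tab.
    change (`|c' * z t| `^ p^-1 = (c * (cos ((-1) ^+ e * al t) + A)) `^ p^-1).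
    have -> : cos ((-1) ^+ e * al t) = cos (al t) by case: (e); rewrite ?expr1 ?expr0 ?mulN1r ?cosN ?mul1r.
    by rewrite -cE -A'E -/(z t) ger0_norm// mulr_ge0 ?(ltW c'0)// z0.
  apply: (@within_continuous_comp _ _ _ _ (fun t => c' * z t) (fun x => `|x| `^ p^-1)) => //.
  apply: within_continuous_mul => //; apply: continuous_subspaceT => x; exact: cvg_cst.
- by move=> t tab; rewrite normrM normr_sign mul1r -Bq; exact: HB.
- rewrite -Bq; case: (e).
    by exists t2, t1; rewrite al1 al2 expr1 !mulN1r opprK.
  by exists t1, t2; rewrite al1 al2 expr0 !mul1r.
Qed.

End LoopEquality.

(** * The figure-eight p-elastica *)

Section FigureEight.
Context {R : realType}.
Implicit Types (p s t x : R).

Definition fig_amplitude p s := am1 p (s - K1c p (qstar p)) (qstar p).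
Definition fig_angle p s := angle (qstar p) (fig_amplitude p s).
Definition fig_x p s := (figure_eight p s).1.
Definition fig_y p s := (figure_eight p s).2.

Variable p : R.
Hypothesis p1 : 1 < p.
Let q := qstar p.
Let K := K1c p q.
Let p0 : 0 < p. Proof. exact: lt_trans ltr01 p1. Qed.

Let q01 : 0 < q < 1. Proof. by have [] := qstarP p1. Qed.
Let q01' : 0 <= q < 1. Proof. by case/andP: q01 => /ltW -> ->. Qed.
Let q01c : 0 < q <= 1. Proof. by case/andP: q01 => -> /ltW ->. Qed.
Let pi2 : 0 < pi / 2 :> R. Proof. by rewrite divr_gt0// pi_gt0. Qed.

Lemma K1c_gt0 : 0 < K.
Proof. by have := F1_lt p1 q01' pi2; rewrite F1_0. Qed.

Let F1_le x y : x <= y -> F1 p x q <= F1 p y q.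
Proof. by rewrite le_eqVlt => /predU1P[->//|/(F1_lt p1 q01')/ltW]. Qed.

Let F1Npihalf : F1 p (- (pi / 2)) q = - K.
Proof. by rewrite F1N// in_itv/= lexx ltW. Qed.

Lemma fig_amplitude_itv s : s \in `[0, 2 * K] ->
  fig_amplitude p s \in `[- (pi / 2), pi / 2] /\ F1 p (fig_amplitude p s) q = s - K.
Proof.
rewrite in_itv/= => /andP[s0 sK].
have npp : - (pi / 2) <= pi / 2 :> R by rewrite (le_trans _ (ltW pi2))// oppr_le0 ltW.
have cF : {within `[- (pi / 2), pi / 2], continuous (F1 p ^~ q)}.
  by apply: continuous_subspaceT; exact: continuous_F1.
have [|x xi Fx] := @IVT _ _ _ _ (s - K) npp cF.
  rewrite F1Npihalf -/(K1c p q) -/K ge_min le_max; apply/andP; split; apply/orP; [left|right]; lra.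
by rewrite /fig_amplitude -/q -/K -Fx am1_F1.
Qed.

Lemma fig_amplitude_F1 x : fig_amplitude p (F1 p x q + K) = x.
Proof. by rewrite /fig_amplitude -/q -/K addrK am1_F1. Qed.

Lemma fig_amplitude_lt s t : s \in `[0, 2 * K] -> t \in `[0, 2 * K] -> s < t ->
  fig_amplitude p s < fig_amplitude p t.
Proof.
move=> si ti st; have [_ Fs] := fig_amplitude_itv si; have [_ Ft] := fig_amplitude_itv ti.
rewrite ltNge; apply/negP; rewrite le_eqVlt => /predU1P[E|/(F1_lt p1 q01')].
  by move: Fs Ft; rewrite E => -> /eqP; rewrite (inj_eq (addIr _)) (lt_eqF st).
by rewrite Fs Ft ltrD2r ltNge (ltW st).
Qed.

Lemma fig_amplitude0 : fig_amplitude p 0 = - (pi / 2).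
Proof. by rewrite -{1}(addNr K) -F1Npihalf fig_amplitude_F1. Qed.

Lemma fig_amplitude_end : fig_amplitude p (2 * K) = pi / 2.
Proof. by rewrite (_ : 2 * K = F1 p (pi / 2) q + K) ?fig_amplitude_F1// -/(K1c p q) -/K; ring. Qed.

Lemma fig_amplitude_oo s : s \in `]0, 2 * K[ -> fig_amplitude p s \in `]- (pi / 2), pi / 2[.
Proof.
move=> si; have K0 := K1c_gt0; move: (si); rewrite in_itv/= => /andP[s0 sK].
have si' : s \in `[0, 2 * K] by rewrite in_itv/= !ltW.
have h0 : 0 \in `[0, 2 * K] by rewrite in_itv/= lexx; lra.
have h1 : 2 * K \in `[0, 2 * K] by rewrite in_itv/= lexx; lra.
by rewrite in_itv/= -fig_amplitude0 -fig_amplitude_end !fig_amplitude_lt.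
Qed.

Lemma cos_fig_amplitude_gt0 s : s \in `]0, 2 * K[ -> 0 < cos (fig_amplitude p s).
Proof. by move=> /fig_amplitude_oo; rewrite in_itv/= => /cos_gt0_pihalf. Qed.

Lemma continuous_fig_amplitude : {within `[0, 2 * K], continuous (fig_amplitude p)}.
Proof.
apply: within_continuous_epsP => t ti e e0.
have [_ Ft] := fig_amplitude_itv ti.
set x := fig_amplitude p t in Ft *.
have h1 : F1 p x q < F1 p (x + e) q by apply: F1_lt => //; rewrite ltrDl.
have h2 : F1 p (x - e) q < F1 p x q by apply: F1_lt => //; rewrite gtrBl.
exists (Num.min (F1 p (x + e) q - F1 p x q) (F1 p x q - F1 p (x - e) q)).
split; first by rewrite lt_min !subr_gt0 h1.
move=> s si; have [_ Fs] := fig_amplitude_itv si.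
rewrite lt_min => /andP[]; rewrite !ltr_norml => /andP[_ b1] /andP[b2 _].
have u1 : fig_amplitude p s < x + e.
  by rewrite ltNge; apply/negP => /F1_le; rewrite Fs; lra.
have u2 : x - e < fig_amplitude p s.
  by rewrite ltNge; apply/negP => /F1_le; rewrite Fs; lra.
by rewrite ler_norml; apply/andP; split; lra.
Qed.

Lemma is_derive_fig_amplitude s : s \in `]0, 2 * K[ ->
  is_derive s 1 (fig_amplitude p)
    (delta q (fig_amplitude p s) / `|cos (fig_amplitude p s)| `^ (1 - 2 / p)).
Proof.
move=> si; have cx := cos_fig_amplitude_gt0 si.
have si' : s \in `[0, 2 * K] by move: si; rewrite !in_itv/= => /andP[/ltW -> /ltW ->].
have [_ Fs] := fig_amplitude_itv si'.
set x := fig_amplitude p s in cx Fs *.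
have dx := delta_gt0 x q01'.
have cn : cos x != 0 by rewrite gt_eqF.
have yc : 0 < `|cos x| `^ (1 - 2 / p) by rewrite powR_gt0// normr_gt0.
have D : is_derive (F1 p x q) 1 (fun s => am1 p s q) (`|cos x| `^ (1 - 2 / p) / delta q x)^-1.
  apply: (@is_derive_inverse R (F1 p ^~ q) (fun s => am1 p s q)).
  - by near=> y; exact: am1_F1.
  - by near=> y; exact: continuous_F1.
  - exact: is_derive_F1.
  - by rewrite gt_eqF// divr_gt0.
rewrite Fs in D.
have := @is_derive_chain R (fun s => am1 p s q) (fun s => s - K) s _ _ D
  (is_derive_sub (is_derive_idfun s) (is_derive_const K s)).
by move/is_derive_eq; apply; rewrite subr0 mulr1 invf_div.
Unshelve. all: by end_near.
Qed.

(** In powers of the cosine, [(2 / p) (p - 1) = 2 - 2 / p]. This exponent is positive, so the value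
    0 at a vanishing cosine is the continuous one. *)
Lemma cnp_powR x : 0 <= cos x ->
  `| `|cos x| `^ (2 / p - 1) * cos x| `^ (p - 2) * (`|cos x| `^ (2 / p - 1) * cos x) =
  `|cos x| `^ (1 - 2 / p) * cos x.
Proof.
rewrite le_eqVlt => /predU1P[<-|cx]; first by rewrite !mulr0.
rewrite (gtr0_norm cx).
have -> : cos x `^ (2 / p - 1) * cos x = cos x `^ (2 / p).
  by rewrite -{2}(powRr1 (ltW cx)) -powRD ?(gt_eqF cx) ?implybT//; congr powR; ring.
rewrite ger0_norm ?powR_ge0// -powRrM -powRD ?(gt_eqF cx) ?implybT//.
rewrite -{3}(powRr1 (ltW cx)) -powRD ?(gt_eqF cx) ?implybT//; congr powR.
by field; rewrite gt_eqF.
Qed.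

Lemma fig_xE s : fig_x p s = 2 * E1 p (fig_amplitude p s) q - (s - K).
Proof. by []. Qed.

Lemma fig_yE s : s \in `[0, 2 * K] ->
  fig_y p s = - q * (p / (p - 1)) * (`|cos (fig_amplitude p s)| `^ (1 - 2 / p) * cos (fig_amplitude p s)).
Proof.
move=> /fig_amplitude_itv[+ _]; rewrite in_itv/= => xi.
rewrite -cnp_powR; last exact: cos_ge0_pihalf.
by [].
Qed.

Lemma continuous_fig_x : {within `[0, 2 * K], continuous (fig_x p)}.
Proof.
apply: within_continuous_sub.
  apply: within_continuous_mul; first by apply: continuous_subspaceT => x; exact: cvg_cst.
  apply: (@within_continuous_comp _ _ _ _ (fig_amplitude p) (fun x => E1 p x q)).
    by move=> x _; exact: continuous_E1.
  exact: continuous_fig_amplitude.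
apply: continuous_subspaceT => x; apply: cvgB; [exact: cvg_id|exact: cvg_cst].
Qed.

Lemma continuous_fig_y : {within `[0, 2 * K], continuous (fig_y p)}.
Proof.
have /andP[e1 _] := exponent_bounds p1.
apply: (@subspace_eq_continuous _ _ _ (fun s => - q * (p / (p - 1)) *
   (`|cos (fig_amplitude p s)| `^ (1 - 2 / p) * cos (fig_amplitude p s)))).
  by move=> s; rewrite inE => si; rewrite -fig_yE.
apply: within_continuous_mul; first by apply: continuous_subspaceT => x; exact: cvg_cst.
apply: (@within_continuous_comp _ _ _ _ (fig_amplitude p) (fun x => `|cos x| `^ (1 - 2 / p) * cos x)).
  move=> x _; apply: (@continuous_comp _ _ _ (@cos R) (fun y => `|y| `^ (1 - 2 / p) * y)).
    exact: continuous_cos.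
  exact: continuous_normr_powR_mul.
exact: continuous_fig_amplitude.
Qed.

Lemma continuous_fig_angle : {within `[0, 2 * K], continuous (fig_angle p)}.
Proof.
apply: (@within_continuous_comp _ _ _ _ (fig_amplitude p) (angle q)).
  by move=> x _; exact: continuous_angle_lt1.
exact: continuous_fig_amplitude.
Qed.

(** From [2 delta^2 - 1 = cos (angle q x)]. Together with [is_derive_fig_y] it says that the model
    curve is parametrized by arclength with tangent angle [fig_angle]. *)
Lemma is_derive_fig_x s : s \in `]0, 2 * K[ -> is_derive s 1 (fig_x p) (cos (fig_angle p s)).
Proof.
move=> si; have cx := cos_fig_amplitude_gt0 si.
have cn : cos (fig_amplitude p s) != 0 by rewrite gt_eqF.
have D := is_derive_sub (is_derive_scale 2 (is_derive_chain (is_derive_E1 q p1 cn) (is_derive_fig_amplitude si)))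
  (is_derive_sub (is_derive_idfun s) (is_derive_const K s)).
apply: is_derive_eq D _; rewrite cos_angle// -/q.
have yc : 0 < `|cos (fig_amplitude p s)| `^ (1 - 2 / p) by rewrite powR_gt0// normr_gt0.
have S := sqr_delta (fig_amplitude p s) q01'.
set y := _ `^ _ in yc *; set u := delta _ _ in S *.
have -> : u * y * (u / y) = u ^+ 2 by field; rewrite gt_eqF.
by rewrite S; ring.
Qed.

Lemma is_derive_fig_y s : s \in `]0, 2 * K[ -> is_derive s 1 (fig_y p) (sin (fig_angle p s)).
Proof.
move=> si; have cx := cos_fig_amplitude_gt0 si.
have cn : cos (fig_amplitude p s) != 0 by rewrite gt_eqF.
have D := is_derive_scale (- q * (p / (p - 1)))
  (is_derive_chain (is_derive_normr_cos_powR (1 - 2 / p) cn) (is_derive_fig_amplitude si)).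
apply: (@is_derive_near _ (fun s => - q * (p / (p - 1)) * (`|cos (fig_amplitude p s)| `^ (1 - 2 / p) * cos (fig_amplitude p s)))).
  have : nbhs s `]0, 2 * K[%classic by apply: near_in_itvoo.
  apply: filterS => y yi; rewrite fig_yE//; move: yi; rewrite /= !in_itv/= => /andP[h1 h2].
  by rewrite !ltW.
apply: is_derive_eq D _; rewrite sin_angle// -/q.
have yc : 0 < `|cos (fig_amplitude p s)| `^ (1 - 2 / p) by rewrite powR_gt0// normr_gt0.
field; rewrite (gt_eqF yc) (gt_eqF p0) /=; rewrite gt_eqF// subr_gt0//.
Qed.

(* The tangent angle of the model curve solves
   [th' ^ p = fig_rate * (cos th + fig_height)]. *)
Definition fig_rate : R := (2 `^ (p - 1)) * q `^ (p - 2).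
Definition fig_height : R := 2 * q ^+ 2 - 1.

Lemma fig_rate_gt0 : 0 < fig_rate.
Proof. by case/andP: q01 => q0 _; rewrite mulr_gt0// powR_gt0. Qed.

Lemma fig_height_gt0 : 0 < fig_height.
Proof. by rewrite subr_gt0; exact: qstar_gt. Qed.

Lemma fig_zone s : cos (fig_angle p s) + fig_height = 2 * q ^+ 2 * cos (fig_amplitude p s) ^+ 2.
Proof. by rewrite cos_angle// /fig_height cos2sin2 -/q; ring. Qed.

(** Origin of [fig_rate]: the p-th power of the right-hand side is [2^p q^p cos^2], that is
    [fig_rate] times [2 q^2 cos^2]. *)
Lemma fig_rate_zone x : 0 < cos x ->
  (fig_rate * (2 * q ^+ 2 * cos x ^+ 2)) `^ p^-1 = 2 * q * cos x / `|cos x| `^ (1 - 2 / p).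
Proof.
move=> cx; have /andP[q0 _] := q01; have p0' := p0; rewrite (gtr0_norm cx).
have R0 : 0 <= 2 * q * cos x / cos x `^ (1 - 2 / p) by rewrite divr_ge0 ?powR_ge0// mulr_ge0 ?(ltW cx)// mulr_ge0 ?(ltW q0).
apply: (@powR_injective R p) => //; rewrite ?nnegrE ?powR_ge0//.
rewrite -powRrM mulVf ?gt_eqF// powRr1; last first.
  by rewrite mulr_ge0 ?(ltW fig_rate_gt0)// mulr_ge0 ?sqr_ge0// mulr_ge0 ?sqr_ge0.
have c0 : 0 <= cos x by exact: ltW.
have q0' : 0 <= q by exact: ltW.
rewrite -powRN powRM ?mulr_ge0 ?powR_ge0// powRM ?mulr_ge0// powRM// -powRrM /fig_rate.
rewrite -!powR_mulrn//.
have -> : 2 `^ p = 2 `^ (p - 1) * 2 :> R.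
  by rewrite -{3}(@powRr1 R 2)// -powRD ?pnatr_eq0 ?implybT//; congr powR; ring.
have -> : q `^ p = q `^ (p - 2) * q `^ 2.
  by rewrite -powRD ?(gt_eqF q0) ?implybT//; congr powR; ring.
have -> : cos x `^ 2 = cos x `^ p * cos x `^ (- (1 - 2 / p) * p).
  by rewrite -powRD ?(gt_eqF cx) ?implybT//; congr powR; field; rewrite gt_eqF.
by ring.
Qed.

Lemma is_derive_fig_angle s : s \in `]0, 2 * K[ ->
  is_derive s 1 (fig_angle p) ((fig_rate * (cos (fig_angle p s) + fig_height)) `^ p^-1).
Proof.
move=> si; have cx := cos_fig_amplitude_gt0 si.
have D := is_derive_chain (is_derive_angle q01c cx) (is_derive_fig_amplitude si).
apply: is_derive_eq D _; rewrite fig_zone fig_rate_zone//.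
have yc : 0 < `|cos (fig_amplitude p s)| `^ (1 - 2 / p) by rewrite powR_gt0// normr_gt0 gt_eqF.
have dx := delta_gt0 (fig_amplitude p s) q01'.
by field; rewrite !gt_eqF.
Qed.

Lemma fig_angle_end : fig_angle p (2 * K) = 2 * asin q.
Proof. by rewrite /fig_angle fig_amplitude_end angle_pihalf. Qed.

Lemma angleN x : angle q (- x) = - angle q x.
Proof.
rewrite /angle sinN mulrN.
suff -> : asin (- (q * sin x)) = - asin (q * sin x) by rewrite mulrN.
have qs := q_sin_le1 x q01c.
have h1 := asin_geNpi2 qs; have h2 := asin_lepi2 qs.
rewrite -[X in - X](asinK (x := q * sin x)) ?in_itv//= -sinN sinK// in_itv/=.
by apply/andP; split; lra.
Qed.

Lemma fig_angle0 : fig_angle p 0 = - (2 * asin q).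
Proof. by rewrite /fig_angle fig_amplitude0 angleN angle_pihalf. Qed.

(** The relation [2 E = K], read at the start of the leaf. With [fig_x_end] it makes the cosine of
    the tangent angle integrate to zero over a leaf. *)
Lemma fig_x0 : fig_x p 0 = 0.
Proof.
have [_ C] := qstarP p1.
rewrite fig_xE fig_amplitude0 E1N//; last by rewrite in_itv/= lexx ltW.
by move: C; rewrite /closing -/q -/(K1c p q) -/K => C; rewrite sub0r opprK mulrN -[RHS]oppr0 -C; ring.
Qed.

Lemma fig_x_end : fig_x p (2 * K) = 0.
Proof.
have [_ C] := qstarP p1; rewrite fig_xE fig_amplitude_end.
by move: C; rewrite /closing -/q -/(K1c p q) -/K => C; rewrite -C; ring.
Qed.

(* Integrates [th' * (cos th + A) ^ r = rate ^ (1/p) * (cos th + A)] along the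
   figure eight. *)
Lemma half_wellE : 2 * half_well p q = fig_rate `^ p^-1 * (fig_height * (2 * K)).
Proof.
have p0' := p0.
have r0 : 0 < 1 - 1 / p by rewrite subr_gt0 ltr_pdivrMr// mul1r.
have K0 := K1c_gt0.
pose D s := potential (1 - 1 / p) fig_height (fig_angle p s) - fig_rate `^ p^-1 * (fig_height * s + fig_x p s).
have cD : {within `[0, 2 * K], continuous D}.
  apply: within_continuous_sub.
    apply: (@within_continuous_comp _ _ _ _ (fig_angle p) (potential (1 - 1 / p) fig_height)).
      by move=> x _; exact: continuous_potential.
    exact: continuous_fig_angle.
  apply: within_continuous_mul; first by apply: continuous_subspaceT => x; exact: cvg_cst.
  apply: within_continuous_add; last exact: continuous_fig_x.
  by apply: continuous_subspaceT => x; apply: cvgM; [exact: cvg_cst|exact: cvg_id].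
have dD : {in `]0, 2 * K[, forall s, is_derive s 1 D 0}.
  move=> s si.
  have DD := is_derive_sub (is_derive_chain (potential_derive fig_height (fig_angle p s) r0) (is_derive_fig_angle si))
    (is_derive_scale (fig_rate `^ p^-1) (is_derive_add (is_derive_scale fig_height (is_derive_idfun s)) (is_derive_fig_x si))).
  apply: is_derive_eq DD _.
  have cx := cos_fig_amplitude_gt0 si.
  rewrite /well mulr1 [fig_height + _]addrC; set z := cos _ + fig_height.
  have z0 : 0 < z by rewrite /z fig_zone; have /andP[q0 _] := q01; rewrite mulr_gt0 ?exprn_gt0// mulr_gt0 ?exprn_gt0.
  rewrite max_r ?(ltW z0)// powRM ?(ltW z0) ?(ltW fig_rate_gt0)//.
  rewrite mulrCA -powRD ?(gt_eqF z0) ?implybT// (_ : 1 - 1 / p + p^-1 = 1); last by rewrite div1r subrK.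
  by rewrite powRr1 ?subrr// ltW.
have KK : 2 * K \in `[0, 2 * K] by rewrite in_itv/= lexx andbT mulr_ge0// ltW.
have := derive_eq0 cD dD KK.
rewrite /D fig_angle_end fig_angle0 fig_x0 fig_x_end potentialN// mulr0 !addr0 mulr0 subr0.
move/eqP; rewrite subr_eq => /eqP E.
by rewrite mulr_natl mulr2n /half_well angle_pihalf -/q -/fig_height {1}E addrAC addNr add0r.
Qed.

End FigureEight.

(** * Equality case for a loop *)

Section Traverse.
Context {R : realType}.
Implicit Types (s t x y : R).
Local Notation mu := (@lebesgue_measure R).

Lemma AC_is_derive a b (f w : R -> R) t : a < b -> AC a b f w -> {within `[a, b], continuous w} ->
  t \in `]a, b[ -> is_derive t 1 f (w t).
Proof.
move=> ab A cw tab; move: (tab); rewrite in_itv/= => /andP[at_ tb].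
have ct : {for t, continuous w} by have /(continuous_within_itvP _ ab)[+ _ _] := cw; exact.
have [dF dE] := continuous_FTC1_closed tb A.1 at_ ct.
have D : is_derive t 1 (fun y => \int[mu]_(s in `[a, y]) w s) (w t).
  exact: is_derive_of_derive1 dF dE.
have := is_derive_add (is_derive_const (f a) t) D; rewrite add0r; apply: is_derive_near.
have : nbhs t `]a, b[%classic by apply: near_in_itvoo.
apply: filterS => y; rewrite /= in_itv/= => /andP[h1 h2].
by rewrite -A.2// in_itv/= !ltW.
Qed.

Lemma AC_le a b (f w : R -> R) : AC a b f w -> {in `[a, b], forall t, 0 <= w t} ->
  {in `[a, b] &, forall s t, s <= t -> f s <= f t}.
Proof.
move=> A w0 s t; rewrite !in_itv/= => /andP[as_ sb] /andP[at_ tb] st.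
rewrite -subr_ge0 (AC_sub A)//; apply: Rintegral_ge0 => x; rewrite /= in_itv/= => /andP[sx xt].
by apply: w0; rewrite in_itv/= (le_trans as_ sx) (le_trans xt tb).
Qed.

(* [eta] cannot rest at its extreme values [-B], [B]: traversing the open range
   alone already takes the whole time [T]. *)
Lemma traverse_without_rest (a b B T : R) (eta S sigma : R -> R) : a < b -> 0 < T ->
  {in `[a, b] &, forall s t, s <= t -> eta s <= eta t} ->
  {in `[a, b], forall t, `|eta t| <= B} -> S (- B) = 0 -> S B = T ->
  {in `[a, b] &, forall s t, s < t -> sigma s < sigma t} -> sigma a = 0 -> sigma b = T ->
  (forall s t, s \in `[a, b] -> t \in `[a, b] -> `|eta s| < B -> `|eta t| < B -> s < t ->
     S (eta t) - S (eta s) = sigma t - sigma s) ->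
  (forall h, h \in `]0, T[ -> exists t, [/\ t \in `[a, b], `|eta t| < B & S (eta t) = h]) ->
  {in `[a, b], forall t, S (eta t) = sigma t}.
Proof.
move=> ab T0 etam etaB S0 ST sm sa sb HD onto.
have T2 : T / 2 \in `]0, T[ by rewrite in_itv/=; apply/andP; split; lra.
have [u [uab uB Su]] := onto _ T2.
pose d := S (eta u) - sigma u.
have dE t : t \in `[a, b] -> `|eta t| < B -> S (eta t) - sigma t = d.
  move=> tab tB; have [tu|ut|->//] := ltgtP t u.
    by have := HD _ _ tab uab tB uB tu; rewrite /d; lra.
  by have := HD _ _ uab tab uB tB ut; rewrite /d; lra.
have aab : a \in `[a, b] by rewrite in_itv/= lexx ltW.
have bab : b \in `[a, b] by rewrite in_itv/= lexx ltW.
have sle s t : s \in `[a, b] -> t \in `[a, b] -> s <= t -> sigma s <= sigma t.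
  by move=> sab' tab; rewrite le_eqVlt => /predU1P[->//|/(sm _ _ sab' tab)/ltW].
have s0T t : t \in `[a, b] -> 0 <= sigma t <= T.
  move=> tab; rewrite -sa -sb; move: (tab); rewrite in_itv/= => /andP[at_ tb].
  by rewrite !sle.
(* If [d] were positive, a small value [h] of [S (eta t)] would give [sigma t = h - d < 0]; if
   negative, a value [T - h] would give [sigma t > T]. *)
have d0 : d = 0.
  apply/eqP; rewrite eq_le; apply/andP; split.
    rewrite leNgt; apply/negP => dpos.
    pose h := Num.min d T / 2.
    have [h0 hd hT] : [/\ 0 < h, h < d & h < T].
      have m0 : 0 < Num.min d T by rewrite lt_min dpos.
      have md : Num.min d T <= d by rewrite ge_min lexx.
      have mT : Num.min d T <= T by rewrite ge_min lexx orbT.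
      by rewrite /h; split; lra.
    have [|t [tab tB Et]] := onto h; first by rewrite in_itv/= h0.
    by have := dE t tab tB; have /andP[] := s0T t tab; rewrite Et; lra.
  rewrite leNgt; apply/negP => dneg.
  pose h := Num.min (- d) T / 2.
  have [h0 hd hT] : [/\ 0 < h, h < - d & h < T].
    have m0 : 0 < Num.min (- d) T by rewrite lt_min oppr_gt0 dneg.
    have md : Num.min (- d) T <= - d by rewrite ge_min lexx.
    have mT : Num.min (- d) T <= T by rewrite ge_min lexx orbT.
    by rewrite /h; split; lra.
  have [|t [tab tB Et]] := onto (T - h); first by rewrite in_itv/=; apply/andP; split; lra.
  by have := dE t tab tB; have /andP[] := s0T t tab; rewrite Et; lra.
move=> t tab; have [tB|] := ltP `|eta t| B.
  by apply/eqP; rewrite -subr_eq0 dE// d0.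
move=> Bt; have {Bt} : `|eta t| = B by apply/eqP; rewrite eq_le Bt etaB.
(* Had [eta] reached [B] at a time [t] with [sigma t < T], some value of [S] between [sigma t] and
   [T] would have to be attained later inside the open range, against monotonicity. The end [- B] is
   symmetric. *)
move/eqP; rewrite eqr_norml => /andP[/orP[/eqP E|/eqP E] _]; rewrite E ?S0 ?ST.
  apply/eqP; rewrite eq_le andbC; have /andP[_ ->] := s0T t tab; rewrite /= leNgt; apply/negP => lt.
  have [|s [sab' sB Es]] := onto ((sigma t + T) / 2).
    by rewrite in_itv/=; have /andP[h0 _] := s0T t tab; apply/andP; split; lra.
  have sE : S (eta s) = sigma s by apply/eqP; rewrite -subr_eq0 dE// d0.
  have st : t <= s.
    rewrite leNgt; apply/negP => /(sm _ _ sab' tab); rewrite -sE Es; lra.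
  have := etam _ _ tab sab' st; rewrite E => h.
  by move: sB; rewrite ltr_norml => /andP[_]; rewrite ltNge h.
apply/eqP; rewrite eq_le; have /andP[-> _] := s0T t tab; rewrite /= leNgt; apply/negP => lt.
have [|s [sab' sB Es]] := onto (sigma t / 2).
  by rewrite in_itv/=; have /andP[_ hT] := s0T t tab; apply/andP; split; lra.
have sE : S (eta s) = sigma s by apply/eqP; rewrite -subr_eq0 dE// d0.
have st : s <= t.
  rewrite leNgt; apply/negP => /(sm _ _ tab sab'); rewrite -sE Es; lra.
have := etam _ _ sab' tab st; rewrite E => h.
by move: sB; rewrite ltr_norml => /andP[]; rewrite ltNge h.
Qed.

End Traverse.

Section EqualityCase.
Context {R : realType}.
Implicit Types (s t x y : R).
Local Notation mu := (@lebesgue_measure R).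
Variable p : R.
Hypothesis p1 : 1 < p.
Let q := qstar p.
Let K := K1c p q.
Let B : R := 2 * asin q.
Let p0 : 0 < p. Proof. exact: lt_trans ltr01 p1. Qed.
Let q01 : 0 < q < 1. Proof. by have [] := qstarP p1. Qed.
Let q01' : 0 <= q < 1. Proof. by case/andP: q01 => /ltW -> ->. Qed.
Let q01c : 0 < q <= 1. Proof. by case/andP: q01 => -> /ltW ->. Qed.
Let q_gt0 : 0 < q. Proof. by case/andP: q01. Qed.
Let pi2 : 0 < pi / 2 :> R. Proof. by rewrite divr_gt0// pi_gt0. Qed.
Let K0 : 0 < K. Proof. exact: K1c_gt0. Qed.

Let qb : -1 <= q <= 1.
Proof. by apply/andP; split; [have := q_gt0; lra|case/andP: q01c]. Qed.

Let asin_lt : asin q < pi / 2.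
Proof. by apply: asin_ltpi2; case/andP: qb => -> _; case/andP: q01. Qed.

Definition inverse_angle y := asin (sin (y / 2) / q).
(** Arclength on the model leaf as a function of the tangent angle, the inverse of [fig_angle]. *)
Definition inverse_time y := F1 p (inverse_angle y) q + K.

Lemma half_angle_bound y : `|y| <= B -> y / 2 \in `[- (pi / 2), pi / 2].
Proof.
rewrite /B ler_norml in_itv/= => /andP[h1 h2]; have h := asin_lt.
by apply/andP; split; lra.
Qed.

Lemma sin_half_bound y : `|y| <= B -> -1 <= sin (y / 2) / q <= 1.
Proof.
move=> yB; have yi := half_angle_bound yB.
have h3 := asin_geNpi2 qb; have h4 := asin_lepi2 qb.
have qi : asin q \in `[- (pi / 2), pi / 2] by rewrite in_itv/= h3.
have qNi : - asin q \in `[- (pi / 2), pi / 2] by rewrite in_itv/=; apply/andP; split; lra.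
move: yB; rewrite /B ler_norml => /andP[h1 h2].
rewrite ler_pdivlMr// ler_pdivrMr// mulN1r mul1r.
rewrite -[X in - X <= _ <= X](asinK (x := q)) ?in_itv//= -sinN.
by apply/andP; split; rewrite leNgt ltr_sin// -leNgt; lra.
Qed.

Lemma sin_half_bound_lt y : `|y| < B -> -1 < sin (y / 2) / q < 1.
Proof.
move=> yB; have yi := half_angle_bound (ltW yB).
have h3 := asin_geNpi2 qb; have h4 := asin_lepi2 qb.
have qi : asin q \in `[- (pi / 2), pi / 2] by rewrite in_itv/= h3.
have qNi : - asin q \in `[- (pi / 2), pi / 2] by rewrite in_itv/=; apply/andP; split; lra.
move: yB; rewrite /B ltr_norml => /andP[h1 h2].
rewrite ltr_pdivlMr// ltr_pdivrMr// mulN1r mul1r.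
rewrite -[X in - X < _ < X](asinK (x := q)) ?in_itv//= -sinN.
by apply/andP; split; rewrite ltr_sin//; lra.
Qed.

Lemma angle_inverse_angle y : `|y| <= B -> angle q (inverse_angle y) = y.
Proof.
move=> yB; rewrite /angle /inverse_angle asinK ?in_itv/= ?sin_half_bound//.
rewrite [q * _]mulrC divfK ?gt_eqF// sinK ?half_angle_bound//.
by field.
Qed.

Lemma fig_angle_inverse_time y : `|y| <= B -> fig_angle p (inverse_time y) = y.
Proof.
by move=> yB; rewrite /fig_angle /inverse_time fig_amplitude_F1// angle_inverse_angle.
Qed.

Lemma inverse_time_fig_angle s : s \in `[0, 2 * K] -> inverse_time (fig_angle p s) = s.
Proof.
move=> si; have [xi Fx] := fig_amplitude_itv p1 si.
rewrite /inverse_time /inverse_angle /fig_angle /angle.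
rewrite [2 * _]mulrC mulfK// asinK ?in_itv/= ?q_sin_le1//.
rewrite -/q [q * sin _]mulrC mulfK ?gt_eqF// sinK// Fx -/q -/K subrK//.
Qed.

Lemma is_derive_inverse_time y : `|y| < B ->
  is_derive y 1 inverse_time (((fig_rate p * (cos y + fig_height p)) `^ p^-1)^-1).
Proof.
move=> yB; have sb := sin_half_bound_lt yB.
set x := inverse_angle y.
have cxE : cos x = Num.sqrt (1 - (sin (y / 2) / q) ^+ 2).
  by rewrite /x /inverse_angle cos_asin//; case/andP: sb => /ltW -> /ltW ->.
have cx : 0 < cos x.
  rewrite cxE sqrtr_gt0 subr_gt0 -real_normK ?num_real// exprn_ilt1// ltr_norml.
  by case/andP: sb => -> ->.
have yi : - (pi / 2) < y / 2 < pi / 2.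
  move: yB; rewrite /B ltr_norml => /andP[h1 h2]; have h := asin_lt.
  by apply/andP; split; lra.
have cy : 0 < cos (y / 2) by exact: cos_gt0_pihalf.
have dx : delta q x = cos (y / 2).
  rewrite /delta /x /inverse_angle asinK ?in_itv/=; last by case/andP: sb => /ltW -> /ltW ->.
  rewrite -exprMn mulrC divfK ?gt_eqF// -cos2sin2 sqrtr_sqr gtr0_norm//.
have dxd : is_derive y 1 inverse_angle (cos (y / 2) / (2 * q * cos x)).
  have D1 := is_derive_scale (q^-1) (@is_derive_chain R (@sin R) (fun y => 2^-1 * y) y _ _ (is_derive_sinR _)
    (is_derive_scale 2^-1 (is_derive_idfun y))).
  have D1' : is_derive y 1 (fun y => sin (y / 2) / q) (cos (y / 2) / 2 / q).
    have -> : (fun y => sin (y / 2) / q) = (fun y => q^-1 * sin (2^-1 * y)).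
      by apply/funext => w; rewrite mulrC [w / 2]mulrC.
    by apply: is_derive_eq D1 _; rewrite [2^-1 * y]mulrC; ring.
  have D2 := @is_derive_chain R (@asin R) (fun y => sin (y / 2) / q) y _ _ (is_derive1_asin sb) D1'.
  apply: is_derive_eq D2 _; rewrite -cxE; field.
  by rewrite (gt_eqF cx) gt_eqF.
have cn : cos x != 0 by rewrite gt_eqF.
have D := is_derive_add (@is_derive_chain R (fun x => F1 p x q) inverse_angle y _ _ (is_derive_F1 p1 q01' cn) dxd)
  (is_derive_const K y).
apply: is_derive_eq D _.
have -> : cos y + fig_height p = 2 * q ^+ 2 * cos x ^+ 2.
  by rewrite -{1}(angle_inverse_angle (ltW yB)) cos_angle// /fig_height cos2sin2 -/q -/x; ring.
rewrite fig_rate_zone// -/q dx addr0.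
have yc : 0 < `|cos x| `^ (1 - 2 / p) by rewrite powR_gt0// normr_gt0.
by field; rewrite !gt_eqF.
Qed.

End EqualityCase.

(** * From the equation of the angle to the half-fold figure-eight *)

Section EqualityCurve.
Context {R : realType}.
Implicit Types (s t x y : R).
Local Notation mu := (@lebesgue_measure R).

Lemma within_continuous_comp_itv a b c d (f g : R -> R) :
  {within `[a, b], continuous g} -> {within `[c, d], continuous f} ->
  {in `[a, b], forall t, g t \in `[c, d]} ->
  {within `[a, b], continuous (fun t => f (g t))}.
Proof.
move=> cg cf gcd; apply: within_continuous_epsP => t tab e e0.
have [d1 [d10 H1]] := within_continuous_eps cf (gcd t tab) e0.
have [d2 [d20 H2]] := within_continuous_eps cg tab d10.
by exists d2; split=> // s sab st; rewrite ltW// H1 ?gcd// H2.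
Qed.

Lemma reparam_increasing a b c d (phi : R -> R) : a <= b -> {within `[a, b], continuous phi} ->
  {in `[a, b] &, forall s t, s < t -> phi s < phi t} -> phi a = c -> phi b = d ->
  reparam a b c d phi.
Proof.
move=> ab cphi phim <- <-.
have phile s t : s \in `[a, b] -> t \in `[a, b] -> s <= t -> phi s <= phi t.
  by move=> sab tab; rewrite le_eqVlt => /predU1P[->//|/(phim _ _ sab tab)/ltW].
have aab : a \in `[a, b] by rewrite in_itv/= lexx.
have bab : b \in `[a, b] by rewrite in_itv/= lexx andbT.
split=> //; split.
- move=> t /= tab; move: (tab); rewrite !in_itv/= => /andP[at_ tb].
  by rewrite !phile.
- move=> s t; rewrite !inE /= => sab tab E.
  by have [st|ts|//] := ltgtP s t; [have := phim _ _ sab tab st|have := phim _ _ tab sab ts]; rewrite E ltxx.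
- by apply: segment_continuous_le_surjective => //; exact: phile.
Qed.

Variable p : R.
Hypothesis p1 : 1 < p.
Let q := qstar p.
Let K := K1c p q.
Let B : R := 2 * asin q.
Let p0 : 0 < p. Proof. exact: lt_trans ltr01 p1. Qed.
Let q01 : 0 < q < 1. Proof. by have [] := qstarP p1. Qed.
Let K0 : 0 < K. Proof. exact: K1c_gt0. Qed.
Let rate0 := fig_rate_gt0 p1.

Let q0 : 0 < q. Proof. by case/andP: q01. Qed.

Let half_zone y : cos y + fig_height p = 2 * (q ^+ 2 * (1 - (sin (y / 2) / q) ^+ 2)).
Proof.
have -> : cos y = 1 - 2 * sin (y / 2) ^+ 2.
  have -> : cos y = cos ((y / 2) *+ 2) by rewrite mulr2n; congr cos; field.
  by rewrite cos_mulr2n cos2sin2; ring.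
by rewrite /fig_height -/q; field; rewrite gt_eqF.
Qed.

Lemma fig_zone_ge0 y : `|y| <= B -> 0 <= cos y + fig_height p.
Proof.
move=> /(sin_half_bound p1); rewrite -/q half_zone => sb.
rewrite mulr_ge0// mulr_ge0 ?sqr_ge0// subr_ge0 -real_normK ?num_real//.
by rewrite exprn_ile1// ler_norml.
Qed.

Lemma zone_gt0 y : `|y| < B -> 0 < cos y + fig_height p.
Proof.
move=> /(sin_half_bound_lt p1); rewrite -/q half_zone => sb.
rewrite mulr_gt0// mulr_gt0 ?exprn_gt0// subr_gt0 -real_normK ?num_real//.
by rewrite exprn_ilt1// ltr_norml.
Qed.

Lemma fig_zone_gt0 s : s \in `]0, 2 * K[ -> 0 < cos (fig_angle p s) + fig_height p.
Proof.
move=> si; have cx := cos_fig_amplitude_gt0 p1 si; have q0' := q0.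
by rewrite fig_zone// mulr_gt0 ?exprn_gt0// mulr_gt0 ?exprn_gt0.
Qed.

Lemma fig_angle_lt s : s \in `]0, 2 * K[ -> `|fig_angle p s| < B.
Proof.
move=> si; move: (si); rewrite in_itv/= => /andP[s0 sK].
have lt c d : 0 <= c -> c < d -> d <= 2 * K -> fig_angle p c < fig_angle p d.
  move=> c0 cd dK.
  have cf := within_continuous_subitv c0 dK (continuous_fig_angle p1).
  have sub x : x \in `]c, d[ -> x \in `]0, 2 * K[.
    by rewrite !in_itv/= => /andP[h1 h2]; apply/andP; split; [exact: le_lt_trans h1|exact: lt_le_trans dK].
  apply: (@derive_gt0_lt R c d (fig_angle p) (fun s => (fig_rate p * (cos (fig_angle p s) + fig_height p)) `^ p^-1)) => // x /sub xi.
    exact: is_derive_fig_angle.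
  by rewrite powR_gt0// mulr_gt0// fig_zone_gt0.
rewrite ltr_norml /B /q; apply/andP; split.
  by rewrite -fig_angle0// lt// ltW.
by rewrite -fig_angle_end// lt// ltW.
Qed.

Lemma inverse_time0 : inverse_time p (- B) = 0.
Proof. by rewrite /B /q -fig_angle0// inverse_time_fig_angle// in_itv/= lexx mulr_ge0// ltW. Qed.

Lemma inverse_time_end : inverse_time p B = 2 * K.
Proof. by rewrite /B /q -fig_angle_end// inverse_time_fig_angle// in_itv/= lexx andbT mulr_ge0// ltW. Qed.

Variables (a b lam : R) (v eta : R -> R).
Hypothesis ab : a < b.
Hypothesis cv : {within `[a, b], continuous v}.
Hypothesis v0 : {in `[a, b], forall t, 0 < v t}.
Hypothesis lam0 : 0 < lam.
Hypothesis vlam : \int[mu]_(t in `[a, b]) v t = lam * (2 * K).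
Hypothesis Aeta : AC a b eta (fun t => v t / lam * (fig_rate p * (cos (eta t) + fig_height p)) `^ p^-1).
Hypothesis etaB : {in `[a, b], forall t, `|eta t| <= B}.
Hypothesis eta_end : exists s t, [/\ s \in `[a, b], t \in `[a, b], eta s = - B & eta t = B].

(** Arclength from [a] in units of [lam], the ratio of the length of the loop to the length [2 K] of
    the model leaf; it will be the reparameterization. *)
Definition leaf_time t := (\int[mu]_(s in `[a, t]) v s) / lam.
Local Notation sigma := leaf_time.

Let aab : a \in `[a, b]. Proof. by rewrite in_itv/= lexx ltW. Qed.
Let bab : b \in `[a, b]. Proof. by rewrite in_itv/= lexx ltW. Qed.

Lemma leaf_time_AC : AC a b sigma (fun t => v t / lam).
Proof.
have A : AC a b (fun t => \int[mu]_(s in `[a, t]) v s) v.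
  split; first exact: continuous_itv_integrable.
  by move=> t _; rewrite set_itv1 Rintegral_set1 add0r.
have := AC_scale lam^-1 (ltW ab) A.
by apply: eq_AC => t _; rewrite mulrC.
Qed.

Let sigma_lt : {in `[a, b] &, forall s t, s < t -> sigma s < sigma t}.
Proof.
move=> s t; rewrite !in_itv/= => /andP[as_ sb] /andP[at_ tb] st.
rewrite -subr_gt0 (AC_sub leaf_time_AC)//; last exact: ltW.
have cvl : {within `[s, t], continuous (fun t => v t / lam)}.
  apply: (within_continuous_subitv as_ tb); apply: within_continuous_mul => //.
  by apply: continuous_subspaceT => x; exact: cvg_cst.
have st' x : x \in `[s, t] -> 0 < v x / lam.
  rewrite in_itv/= => /andP[sx xt]; rewrite divr_gt0// v0// in_itv/= (le_trans as_ sx).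
  exact: le_trans tb.
have ss : s \in `[s, t] by rewrite in_itv/= lexx ltW.
by apply: (Rintegral_gt0 st cvl _ ss) => [x xi|]; [exact: ltW (st' x xi)|exact: st'].
Qed.

Let sigma_a : sigma a = 0.
Proof. by rewrite /sigma set_itv1 Rintegral_set1 mul0r. Qed.

Let sigma_b : sigma b = 2 * K.
Proof. by rewrite /sigma vlam mulrC mulKf ?gt_eqF. Qed.

Let sigma_cont : {within `[a, b], continuous sigma}.
Proof. exact: AC_continuous (ltW ab) leaf_time_AC. Qed.

Lemma leaf_time_reparam : reparam a b 0 (2 * K) sigma.
Proof. exact: reparam_increasing (ltW ab) sigma_cont sigma_lt sigma_a sigma_b. Qed.

Let sigma_itv t : t \in `[a, b] -> sigma t \in `[0, 2 * K].
Proof. by have [_ [+ _ _]] := leaf_time_reparam => /(_ t). Qed.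

Let sigma_oo t : t \in `]a, b[ -> sigma t \in `]0, 2 * K[.
Proof.
rewrite in_itv/= => /andP[at_ tb].
have tab : t \in `[a, b] by rewrite in_itv/= !ltW.
by rewrite in_itv/= -{1}sigma_a -sigma_b !sigma_lt.
Qed.

Let ceta : {within `[a, b], continuous eta}.
Proof. exact: AC_continuous (ltW ab) Aeta. Qed.

Let vl_cont : {within `[a, b], continuous (fun t => v t / lam)}.
Proof.
by apply: within_continuous_mul => //; apply: continuous_subspaceT => x; exact: cvg_cst.
Qed.

Let deta_cont : {within `[a, b], continuous
  (fun t => v t / lam * (fig_rate p * (cos (eta t) + fig_height p)) `^ p^-1)}.
Proof.
apply: within_continuous_mul => //.
have cpow : continuous (fun x : R => `|x| `^ p^-1) by apply: continuous_normr_powR; rewrite invr_gt0.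
apply: (@subspace_eq_continuous _ _ _ (fun t => `|fig_rate p * (cos (eta t) + fig_height p)| `^ p^-1)).
  move=> t; rewrite inE => tab.
  change (`|fig_rate p * (cos (eta t) + fig_height p)| `^ p^-1 = (fig_rate p * (cos (eta t) + fig_height p)) `^ p^-1).
  by rewrite ger0_norm// mulr_ge0 ?(ltW rate0)// fig_zone_ge0// etaB.
apply: (@within_continuous_comp _ _ _ _ eta (fun y => `|fig_rate p * (cos y + fig_height p)| `^ p^-1)) => //.
move=> y _; apply: (@continuous_comp _ _ _ (fun y => fig_rate p * (cos y + fig_height p)) (fun x => `|x| `^ p^-1)) => //.
  apply: continuousM; first exact: cvg_cst.
  by apply: continuousD; [exact: continuous_cos|exact: cvg_cst].
exact: cpow.
Qed.

Let eta_le : {in `[a, b] &, forall s t, s <= t -> eta s <= eta t}.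
Proof.
apply: AC_le Aeta _ => t tab; rewrite mulr_ge0 ?powR_ge0// divr_ge0 ?(ltW lam0)// ltW// v0//.
Qed.

Let onto h : h \in `]0, 2 * K[ -> exists t, [/\ t \in `[a, b], `|eta t| < B & inverse_time p (eta t) = h].
Proof.
move=> hi; have hi' : h \in `[0, 2 * K].
  by move: hi; rewrite !in_itv/= => /andP[h1 h2]; rewrite !ltW.
have fB := fig_angle_lt hi.
have [s [t [sab tab es et]]] := eta_end.
have B0 : 0 < B by exact: le_lt_trans fB.
have st : s <= t.
  by rewrite leNgt; apply/negP => /ltW /(eta_le tab sab); rewrite es et; lra.
move: (sab) (tab); rewrite !in_itv/= => /andP[as_ sb] /andP[at_ tb].
have [|x xi ex] := @IVT _ eta s t (fig_angle p h) st (within_continuous_subitv as_ tb ceta).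
  move: fB; rewrite es et ltr_norml => /andP[h1 h2].
  by rewrite min_l ?max_r; [apply/andP; split; lra|lra|lra].
exists x; rewrite ex fB inverse_time_fig_angle//; split=> //.
by move: xi; rewrite !in_itv/= => /andP[h1 h2]; rewrite (le_trans as_)//= (le_trans _ tb).
Qed.

(** Separation of variables: in the open range of angles the right-hand side of the equation is
    positive, and dividing by it shows that the model time of [eta] and [sigma] have the same
    derivative. *)
Let inverse_time_diff s t : s \in `[a, b] -> t \in `[a, b] -> `|eta s| < B -> `|eta t| < B -> s < t ->
  inverse_time p (eta t) - inverse_time p (eta s) = sigma t - sigma s.
Proof.
move=> sab tab sB tB st; move: (sab) (tab); rewrite !in_itv/= => /andP[as_ sb] /andP[at_ tb].
have etaBst x : x \in `[s, t] -> `|eta x| < B.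
  rewrite in_itv/= => /andP[sx xt].
  have xab : x \in `[a, b] by rewrite in_itv/= (le_trans as_ sx) (le_trans xt tb).
  move: sB tB; rewrite !ltr_norml => /andP[h1 h2] /andP[h3 h4].
  by rewrite (lt_le_trans h1) ?(le_lt_trans _ h4)// eta_le.
pose D x := inverse_time p (eta x) - sigma x.
have cD : {within `[s, t], continuous D}.
  apply: within_continuous_sub; last exact: within_continuous_subitv as_ tb sigma_cont.
  apply: within_continuous_comp; last exact: within_continuous_subitv as_ tb ceta.
  move=> _ /set_mem[x /= xi <-]; apply: is_derive_continuous.
  by apply: is_derive_inverse_time => //; exact: etaBst.
have dD : {in `]s, t[, forall x, is_derive x 1 D 0}.
  move=> x; rewrite in_itv/= => /andP[sx xt].
  have xst : x \in `[s, t] by rewrite in_itv/= !ltW.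
  have xab : x \in `]a, b[ by rewrite in_itv/= (le_lt_trans as_ sx) (lt_le_trans xt tb).
  have De := AC_is_derive ab Aeta deta_cont xab.
  have Ds := AC_is_derive ab leaf_time_AC vl_cont xab.
  have DD := is_derive_sub (is_derive_chain (is_derive_inverse_time p1 (etaBst x xst)) De) Ds.
  apply: is_derive_eq DD _.
  have r0 : 0 < (fig_rate p * (cos (eta x) + fig_height p)) `^ p^-1.
    by rewrite powR_gt0// mulr_gt0// zone_gt0// etaBst.
  by field; rewrite !gt_eqF.
have tst : t \in `[s, t] by rewrite in_itv/= lexx ltW.
have := derive_eq0 cD dD tst; rewrite /D; lra.
Qed.

Lemma leaf_angle : {in `[a, b], forall t, eta t = fig_angle p (sigma t)}.
Proof.
move=> t tab.
have T0 : 0 < 2 * K by rewrite mulr_gt0.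
have <- := traverse_without_rest ab T0 eta_le etaB inverse_time0 inverse_time_end sigma_lt
  sigma_a sigma_b inverse_time_diff onto tab.
by rewrite fig_angle_inverse_time// etaB.
Qed.

(** The angle [th0] becomes the rotation, [lam] the dilation and the sign [e] the reflection. The
    curve minus the transformed model has zero derivative, and the constant difference is the
    translation. *)
Lemma leaf_half_fold (g : R -> R * R) (th0 : R) (e : bool) :
  {within `[a, b], continuous (crd1 g)} -> {within `[a, b], continuous (crd2 g)} ->
  {in `]a, b[, forall t, is_derive t 1 (crd1 g) (v t * cos (th0 + (-1) ^+ e * eta t))} ->
  {in `]a, b[, forall t, is_derive t 1 (crd2 g) (v t * sin (th0 + (-1) ^+ e * eta t))} ->
  half_fold_figure_eight p a b g.
Proof.
move=> cg1 cg2 dg1 dg2.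
have cx : {within `[a, b], continuous (fun t => fig_x p (sigma t))}.
  exact: within_continuous_comp_itv sigma_cont (continuous_fig_x p1) sigma_itv.
have cy : {within `[a, b], continuous (fun t => fig_y p (sigma t))}.
  exact: within_continuous_comp_itv sigma_cont (continuous_fig_y p1) sigma_itv.
have cM (k : R) (f : R -> R) : {within `[a, b], continuous f} -> {within `[a, b], continuous (fun t => k * f t)}.
  by move=> cf; apply: within_continuous_mul => //; apply: continuous_subspaceT => x; exact: cvg_cst.
have dx t : t \in `]a, b[ -> is_derive t 1 (fun t => fig_x p (sigma t)) (cos (eta t) * (v t / lam)).
  move=> ti; have tab : t \in `[a, b] by move: ti; rewrite !in_itv/= => /andP[/ltW -> /ltW ->].
  rewrite (leaf_angle tab).
  exact: is_derive_chain (is_derive_fig_x p1 (sigma_oo ti)) (AC_is_derive ab leaf_time_AC vl_cont ti).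
have dy t : t \in `]a, b[ -> is_derive t 1 (fun t => fig_y p (sigma t)) (sin (eta t) * (v t / lam)).
  move=> ti; have tab : t \in `[a, b] by move: ti; rewrite !in_itv/= => /andP[/ltW -> /ltW ->].
  rewrite (leaf_angle tab).
  exact: is_derive_chain (is_derive_fig_y p1 (sigma_oo ti)) (AC_is_derive ab leaf_time_AC vl_cont ti).
have ce t : cos ((-1) ^+ e * eta t) = cos (eta t).
  by case: (e); rewrite ?expr1 ?expr0 ?mulN1r ?cosN ?mul1r.
have se t : sin ((-1) ^+ e * eta t) = (-1) ^+ e * sin (eta t).
  by case: (e); rewrite ?expr1 ?expr0 ?mulN1r ?sinN ?mul1r.
have ln : lam != 0 by rewrite gt_eqF.
pose D1 t := crd1 g t - lam * (cos th0 * fig_x p (sigma t) - sin th0 * ((-1) ^+ e * fig_y p (sigma t))).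
pose D2 t := crd2 g t - lam * (sin th0 * fig_x p (sigma t) + cos th0 * ((-1) ^+ e * fig_y p (sigma t))).
have E1 : {in `[a, b], forall t, D1 t = D1 a}.
  apply: derive_eq0.
    exact: within_continuous_sub cg1 (cM lam _ (within_continuous_sub (cM (cos th0) _ cx) (cM (sin th0) _ (cM ((-1) ^+ e) _ cy)))).
  move=> t ti.
  have D := is_derive_sub (dg1 t ti) (is_derive_scale lam (is_derive_sub (is_derive_scale (cos th0) (dx t ti))
    (is_derive_scale (sin th0) (is_derive_scale ((-1) ^+ e) (dy t ti))))).
  by apply: is_derive_eq D _; rewrite cosD ce se; field.
have E2 : {in `[a, b], forall t, D2 t = D2 a}.
  apply: derive_eq0.
    exact: within_continuous_sub cg2 (cM lam _ (within_continuous_add (cM (sin th0) _ cx) (cM (cos th0) _ (cM ((-1) ^+ e) _ cy)))).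
  move=> t ti.
  have D := is_derive_sub (dg2 t ti) (is_derive_scale lam (is_derive_add (is_derive_scale (sin th0) (dx t ti))
    (is_derive_scale (cos th0) (is_derive_scale ((-1) ^+ e) (dy t ti))))).
  by apply: is_derive_eq D _; rewrite sinD ce se; field.
exists lam, th0, e, (D1 a, D2 a), sigma; split=> //; first exact: leaf_time_reparam.
move=> t tab; rewrite [g t]surjective_pairing -/(crd1 g t) -/(crd2 g t).
rewrite /similarity -/(fig_x p (sigma t)) -/(fig_y p (sigma t)) /= -(E1 t tab) -(E2 t tab).
by congr (_, _); rewrite subrK.
Qed.

End EqualityCurve.

(** * Energy of a leaf *)

Section LeafEnergy.
Context {R : realType}.
Implicit Types (p s t x y : R).
Local Notation mu := (@lebesgue_measure R).

(** A continuous injection on an interval is monotone; [e] is true when the orientation is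
    reversed. *)
Lemma reparam_ends a b T (phi : R -> R) : a <= b -> 0 <= T -> reparam a b 0 T phi ->
  exists e : bool,
    [/\ {in `[a, b] &, forall s t, s < t -> 0 < (-1) ^+ e * (phi t - phi s)},
        phi a = (if e then T else 0) & phi b = (if e then 0 else T)].
Proof.
move=> ab T0 [cphi [phiT injphi surj]].
have aab : a \in `[a, b] by rewrite in_itv/= lexx.
have bab : b \in `[a, b] by rewrite in_itv/= lexx andbT.
have bnd t : t \in `[a, b] -> 0 <= phi t <= T by move=> /phiT; rewrite /= in_itv.
have [s0 s0ab E0] : exists2 s, s \in `[a, b] & phi s = 0.
  by apply: surj; rewrite /= in_itv/= lexx.
have [s1 s1ab E1] : exists2 s, s \in `[a, b] & phi s = T.
  by apply: surj; rewrite /= in_itv/= lexx andbT.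
move: (s0ab) (s1ab); rewrite !in_itv/= => /andP[as0 s0b] /andP[as1 s1b].
have inj' : {in `[a, b] &, injective phi}.
  by move=> s t sab tab; apply: injphi; rewrite inE.
have [m|m] := itv_continuous_inj_mono cphi inj'.
  have m' s t : s \in `[a, b] -> t \in `[a, b] -> s <= t -> phi s <= phi t.
    by move=> sab tab; rewrite le_eqVlt => /predU1P[->//|/(m _ _ sab tab)/ltW].
  exists false; split.
  - by move=> s t sab tab st; rewrite expr0 mul1r subr_gt0 m.
  - by apply/eqP; rewrite eq_le; have /andP[-> _] := bnd a aab; rewrite -E0 m'.
  - by apply/eqP; rewrite eq_le; have /andP[_ ->] := bnd b bab; rewrite -E1 m'.
have m' s t : s \in `[a, b] -> t \in `[a, b] -> s <= t -> phi t <= phi s.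
  by move=> sab tab; rewrite le_eqVlt => /predU1P[->//|/(m _ _ tab sab)/ltW].
exists true; split.
- by move=> s t sab tab st; rewrite expr1 mulN1r opprB subr_gt0 m.
- by apply/eqP; rewrite eq_le; have /andP[_ ->] := bnd a aab; rewrite -E1 m'.
- by apply/eqP; rewrite eq_le; have /andP[-> _] := bnd b bab; rewrite -E0 m'.
Qed.

(* Carathéodory: [phi t - phi t0 = (W t - W t0) / h (phi t)]. *)
Lemma is_derive_left_factor (Z W phi : R -> R) t w :
  {for t, continuous phi} -> is_derive (phi t) 1 Z 1 -> is_derive t 1 W w ->
  (\forall y \near t, W y = Z (phi y)) -> is_derive t 1 phi w.
Proof.
move=> cphi /is_derive1_caratheodory[h [hE ch h1]] /is_derive1_caratheodory[k [kE ck k1]] WZ.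
have ch' : {for t, continuous (fun y => h (phi y))} by apply: continuous_comp.
have h0 : \forall y \near t, h (phi y) != 0.
  have := cvgr_neq0 _ ch'; apply; rewrite h1; exact: oner_neq0.
apply: (@is_derive_near _ (fun y => phi t + k y / h (phi y) * (y - t))).
  near=> y; have hy : h (phi y) != 0 by near: y.
  have Wy : W y = Z (phi y) by near: y.
  have Wt : W t = Z (phi t) by exact: nbhs_singleton WZ.
  rewrite mulrAC -kE Wy Wt hE mulrAC mulfV// mul1r; ring.
apply/is_derive1_caratheodory; exists (fun y => k y / h (phi y)); split.
- by move=> z /=; rewrite subrr mulr0 addr0; ring.
- by apply: cvgM => //; apply: cvgV => //; rewrite h1 oner_neq0.
- by rewrite h1 k1 divr1.
Unshelve. all: by end_near.
Qed.

(** * Speed and curvature of a half-fold figure-eight *)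

Section HalfFold.
Variable p : R.
Hypothesis p1 : 1 < p.
Let K := K1c p (qstar p).
Let p0 : 0 < p. Proof. exact: lt_trans ltr01 p1. Qed.
Let K0 : 0 < K. Proof. exact: K1c_gt0. Qed.
Variables (a b : R) (g : R -> R * R) (v th k : R -> R).
Hypothesis ab : a < b.
Hypothesis T : tangent_lift p a b g v th k.
Variables (l th0 : R) (sg : bool) (c : R * R) (phi : R -> R).
Hypothesis l0 : 0 < l.
Hypothesis rphi : reparam a b 0 (2 * K) phi.
Hypothesis gE : forall t, t \in `[a, b] -> g t = similarity l th0 sg c (figure_eight p (phi t)).
Variable e : bool.
Hypothesis phim : {in `[a, b] &, forall s t, s < t -> 0 < (-1) ^+ e * (phi t - phi s)}.
Hypothesis phia : phi a = (if e then 2 * K else 0).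
Hypothesis phib : phi b = (if e then 0 else 2 * K).

Let ooW t : t \in `]a, b[ -> t \in `[a, b].
Proof. by rewrite !in_itv/= => /andP[/ltW -> /ltW ->]. Qed.

Let aab : a \in `[a, b]. Proof. by rewrite in_itv/= lexx ltW. Qed.
Let bab : b \in `[a, b]. Proof. by rewrite in_itv/= lexx ltW. Qed.

Let phi_itv : {in `[a, b], forall t, phi t \in `[0, 2 * K]}.
Proof. by have [_ [phiT _ _]] := rphi => t /phiT. Qed.

Lemma half_fold_time_oo t : t \in `]a, b[ -> phi t \in `]0, 2 * K[.
Proof.
move=> ti; have tab := ooW ti; move: ti; rewrite in_itv/= => /andP[at_ tb].
have := phim aab tab at_; have := phim tab bab tb; rewrite phia phib in_itv/=.
by case: (e); rewrite ?expr1 ?expr0 => h1 h2; apply/andP; split; lra.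
Qed.

Let x_of t := l^-1 * (cos th0 * (crd1 g t - c.1) + sin th0 * (crd2 g t - c.2)).
Let y_of t := l^-1 * ((-1) ^+ sg * (cos th0 * (crd2 g t - c.2) - sin th0 * (crd1 g t - c.1))).

Let crd1E t : t \in `[a, b] ->
  crd1 g t = c.1 + l * (cos th0 * fig_x p (phi t) - sin th0 * ((-1) ^+ sg * fig_y p (phi t))).
Proof. by move=> tab; rewrite /crd1 gE. Qed.

Let crd2E t : t \in `[a, b] ->
  crd2 g t = c.2 + l * (sin th0 * fig_x p (phi t) + cos th0 * ((-1) ^+ sg * fig_y p (phi t))).
Proof. by move=> tab; rewrite /crd2 gE. Qed.

Let fig_x_time t : t \in `[a, b] -> fig_x p (phi t) = x_of t.
Proof.
move=> tab; rewrite /x_of crd1E// crd2E//.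
have CS := cos2Dsin2 th0.
set x := fig_x _ _; set y := _ * fig_y _ _.
transitivity (l^-1 * (l * ((cos th0 ^+ 2 + sin th0 ^+ 2) * x))); first by rewrite CS mul1r mulKf// gt_eqF.
by ring.
Qed.

Let fig_y_time t : t \in `[a, b] -> fig_y p (phi t) = y_of t.
Proof.
move=> tab; rewrite /y_of crd1E// crd2E//.
have CS := cos2Dsin2 th0.
set x := fig_x _ _; set y := fig_y _ _.
transitivity (l^-1 * (l * ((cos th0 ^+ 2 + sin th0 ^+ 2) * ((-1) ^+ sg * (-1) ^+ sg * y)))).
  by rewrite CS mul1r mulKf ?gt_eqF// -expr2 sqrr_sign mul1r.
by ring.
Qed.

Let near_oo t : t \in `]a, b[ -> \forall y \near t, y \in `]a, b[.
Proof. by move=> ti; apply: near_in_itvoo. Qed.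

Let x_of_derive t : t \in `]a, b[ -> is_derive t 1 x_of (v t / l * cos (th t - th0)).
Proof.
move=> ti.
have D := is_derive_scale l^-1 (is_derive_add
  (is_derive_scale (cos th0) (is_derive_sub (tl_derive1 T ti) (is_derive_const c.1 t)))
  (is_derive_scale (sin th0) (is_derive_sub (tl_derive2 T ti) (is_derive_const c.2 t)))).
by apply: is_derive_eq D _; rewrite cosB; ring.
Qed.

Let y_of_derive t : t \in `]a, b[ -> is_derive t 1 y_of (v t / l * ((-1) ^+ sg * sin (th t - th0))).
Proof.
move=> ti.
have D := is_derive_scale l^-1 (is_derive_scale ((-1) ^+ sg) (is_derive_sub
  (is_derive_scale (cos th0) (is_derive_sub (tl_derive2 T ti) (is_derive_const c.2 t)))
  (is_derive_scale (sin th0) (is_derive_sub (tl_derive1 T ti) (is_derive_const c.1 t))))).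
by apply: is_derive_eq D _; rewrite sinB; ring.
Qed.

Let phi_continuous t : t \in `]a, b[ -> {for t, continuous phi}.
Proof.
have /(continuous_within_itvP _ ab)[+ _ _] := rphi.1; exact.
Qed.

(** By definition [phi] is a homeomorphism only. The component of the model curve along its tangent
    at [phi t] has derivative 1 there, while composed with [phi] it is a differentiable expression
    in [g]; [is_derive_left_factor] then differentiates [phi]. *)
Let phi_derivable t : t \in `]a, b[ -> exists w, is_derive t 1 phi w.
Proof.
move=> ti; have si := half_fold_time_oo ti; set al := fig_angle p (phi t).
have DZ := is_derive_add (is_derive_scale (cos al) (is_derive_fig_x p1 si))
  (is_derive_scale (sin al) (is_derive_fig_y p1 si)).
rewrite -/al -!expr2 cos2Dsin2 in DZ.
have DW := is_derive_add (is_derive_scale (cos al) (x_of_derive ti)) (is_derive_scale (sin al) (y_of_derive ti)).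
eexists; apply: is_derive_left_factor (phi_continuous ti) DZ DW _.
by apply: filterS (near_oo ti) => y /ooW yab; rewrite fig_x_time// fig_y_time.
Qed.

(** Comparing the norms of the two expressions of the velocity gives the derivative of [phi] up to
    sign, and monotonicity of [phi] decides the sign. *)
Lemma half_fold_derive t : t \in `]a, b[ -> [/\ is_derive t 1 phi ((-1) ^+ e * (v t / l)),
  cos (th t - th0) = (-1) ^+ e * cos (fig_angle p (phi t)) &
  sin (th t - th0) = (-1) ^+ e * ((-1) ^+ sg * sin (fig_angle p (phi t)))].
Proof.
move=> ti; have si := half_fold_time_oo ti; have [w Dw] := phi_derivable ti.
have vl : 0 < v t / l by rewrite divr_gt0// (tl_speed_gt0 T) ?ooW.
have Ex : v t / l * cos (th t - th0) = cos (fig_angle p (phi t)) * w.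
  apply: is_derive1_uniq (x_of_derive ti) _.
  apply: is_derive_near (is_derive_chain (is_derive_fig_x p1 si) Dw).
  by apply: filterS (near_oo ti) => y /ooW yab; rewrite fig_x_time.
have Ey : v t / l * ((-1) ^+ sg * sin (th t - th0)) = sin (fig_angle p (phi t)) * w.
  apply: is_derive1_uniq (y_of_derive ti) _.
  apply: is_derive_near (is_derive_chain (is_derive_fig_y p1 si) Dw).
  by apply: filterS (near_oo ti) => y /ooW yab; rewrite fig_y_time.
have w0 : 0 <= (-1) ^+ e * w.
  have D := is_derive_scale ((-1) ^+ e) Dw.
  rewrite -(is_derive_derive1 D).
  apply: (@incr_derive1_ge0_itv _ _ true false a b) => //.
    move=> x; rewrite inE => /= xi; have [w' Dw'] := phi_derivable xi.
    by have [] := is_derive_scale ((-1) ^+ e) Dw'.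
  by move=> x y xi yi xy; rewrite -subr_gt0 -mulrBr phim.
have wE : w = (-1) ^+ e * (v t / l).
  have W2 : w ^+ 2 = (v t / l) ^+ 2.
    transitivity ((cos (fig_angle p (phi t)) ^+ 2 + sin (fig_angle p (phi t)) ^+ 2) * w ^+ 2).
      by rewrite cos2Dsin2 mul1r.
    rewrite mulrDl -!exprMn -Ex -Ey !exprMn sqrr_sign mul1r -mulrDr cos2Dsin2.
    by rewrite mulr1.
  have : (-1) ^+ e * w = v t / l.
    apply/eqP; rewrite -(@eqrXn2 _ 2)// ?(ltW vl)//.
    by rewrite exprMn sqrr_sign mul1r W2.
  by move=> <-; rewrite mulrA -expr2 sqrr_sign mul1r.
have vn : v t / l != 0 by rewrite gt_eqF.
split; first by rewrite -wE.
  by apply: (mulfI vn); rewrite Ex wE; ring.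
apply: (mulfI vn).
transitivity ((-1) ^+ sg * (v t / l * ((-1) ^+ sg * sin (th t - th0)))).
  by rewrite mulrCA [_ ^+ sg * (_ * _)]mulrA -expr2 sqrr_sign mul1r.
by rewrite Ey wE; ring.
Qed.

(** The two angles are related through their cosine and sine only. Both relations are
    differentiated, and the sum of the squares gives [k t ^ 2]. *)
Lemma half_fold_curvature : {ae mu, forall t, t \in `]a, b[ ->
  `|k t| = (fig_rate p * (cos (fig_angle p (phi t)) + fig_height p)) `^ p^-1 * (v t / l)}.
Proof.
apply: (@filterS _ _ (ae_filter_ringOfSetsType mu) _ _ _ (AC_derivable_ae ab (tl_angle T))) => t Dth ti.
have si := half_fold_time_oo ti; have [Dphi C S] := half_fold_derive ti.
have vl : 0 < v t / l by rewrite divr_gt0// (tl_speed_gt0 T) ?ooW.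
set r := _ `^ _.
have r0 : 0 <= r by exact: powR_ge0.
have Dfa := is_derive_chain (is_derive_fig_angle p1 si) Dphi; rewrite -/r in Dfa.
have Dth0 := is_derive_sub (Dth ti) (is_derive_const th0 t).
have EC : - sin (th t - th0) * (k t - 0) =
    (-1) ^+ e * (- sin (fig_angle p (phi t)) * (r * ((-1) ^+ e * (v t / l)))).
  apply: is_derive1_uniq (@is_derive_chain R (@cos R) (fun y => th y - th0) t _ _ (is_derive_cosR _) Dth0) _.
  apply: is_derive_near (is_derive_scale ((-1) ^+ e)
    (@is_derive_chain R (@cos R) (fun y => fig_angle p (phi y)) t _ _ (is_derive_cosR _) Dfa)).
  by apply: filterS (near_oo ti) => y yab; have [_ -> _] := half_fold_derive yab.
have ES : cos (th t - th0) * (k t - 0) =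
    (-1) ^+ e * ((-1) ^+ sg * (cos (fig_angle p (phi t)) * (r * ((-1) ^+ e * (v t / l))))).
  apply: is_derive1_uniq (@is_derive_chain R (@sin R) (fun y => th y - th0) t _ _ (is_derive_sinR _) Dth0) _.
  apply: is_derive_near (is_derive_scale ((-1) ^+ e) (is_derive_scale ((-1) ^+ sg)
    (@is_derive_chain R (@sin R) (fun y => fig_angle p (phi y)) t _ _ (is_derive_sinR _) Dfa))).
  by apply: filterS (near_oo ti) => y yab; have [_ _ ->] := half_fold_derive yab.
have K2 : k t ^+ 2 = (r * (v t / l)) ^+ 2.
  transitivity ((cos (th t - th0) * (k t - 0)) ^+ 2 + (- sin (th t - th0) * (k t - 0)) ^+ 2).
    rewrite !exprMn sqrrN -mulrDl cos2Dsin2 mul1r subr0//.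
  rewrite EC ES !exprMn !sqrr_sign sqrrN !mul1r -mulrDl cos2Dsin2; ring.
apply/eqP; rewrite -(@eqrXn2 _ 2)//; last by rewrite mulr_ge0// ltW.
by rewrite real_normK ?num_real// K2.
Qed.

Let cM (x : R) (f : R -> R) : {within `[a, b], continuous f} -> {within `[a, b], continuous (fun t => x * f t)}.
Proof.
by move=> cf; apply: within_continuous_mul => //; apply: continuous_subspaceT => y; exact: cvg_cst.
Qed.

Let vl_cont : {within `[a, b], continuous (fun t => (-1) ^+ e * (v t / l))}.
Proof.
apply: cM; apply: within_continuous_mul; first exact: tl_speed T.
by apply: continuous_subspaceT => y; exact: cvg_cst.
Qed.

Let fa_cont : {within `[a, b], continuous (fun t => cos (fig_angle p (phi t)))}.
Proof.
apply: (@within_continuous_comp _ _ _ _ (fun t => fig_angle p (phi t)) (@cos R)).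
  by move=> y _; exact: continuous_cos.
apply: within_continuous_comp_itv rphi.1 (continuous_fig_angle p1) _.
exact: phi_itv.
Qed.

Lemma half_fold_length : \int[mu]_(t in `[a, b]) v t = l * (2 * K).
Proof.
have A : AC a b phi (fun t => (-1) ^+ e * (v t / l)).
  apply: AC_of_derive (ltW ab) rphi.1 vl_cont _ => t ti.
  by have [] := half_fold_derive ti.
have := AC_sub A (lexx a) (ltW ab) (lexx b).
rewrite phia phib (_ : (fun t => _ * (v t / l)) = (fun t => (-1) ^+ e / l * v t)); last first.
  by apply/funext => t; rewrite mulrA; ring.
rewrite Rintegral_itvZ; last exact: continuous_itv_integrable (tl_speed T).
set I := \int[_]_(_ in _) _ => E.
transitivity (l * ((-1) ^+ e * ((-1) ^+ e / l * I))).
  transitivity (((-1) ^+ e) ^+ 2 * I); first by rewrite sqrr_sign mul1r.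
  by field; rewrite gt_eqF.
by rewrite -E; case: (e); rewrite ?expr1 ?expr0; ring.
Qed.

Let cos_integral : \int[mu]_(t in `[a, b]) (v t * cos (fig_angle p (phi t))) = 0.
Proof.
have A : AC a b (fun t => fig_x p (phi t)) (fun t => cos (fig_angle p (phi t)) * ((-1) ^+ e * (v t / l))).
  apply: AC_of_derive (ltW ab) _ _ _.
  - apply: within_continuous_comp_itv rphi.1 (continuous_fig_x p1) _.
    exact: phi_itv.
  - exact: within_continuous_mul.
  - move=> t ti; have [D _ _] := half_fold_derive ti.
    exact: is_derive_chain (is_derive_fig_x p1 (half_fold_time_oo ti)) D.
have := AC_sub A (lexx a) (ltW ab) (lexx b).
have -> : fig_x p (phi b) - fig_x p (phi a) = 0.
  by rewrite phia phib; case: (e); rewrite /K fig_x0// fig_x_end// subrr.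
have vc := continuous_itv_integrable (within_continuous_mul (tl_speed T) fa_cont).
have -> : (fun t => cos (fig_angle p (phi t)) * ((-1) ^+ e * (v t / l))) =
          (fun t => (-1) ^+ e / l * (v t * cos (fig_angle p (phi t)))).
  by apply/funext => t; ring.
rewrite Rintegral_itvZ// => /esym/eqP; rewrite mulf_eq0 => /orP[|/eqP//].
by rewrite mulf_eq0 signr_eq0/= invr_eq0 gt_eqF.
Qed.

(** The bending density becomes a constant times [(cos + fig_height) v]. The cosine part integrates
    to zero because the leaf closes, and the rest is a multiple of the length. *)
Lemma half_fold_bending : bending p a b g = l `^ (- p) * fig_rate p * (fig_height p * (l * (2 * K))).
Proof.
rewrite (tangent_lift_bending T).
have lp : 0 < l `^ (- p) by exact: powR_gt0.
have vi := continuous_itv_integrable (tl_speed T).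
have vci := continuous_itv_integrable (within_continuous_mul (tl_speed T) fa_cont).
transitivity (\int[mu]_(t in `[a, b]) (l `^ (- p) * fig_rate p * (v t * cos (fig_angle p (phi t)) + fig_height p * v t))); last first.
  rewrite Rintegral_itvZ; last by apply: integrableDR => //; exact: integrableZR.
  rewrite Rintegral_itvD//; last exact: integrableZR.
  by rewrite Rintegral_itvZ// cos_integral add0r half_fold_length.
have zc : mu.-integrable `[a, b] (EFin \o (fun t => l `^ (- p) * fig_rate p * (v t * cos (fig_angle p (phi t)) + fig_height p * v t))).
  by apply: integrableZR; apply: integrableDR => //; exact: integrableZR.
rewrite -[LHS]Rintegral_oo_cc; last exact: integrable_measurable_oo (tl_integrable T).
rewrite -[RHS]Rintegral_oo_cc; last exact: integrable_measurable_oo zc.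
rewrite /Rintegral; congr fine.
have zE t : v t * cos (fig_angle p (phi t)) + fig_height p * v t =
    v t * (cos (fig_angle p (phi t)) + fig_height p) by ring.
have z0 t : 0 <= cos (fig_angle p (phi t)) + fig_height p.
  by rewrite fig_zone// mulr_ge0 ?sqr_ge0// mulr_ge0 ?sqr_ge0.
have rate0 := fig_rate_gt0 p1.
apply: ge0_ae_eq_integral_nonmeasurable.
- by move=> t _; rewrite lee_fin mulr_ge0 ?powR_ge0.
- move=> t ti; rewrite lee_fin zE mulr_ge0//; first by rewrite mulr_ge0 ?(ltW lp)// ltW.
  by rewrite mulr_ge0 ?z0// ltW// (tl_speed_gt0 T)// ooW.
apply: (@filterS _ _ (ae_filter_ringOfSetsType mu) _ _ _ half_fold_curvature) => t kE ti.
congr (_%:E); rewrite kE// zE; set z := _ + _.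
have z0' : 0 <= z by exact: z0.
have vt : 0 < v t by rewrite (tl_speed_gt0 T)// ooW.
rewrite powRM ?powR_ge0//; last by rewrite divr_ge0// ltW.
rewrite -powRrM mulVf ?gt_eqF// powRr1; last by rewrite mulr_ge0// ltW.
rewrite powRM ?(ltW vt)//; last by rewrite invr_ge0 ltW.
rewrite -powR_inv1 ?(ltW l0)// -powRrM mulN1r.
have E : v t `^ p * v t `^ (1 - p) = v t.
  rewrite -powRD ?(gt_eqF vt) ?implybT// -[RHS]powRr1 ?(ltW vt)//.
  by congr powR; ring.
by rewrite -[in RHS]E; ring.
Qed.

End HalfFold.

(** Scale invariance: the powers [l^(p-1)], [l^(-p)] and [l] cancel. *)
Lemma half_fold_energy p (a b : R) g v th k : 1 < p -> a < b -> tangent_lift p a b g v th k ->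
  half_fold_figure_eight p a b g ->
  nbending p a b g = fig_rate p * fig_height p * (2 * K1c p (qstar p)) `^ p.
Proof.
move=> p1 ab T [l [th0 [sg [c [phi [l0 rphi gE]]]]]].
have K0 : 0 < 2 * K1c p (qstar p) by rewrite mulr_gt0// K1c_gt0.
have [e [phim phia phib]] := reparam_ends (ltW ab) (ltW K0) rphi.
rewrite /nbending (tangent_lift_length T) (half_fold_length p1 ab T l0 rphi gE phim phia phib).
rewrite (half_fold_bending p1 ab T l0 rphi gE phim phia phib).
set K := 2 * _ in K0 *.
rewrite powRM ?ltW//.
have -> : K `^ p = K `^ (p - 1) * K.
  by rewrite -{3}(@powRr1 _ K) ?(ltW K0)// -powRD ?(gt_eqF K0) ?implybT//; congr powR; ring.
have E : l `^ (p - 1) * l `^ (- p) * l = 1.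
  rewrite -{3}(@powRr1 _ l) ?(ltW l0)// -!powRD ?(gt_eqF l0) ?implybT//.
  by rewrite (_ : _ + _ = 0) ?powRr0//; ring.
transitivity (l `^ (p - 1) * l `^ (- p) * l * (fig_rate p * fig_height p * (K `^ (p - 1) * K))).
  by ring.
by rewrite E mul1r.
Qed.

Lemma leaf_energy_qstar p : 1 < p ->
  leaf_energy p (qstar p) = fig_rate p * fig_height p * (2 * K1c p (qstar p)) `^ p.
Proof.
move=> p1; have A0 := fig_height_gt0 p1; have r0 := fig_rate_gt0 p1.
have K0 : 0 < 2 * K1c p (qstar p) by rewrite mulr_gt0// K1c_gt0.
have p0 : 0 < p by exact: lt_trans ltr01 p1.
rewrite /leaf_energy half_wellE// -/(fig_height p).
move: (fig_height p) (fig_rate p) (2 * K1c p (qstar p)) A0 r0 K0 => A r K A0 r0 K0.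
have [A0' r0' K0'] := And3 (ltW A0) (ltW r0) (ltW K0).
rewrite powRM ?powR_ge0 ?mulr_ge0 ?powR_ge0// powRM ?mulr_ge0 ?powR_ge0// (powRM _ A0' K0').
rewrite -(powRrM A) -(powRrM r) mulVf ?gt_eqF// (powRr1 r0').
have E : A `^ (- (1 - 1 / p) * p) * A `^ p = A.
  rewrite -powRD ?(gt_eqF A0) ?implybT// -[RHS]powRr1//; congr powR.
  by field; rewrite gt_eqF.
by rewrite -[in RHS]E; ring.
Qed.

Lemma figure_eight_tangent_lift p : 1 < p ->
  tangent_lift p 0 (2 * K1c p (qstar p)) (figure_eight p) (fun=> 1) (fig_angle p)
    (fun s => (fig_rate p * (cos (fig_angle p s) + fig_height p)) `^ p^-1).
Proof.
move=> p1; have p0 : 0 < p by exact: lt_trans ltr01 p1.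
have K0 : 0 < 2 * K1c p (qstar p) by rewrite mulr_gt0// K1c_gt0.
set T := 2 * _ in K0 *; set k := (fun s => (_ * _) `^ _).
have kE s : k s = `|fig_rate p * (cos (fig_angle p s) + fig_height p)| `^ p^-1.
  suff z0 : 0 <= fig_rate p * (cos (fig_angle p s) + fig_height p) by rewrite ger0_norm.
  apply: mulr_ge0; first exact: ltW (fig_rate_gt0 p1).
  by rewrite fig_zone// mulr_ge0 ?sqr_ge0// mulr_ge0 ?sqr_ge0.
have cpow r : 0 < r -> continuous (fun x : R => `|x| `^ r) by exact: continuous_normr_powR.
have ck : {within `[0, T], continuous k}.
  apply: (@subspace_eq_continuous _ _ _ (fun s => `|fig_rate p * (cos (fig_angle p s) + fig_height p)| `^ p^-1)).
    by move=> t _; rewrite -kE.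
  apply: (@within_continuous_comp _ _ _ _ (fig_angle p) (fun y => `|fig_rate p * (cos y + fig_height p)| `^ p^-1)).
    move=> y _; apply: (@continuous_comp _ _ _ (fun y => fig_rate p * (cos y + fig_height p)) (fun x => `|x| `^ p^-1)).
      apply: continuousM; first exact: cvg_cst.
      by apply: continuousD; [exact: continuous_cos|exact: cvg_cst].
    by apply: cpow; rewrite invr_gt0.
  exact: continuous_fig_angle.
split.
- exact: continuous_fig_x.
- exact: continuous_fig_y.
- by apply: continuous_subspaceT => x; exact: cvg_cst.
- by move=> t _.
- apply: AC_of_derive (ltW K0) (continuous_fig_angle p1) ck _ => t ti.
  exact: is_derive_fig_angle.
- by move=> t ti; rewrite mul1r; exact: is_derive_fig_x.
- by move=> t ti; rewrite mul1r; exact: is_derive_fig_y.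
- apply: continuous_itv_integrable.
  apply: (@subspace_eq_continuous _ _ _ (fun s => `|k s| `^ p)).
    by move=> t _; change (`|k t| `^ p = `|k t| `^ p * 1 `^ (1 - p)); rewrite powR1 mulr1.
  apply: (@within_continuous_comp _ _ _ _ k (fun y => `|y| `^ p)) => //.
  by move=> y _; exact: cpow.
apply: aeW => t ti.
have near_ab : \forall y \near t, y \in `]0, T[ by exact: near_in_itvoo.
have dE1 y : y \in `]0, T[ -> (crd1 (figure_eight p))^`()%classic y = cos (fig_angle p y).
  by move=> yi; exact: is_derive_derive1 (is_derive_fig_x p1 yi).
have dE2 y : y \in `]0, T[ -> (crd2 (figure_eight p))^`()%classic y = sin (fig_angle p y).
  by move=> yi; exact: is_derive_derive1 (is_derive_fig_y p1 yi).
have c1 : ((crd1 (figure_eight p))^`()^`())%classic t = - sin (fig_angle p t) * k t.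
  apply: is_derive_derive1.
  apply: is_derive_near (@is_derive_chain R (@cos R) (fig_angle p) t _ _ (is_derive_cosR _) (is_derive_fig_angle p1 ti)).
  by apply: filterS near_ab => y yab; rewrite dE1.
have c2 : ((crd2 (figure_eight p))^`()^`())%classic t = cos (fig_angle p t) * k t.
  apply: is_derive_derive1.
  apply: is_derive_near (@is_derive_chain R (@sin R) (fig_angle p) t _ _ (is_derive_sinR _) (is_derive_fig_angle p1 ti)).
  by apply: filterS near_ab => y yab; rewrite dE2.
rewrite (curvature_tangent_lift (dE1 t ti) (dE2 t ti) c1 c2) cos2Dsin2 sqrtr1 expr1n !divr1.
transitivity ((cos (fig_angle p t) ^+ 2 + sin (fig_angle p t) ^+ 2) * k t); first by ring.
by rewrite cos2Dsin2 mul1r.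
Qed.

(** The model curve is a half-fold figure-eight through the trivial similarity, so the bound of the
    loop inequality is its energy. *)
Lemma varpiE p : 1 < p -> varpi p = leaf_energy p (qstar p).
Proof.
move=> p1; rewrite leaf_energy_qstar//.
have K0 : 0 < 2 * K1c p (qstar p) by rewrite mulr_gt0// K1c_gt0.
apply: (half_fold_energy p1 K0 (figure_eight_tangent_lift p1)).
exists 1, 0, false, (0, 0), id; split=> //.
  by apply: reparam_increasing => //; [exact: ltW K0|by apply: continuous_subspaceT => x; exact: cvg_id].
move=> t _; rewrite /similarity expr0 cos0 sin0 /= !mul0r !mul1r !add0r subr0.
by rewrite [LHS]surjective_pairing.
Qed.

End LeafEnergy.

Import HBNNSimple.

(** * Translation of the parameter *)

Section Shift.
Context {R : realType}.
Implicit Types (a b c x y : R).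
Local Notation mu := (@lebesgue_measure R).

Lemma shift_preimage_itv c (b0 b1 : bool) a b :
  (fun x : R => x + c) @^-1` [set` Interval (BSide b0 a) (BSide b1 b)] =
  [set` Interval (BSide b0 (a - c)) (BSide b1 (b - c))].
Proof.
apply/seteqP; split=> x /=; rewrite !itv_boundlr /= ?lteBSide;
  case: b0 b1 => [] [] /=; rewrite ?lerBlDr ?ltrBlDr ?lerBrDr ?ltrBrDr //.
Qed.

Lemma measurable_shift c : measurable_fun setT (fun x : R => x + c).
Proof. by apply: measurable_funD => //; exact: measurable_cst. Qed.

Lemma lebesgue_measure_shift c (A : set R) : measurable A ->
  mu ((fun x => x + c) @^-1` A) = mu A.
Proof.
move=> mA; have ms := measurable_shift c.
rewrite -[LHS]/(pushforward mu ((fun x => x + c) : _ -> measurableTypeR R) A).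
apply/esym/lebesgue_measure_unique => //= _ [[x y]] _ <-.
rewrite /pushforward /= shift_preimage_itv !lebesgue_measure_itv/=.
by rewrite !lte_fin ltrD2r -!EFinB; case: ifP => // _; congr (_%:E); ring.
Qed.

Lemma sintegral_shift c (h : {nnsfun (measurableTypeR R) >-> R}) :
  exists h' : {nnsfun (measurableTypeR R) >-> R},
    (forall x, h' x = h (x + c)) /\ sintegral mu h' = sintegral mu h.
Proof.
have mh0 : measurable_fun setT (h : measurableTypeR R -> R) by [].
have mh : measurable_fun setT ((fun x => h (x + c)) : measurableTypeR R -> R).
  by apply: (@measurableT_comp _ _ _ _ _ _ h) => //; exact: measurable_shift.
have fh : finite_set (range (fun x => h (x + c))).
  apply: sub_finite_set (fimfunP h) => _ [x _ <-]; by exists (x + c).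
have h0 x : 0 <= h (x + c) by [].
pose h' : {nnsfun (measurableTypeR R) >-> R} := HB.pack (fun x => h (x + c))
  (@isMeasurableFun.Build _ _ (measurableTypeR R) _ (fun x => h (x + c)) mh)
  (FiniteImage.Build _ _ (fun x => h (x + c)) fh) (isNonNegFun.Build _ _ (fun x => h (x + c)) h0).
exists h'; split=> //.
rewrite /sintegral; apply: eq_fsbigr => x _; congr (_ * _)%E.
by rewrite -[RHS](lebesgue_measure_shift c)// -[X in measurable X]setTI; exact: mh0.
Qed.

(** Stated for arbitrary [f], because it is applied to pointwise speeds and curvatures. The
    integrals of the positive and negative parts are suprema over simple functions, which are
    translated. *)
Lemma integral_shift c (D : set R) (f : R -> \bar R) :
  (\int[mu]_(x in (fun x => x + c)%R @^-1` D) f (x + c)%R = \int[mu]_(x in D) f x)%E.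
Proof.
have le d (f1 f2 : R -> \bar R) : (forall x, f2 (x + d)%R = f1 x) ->
    (ereal_sup [set sintegral mu h | h in [set h : {nnsfun (measurableTypeR R) >-> R} | forall x, ((h x)%:E <= f2 x)%E]] <=
     ereal_sup [set sintegral mu h | h in [set h : {nnsfun (measurableTypeR R) >-> R} | forall x, ((h x)%:E <= f1 x)%E]])%E.
  move=> f12; apply: ub_ereal_sup => _ [h /= hf <-].
  have [h' [h'E <-]] := sintegral_shift d h.
  by apply: ereal_sup_ubound; exists h' => // x; rewrite /= h'E -f12.
have eq d (f1 f2 : R -> \bar R) : (forall x, f2 (x + d)%R = f1 x) ->
    ereal_sup [set sintegral mu h | h in [set h : {nnsfun (measurableTypeR R) >-> R} | forall x, ((h x)%:E <= f2 x)%E]] =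
    ereal_sup [set sintegral mu h | h in [set h : {nnsfun (measurableTypeR R) >-> R} | forall x, ((h x)%:E <= f1 x)%E]].
  move=> f12; apply/eqP; rewrite eq_le (le d)// (le (- d)) // => x.
  by rewrite -f12 subrK.
rewrite /integral; congr (_ - _)%E; apply/esym; apply: (eq c) => x.
- by rewrite !funeposE !patchE.
- by rewrite !funenegE !patchE.
Qed.

Lemma integral_shift_itv c a b (f : R -> \bar R) (b0 b1 : bool) :
  (\int[mu]_(x in [set` Interval (BSide b0 a) (BSide b1 b)]) f (x + c)%R =
   \int[mu]_(x in [set` Interval (BSide b0 (a + c)%R) (BSide b1 (b + c)%R)]) f x)%E.
Proof.
by rewrite -[RHS](integral_shift c) shift_preimage_itv !addrK.
Qed.

Lemma Rintegral_shift c a b (f : R -> R) (b0 b1 : bool) :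
  \int[mu]_(x in [set` Interval (BSide b0 a) (BSide b1 b)]) f (x + c) =
  \int[mu]_(x in [set` Interval (BSide b0 (a + c)) (BSide b1 (b + c))]) f x.
Proof. by rewrite /Rintegral (integral_shift_itv c a b (fun x => (f x)%:E)). Qed.

Lemma is_derive_shift c (f : R -> R) x l : is_derive (x + c) 1 f l ->
  is_derive x 1 (fun y => f (y + c)) l.
Proof.
move=> D; have := @is_derive_chain R f (fun y => y + c) x _ _ D (is_derive_add (is_derive_idfun x) (is_derive_const c x)).
by rewrite addr0 mulr1.
Qed.

Lemma within_continuous_shift c a b (f : R -> R) : {within `[a + c, b + c], continuous f} ->
  {within `[a, b], continuous (fun x => f (x + c))}.
Proof.
move=> cf; apply: within_continuous_comp_itv cf _.
  by apply: continuous_subspaceT => x; apply: cvgD; [exact: cvg_id|exact: cvg_cst].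
by move=> t; rewrite !in_itv/= !lerD2r.
Qed.

Lemma derive1_shift c (f : R -> R) x : (fun y => f (y + c))^`()%classic x = f^`()%classic (x + c).
Proof.
rewrite /derive1; congr (lim _); apply/funext => A /=.
rewrite /nbhs/=; congr (nbhs _ _); apply/funext => h /=.
by rewrite addrA.
Qed.

End Shift.

(** * Translating, cutting and closing up curves *)

Section ShiftCurve.
Context {R : realType}.
Implicit Types (p a b c x y : R) (g : R -> R * R).
Local Notation mu := (@lebesgue_measure R).

Lemma Lp_on_shift p a b c (u : R -> R) : Lp_on p (a + c) (b + c) u ->
  Lp_on p a b (fun x => u (x + c)).
Proof.
move=> [mu_ ui]; split.
  apply: (measurable_comp _ _ mu_) => //.
    by move=> _ [x /= + <-]; rewrite !in_itv/= !ltrD2r.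
  exact: measurable_funTS (measurable_shift c).
by rewrite (integral_shift_itv c a b (fun x => (`|u x| `^ p)%:E)).
Qed.

Lemma weak_derivative_shift a b c (u v : R -> R) : weak_derivative (a + c) (b + c) u v ->
  weak_derivative a b (fun x => u (x + c)) (fun x => v (x + c)).
Proof.
move=> W phi [dphi cphi [s [t [as_ tb phi0]]]].
have dE x : (fun y => phi (y - c))^`()%classic x = phi^`()%classic (x - c) by exact: derive1_shift.
have dF : (fun y => phi (y - c))^`()%classic = (fun y => phi^`()%classic (y - c)).
  by apply/funext => y; exact: dE.
have tphi : test_fun (a + c) (b + c) (fun y => phi (y - c)).
  split.
  - move=> x; have D : is_derive (x - c) 1 phi (phi^`()%classic (x - c)).
      by rewrite derive1E; exact: derivableP.
    by have [] := is_derive_shift D.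
  - rewrite dF => x.
    apply: (@continuous_comp _ _ _ (fun y => y - c) phi^`()%classic); last exact: cphi.
    by apply: cvgB; [exact: cvg_id|exact: cvg_cst].
  - exists (s + c), (t + c); rewrite !ltrD2r; split=> // x xst; apply: phi0.
    by move: xst; rewrite !in_itv/= lerBrDr lerBlDr.
transitivity (\int[mu]_(x in `]a + c, b + c[) (u x * (fun y => phi (y - c))^`()%classic x)).
  rewrite -(Rintegral_shift c a b _ false true); apply: eq_Rintegral => x _.
  by rewrite dE addrK.
rewrite (W _ tphi) -(Rintegral_shift c a b _ false true); congr (- _).
by apply: eq_Rintegral => x _; rewrite addrK.
Qed.

Lemma W2p_shift p a b c (u : R -> R) : W2p p (a + c) (b + c) u -> W2p p a b (fun x => u (x + c)).
Proof.
move=> [v [w [Lu Lv Lw uv vw]]]; exists (fun x => v (x + c)), (fun x => w (x + c)).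
by split; [exact: Lp_on_shift|exact: Lp_on_shift|exact: Lp_on_shift|exact: weak_derivative_shift|exact: weak_derivative_shift].
Qed.

Lemma W2p_imm_shift p a b c g : W2p_imm p (a + c) (b + c) g -> W2p_imm p a b (fun x => g (x + c)).
Proof.
move=> [c1 c2 W1 W2 [v1 [v2 [cv1 cv2 d1 d2 v0]]]]; split.
- exact: within_continuous_shift c1.
- exact: within_continuous_shift c2.
- exact: W2p_shift W1.
- exact: W2p_shift W2.
exists (fun x => v1 (x + c)), (fun x => v2 (x + c)); split.
- exact: within_continuous_shift cv1.
- exact: within_continuous_shift cv2.
- move=> t tab; apply: (is_derive_shift (f := crd1 g)); apply: d1.
  by move: tab; rewrite !in_itv/= !ltrD2r.
- move=> t tab; apply: (is_derive_shift (f := crd2 g)); apply: d2.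
  by move: tab; rewrite !in_itv/= !ltrD2r.
- by move=> t tab; apply: v0; move: tab; rewrite !in_itv/= !lerD2r.
Qed.

Lemma W2p_imm_T1_shift p c g : W2p_imm_T1 p g -> W2p_imm_T1 p (fun x => g (x + c)).
Proof.
move=> [per W]; split; first by move=> t; rewrite addrAC per.
by move=> a b ab; apply: W2p_imm_shift; apply: W; rewrite ltrD2r.
Qed.

Lemma speed_shift c g t : speed (fun x => g (x + c)) t = speed g (t + c).
Proof.
rewrite /speed -(derive1_shift c (crd1 g)) -(derive1_shift c (crd2 g)).
by [].
Qed.

Lemma curvature_shift c g t : curvature (fun x => g (x + c)) t = curvature g (t + c).
Proof.
have d1 (f : R -> R) : (fun y => f (y + c))^`()%classic = (fun y => f^`()%classic (y + c)).
  by apply/funext => y; exact: derive1_shift.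
by rewrite /curvature speed_shift -[crd1 _]/(fun y => crd1 g (y + c)) -[crd2 _]/(fun y => crd2 g (y + c)) !d1.
Qed.

Lemma curve_length_shift a b c g : curve_length a b (fun x => g (x + c)) = curve_length (a + c) (b + c) g.
Proof.
rewrite /curve_length -(Rintegral_shift c a b _ false true).
by apply: eq_Rintegral => t _; rewrite speed_shift.
Qed.

Lemma bending_shift p a b c g : bending p a b (fun x => g (x + c)) = bending p (a + c) (b + c) g.
Proof.
rewrite /bending -(Rintegral_shift c a b _ false true).
by apply: eq_Rintegral => t _; rewrite speed_shift curvature_shift.
Qed.

Lemma half_fold_shift p a b c g : half_fold_figure_eight p (a + c) (b + c) g ->
  half_fold_figure_eight p a b (fun x => g (x + c)).
Proof.
move=> [l [th [sg [z [phi [l0 [cphi [phiT injphi surj]] gE]]]]]].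
exists l, th, sg, z, (fun x => phi (x + c)); split=> //; last first.
  by move=> t tab; apply: gE; move: tab; rewrite !in_itv/= !lerD2r.
split; first exact: within_continuous_shift.
have sh t : t \in `[a, b] -> t + c \in `[a + c, b + c] by rewrite !in_itv/= !lerD2r.
split.
- by move=> t /= /sh tab; exact: phiT.
- move=> s t; rewrite !inE /= => /sh sab /sh tab E.
  by apply: (addIr c); apply: injphi; rewrite ?inE.
- move=> y /surj[t /= tab <-]; exists (t - c); last by rewrite subrK.
  by move: tab; rewrite /= !in_itv/= lerBrDr lerBlDr.
Qed.

Lemma curve_cat p a b c g : 1 < p -> a < c -> c < b -> W2p_imm p a b g ->
  curve_length a b g = curve_length a c g + curve_length c b g /\
  bending p a b g = bending p a c g + bending p c b g.
Proof.
move=> p1 ac cb W; have ab := lt_trans ac cb.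
have [v [th [k T]]] := W2p_imm_tangent_lift p1 ab W.
have T1 := tangent_lift_sub T (lexx a) ac (ltW cb).
have T2 := tangent_lift_sub T (ltW ac) cb (lexx b).
rewrite !(tangent_lift_length T, tangent_lift_length T1, tangent_lift_length T2).
rewrite !(tangent_lift_bending T, tangent_lift_bending T1, tangent_lift_bending T2).
split; apply: Rintegral_itv_cat; rewrite ?(ltW ac) ?(ltW cb)//.
  exact: continuous_itv_integrable (tl_speed T).
exact: tl_integrable T.
Qed.

(** The interval from [a] to [b + 1] is cut once at [a + 1] and once at [b]; the pieces over
    [[a, b]] and [[a + 1, b + 1]] agree by periodicity. *)
Lemma curve_period p a b g : 1 < p -> W2p_imm_T1 p g ->
  curve_length a (a + 1) g = curve_length b (b + 1) g /\
  bending p a (a + 1) g = bending p b (b + 1) g.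
Proof.
move=> p1 W.
wlog ab : a b / a < b.
  move=> H; have [ab|ba|->//] := ltgtP a b; first exact: H.
  by have [-> ->] := H _ _ ba.
have pE : (fun x => g (x + 1)) = g by apply/funext => x; rewrite W.1.
have le1 x : x < x + 1 by rewrite ltrDl.
have ab1 : a + 1 < b + 1 by rewrite ltrD2r.
have [l1 b1] := curve_cat p1 (le1 a) ab1 (W.2 _ _ (lt_trans ab (le1 b))).
have [l2 b2] := curve_cat p1 ab (le1 b) (W.2 _ _ (lt_trans ab (le1 b))).
have := curve_length_shift a b 1 g; have := bending_shift p a b 1 g; rewrite pE => bE lE.
by split; [move: l2; rewrite l1 lE|move: b2; rewrite b1 bE] => /eqP; rewrite addrC (inj_eq (addrI _)) => /eqP.
Qed.

Lemma nbending_shift p c g : 1 < p -> W2p_imm_T1 p g ->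
  nbending p 0 1 (fun x => g (x + c)) = nbending p 0 1 g.
Proof.
move=> p1 W; rewrite /nbending curve_length_shift bending_shift add0r [1 + c]addrC.
by have [-> ->] := curve_period c 0 p1 W; rewrite add0r.
Qed.

Lemma curve_partition p (n : nat) (s : nat -> R) g : 1 < p -> (0 < n)%N ->
  (forall i, (i < n)%N -> s i < s i.+1) -> (forall a b, a < b -> W2p_imm p a b g) ->
  curve_length (s 0%N) (s n) g = \sum_(i < n) curve_length (s i) (s i.+1) g /\
  bending p (s 0%N) (s n) g = \sum_(i < n) bending p (s i) (s i.+1) g.
Proof.
move=> p1; case: n => // n _; elim: n => [|n IH] sm W.
  by rewrite !big_ord_recl !big_ord0 /= !addr0.
have sm' i : (i < n.+1)%N -> s i < s i.+1 by move=> h; apply: sm; rewrite ltnS ltnW.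
have [lE bE] := IH sm' W.
have s0n : s 0%N < s n.+1.
  elim: {IH lE bE} n sm sm' => [|n IH] sm sm'; first exact: sm'.
  apply: lt_trans (sm' _ _) => //; apply: IH => i h; apply: sm'; first by [].
  by rewrite ltnS ltnW.
rewrite big_ord_recr [X in _ /\ _ = X]big_ord_recr /= -lE -bE; apply: curve_cat => //; first exact: sm.
by apply: W; apply: lt_trans s0n _; exact: sm.
Qed.

End ShiftCurve.

(** * Curves with a multiple point *)

Section MultiplePoint.
Context {R : realType}.
Implicit Types (p a b c x y : R) (g : R -> R * R).
Local Notation mu := (@lebesgue_measure R).

Lemma leaf_energy_gt0 p : 1 < p -> 0 < leaf_energy p (qstar p).
Proof.
move=> p1; rewrite leaf_energy_qstar//; apply: mulr_gt0.
  by apply: mulr_gt0; [exact: fig_rate_gt0|exact: fig_height_gt0].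
by apply: powR_gt0; apply: mulr_gt0 => //; exact: K1c_gt0.
Qed.

Lemma curve_length_gt0 p a b g : 1 < p -> a < b -> W2p_imm p a b g -> 0 < curve_length a b g.
Proof.
move=> p1 ab W; have [v [th [k T]]] := W2p_imm_tangent_lift p1 ab W.
rewrite (tangent_lift_length T).
have aab : a \in `[a, b] by rewrite in_itv/= lexx ltW.
apply: (Rintegral_gt0 ab (tl_speed T) _ aab) => [x xab|]; first exact: ltW (tl_speed_gt0 T xab).
exact: tl_speed_gt0 T _ aab.
Qed.

Lemma rescaled_rate p r x (l : R) : 0 < p -> 0 < r -> 0 <= x -> 0 < l ->
  ((r `^ p^-1 / l) `^ p * x) `^ p^-1 = l^-1 * (r * x) `^ p^-1.
Proof.
move=> p0 r0 x0 l0; have rl0 : 0 <= r `^ p^-1 / l by rewrite divr_ge0 ?powR_ge0// ltW.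
rewrite (powRM _ (powR_ge0 _ _) x0) (powRM _ (ltW r0) x0).
rewrite -powRrM mulfV ?gt_eqF// powRr1//; ring.
Qed.

(** Coincidence of the end points says that the integrals of [v cos th] and [v sin th] vanish, the
    hypotheses of [loop_inequality]. *)
Lemma loop_energy p a b g : 1 < p -> a < b -> W2p_imm p a b g -> g a = g b ->
  leaf_energy p (qstar p) <= nbending p a b g /\
  (nbending p a b g = leaf_energy p (qstar p) -> half_fold_figure_eight p a b g).
Proof.
move=> p1 ab W gab; have [v [th [k T]]] := W2p_imm_tangent_lift p1 ab W.
have p0 : 0 < p by exact: lt_trans ltr01 p1.
have cth := AC_continuous (ltW ab) (tl_angle T).
have ccos : {within `[a, b], continuous (fun t => v t * cos (th t))}.
  apply: within_continuous_mul (tl_speed T) _.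
  by apply: within_continuous_comp => // x _; exact: continuous_cos.
have csin : {within `[a, b], continuous (fun t => v t * sin (th t))}.
  apply: within_continuous_mul (tl_speed T) _.
  by apply: within_continuous_comp => // x _; exact: continuous_sin.
have I1 : \int[mu]_(t in `[a, b]) (v t * cos (th t)) = 0.
  rewrite -(AC_sub (AC_of_derive (ltW ab) (tl_cont1 T) ccos (tl_derive1 T)) (lexx a) (ltW ab) (lexx b)).
  by rewrite /crd1 gab subrr.
have I2 : \int[mu]_(t in `[a, b]) (v t * sin (th t)) = 0.
  rewrite -(AC_sub (AC_of_derive (ltW ab) (tl_cont2 T) csin (tl_derive2 T)) (lexx a) (ltW ab) (lexx b)).
  by rewrite /crd2 gab subrr.
have [LE EQ] := loop_inequality p1 ab (tl_speed T) (tl_speed_gt0 T) (tl_angle T) (tl_integrable T) I1 I2.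
rewrite /nbending (tangent_lift_length T) (tangent_lift_bending T); split=> // /EQ.
have l0 : 0 < \int[mu]_(t in `[a, b]) v t by rewrite -(tangent_lift_length T); exact: curve_length_gt0 W.
move: l0; set l := \int[mu]_(t in _) v t => l0 [e [m [eta [thE Aeta etaB eta_end]]]].
have K0 := K1c_gt0 p1; set K := K1c _ _ in K0.
have A0 := fig_height_gt0 p1; have r0 := fig_rate_gt0 p1.
pose lam := l / (2 * K).
have lam0 : 0 < lam by rewrite divr_gt0// mulr_gt0.
have vlam : l = lam * (2 * K) by rewrite divfK// gt_eqF// mulr_gt0.
have Aeta' : AC a b eta (fun t => v t / lam * (fig_rate p * (cos (eta t) + fig_height p)) `^ p^-1).
  apply: eq_AC Aeta => // t tab; have z0 := fig_zone_ge0 p1 (etaB t tab).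
  rewrite -/(fig_height p) half_wellE// -/K.
  (* By [half_wellE] the p-th root of the optimal multiplier is the one of the model divided by
     [lam]. The scaled length [2 * K] of the loop is therefore exactly the time in which the model
     crosses its range of angles. *)
  have -> : fig_rate p `^ p^-1 * (fig_height p * (2 * K)) / (fig_height p * l) = fig_rate p `^ p^-1 / lam.
    by rewrite vlam; field; rewrite !gt_eqF.
  by rewrite rescaled_rate// mulrA.
apply: (leaf_half_fold p1 ab (tl_speed T) (tl_speed_gt0 T) lam0 vlam Aeta' etaB eta_end (th0 := m) (e := e)).
- exact: tl_cont1 T.
- exact: tl_cont2 T.
- move=> t tab; rewrite -thE; last by move: tab; rewrite !in_itv/= => /andP[/ltW -> /ltW ->].
  exact: tl_derive1 T _ tab.
- move=> t tab; rewrite -thE; last by move: tab; rewrite !in_itv/= => /andP[/ltW -> /ltW ->].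
  exact: tl_derive2 T _ tab.
Qed.

Lemma powR_cancel p x : 0 < x -> x `^ (p - 1) * x `^ (1 - p) = 1.
Proof.
by move=> x0; rewrite -powRD ?(gt_eqF x0) ?implybT// (_ : _ + _ = 0) ?powRr0//; ring.
Qed.

Lemma solve_powR p x y (z : R) : 0 < x -> x `^ (p - 1) * y = z -> y = z * x `^ (1 - p).
Proof. by move=> x0 <-; rewrite mulrAC powR_cancel// mul1r. Qed.

Lemma equal_leaves_energy p x y (l : R) : 0 < l -> 0 < x ->
  (x * l) `^ (p - 1) * (x * (y * l `^ (1 - p))) = y * x `^ p.
Proof.
move=> l0 x0; rewrite powRM ?ltW//.
rewrite (_ : _ * _ = y * (x `^ (p - 1) * x) * (l `^ (p - 1) * l `^ (1 - p))); last by ring.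
rewrite powR_cancel// mulr1 -{2}(powRr1 (ltW x0)) -powRD ?(gt_eqF x0) ?implybT//.
by congr (_ * _ `^ _); ring.
Qed.

(* Jensen's inequality for [x `^ (1 - p)], written with the tangent line at the
   mean so that the equality case is termwise. *)
Lemma sum_leaf_energy (n : nat) (l b : 'I_n -> R) p Om : 1 < p -> 0 < Om -> (0 < n)%N ->
  (forall i, 0 < l i) -> (forall i, Om <= l i `^ (p - 1) * b i) ->
  let L := \sum_i l i in let B := \sum_i b i in
  Om * n%:R `^ p <= L `^ (p - 1) * B /\
  (L `^ (p - 1) * B = Om * n%:R `^ p ->
   forall i, l i = L / n%:R /\ l i `^ (p - 1) * b i = Om).
Proof.
move=> p1 Om0 n0 l0 lb L B.
have nR : 0 < n%:R :> R by rewrite ltr0n.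
have L0 : 0 < L.
  rewrite lt_def sumr_ge0 ?andbT; last by move=> i _; exact: ltW.
  apply/eqP => /eqP; rewrite psumr_eq0; last by move=> i _; exact: ltW.
  by move=> /allP/(_ (Ordinal n0) (mem_index_enum _)); rewrite /= (gt_eqF (l0 _)).
pose y := L / n%:R; have y0 : 0 < y by rewrite divr_gt0.
(* The deficit of [b i] from [Om] times the tangent line of [x^(1-p)] at the mean length [y]. The
   lengths add up to [n y], so the tangent lines add up to [n y^(1-p)]. *)
pose d i := b i - Om * ((1 - p) * l i * y `^ (- p) + p * y `^ (1 - p)).
have lp i := powR_cancel p (l0 i).
have bE i : Om * l i `^ (1 - p) <= b i.
  apply: le_trans (_ : l i `^ (p - 1) * b i * l i `^ (1 - p) <= _).
    by rewrite ler_wpM2r ?powR_ge0.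
  by rewrite mulrAC lp mul1r.
have Ey : y * y `^ (- p) = y `^ (1 - p).
  by rewrite -{1}(powRr1 (ltW y0)) -powRD ?(gt_eqF y0) ?implybT.
have tl i : (1 - p) * l i * y `^ (- p) + p * y `^ (1 - p) <= l i `^ (1 - p) ?= iff (l i == y).
  have k0 : 0 < (1 - p) * (1 - p - 1) by rewrite (_ : _ * _ = (p - 1) * p); [rewrite mulr_gt0 ?subr_gt0//; lra|ring].
  have := tangent_powR_lt k0 (l0 i) y0.
  have -> : 1 - p - 1 = - p by ring.
  rewrite mulNr opprK; have [ly|ly] := eqVneq (l i) y; last first.
    by move=> /(_ isT) h; split; [exact: ltW|apply/negbTE; rewrite lt_eqF].
  move=> _; rewrite ly.
  have -> : (1 - p) * y * y `^ (- p) + p * y `^ (1 - p) = y `^ (1 - p) by rewrite -Ey; ring.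
  by split; rewrite ?lexx ?eqxx.
have d0 i : 0 <= d i.
  by rewrite subr_ge0; apply: le_trans (bE i); rewrite ler_wpM2l ?(ltW Om0)// tl.
have Sd : \sum_i d i = B - Om * (n%:R * y `^ (1 - p)).
  rewrite sumrB -mulr_sumr big_split /= -mulr_suml -mulr_sumr -/L sumr_const card_ord.
  have E : L * y `^ (- p) = n%:R * y `^ (1 - p).
    by rewrite -Ey mulrA; congr (_ * _); rewrite mulrC divfK// gt_eqF.
  by rewrite -mulrA E -mulr_natl; congr (_ - _ * _); ring.
have Ly : L `^ (p - 1) * (n%:R * y `^ (1 - p)) = n%:R `^ p.
  rewrite /y powRM ?(ltW L0) ?invr_ge0 ?(ltW nR)// -powR_inv1 ?(ltW nR)// -powRrM.
  rewrite (_ : L `^ _ * _ = L `^ (p - 1) * L `^ (1 - p) * (n%:R * n%:R `^ (-1 * (1 - p)))); last by ring.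
  rewrite -powRD ?(gt_eqF L0) ?implybT// (_ : p - 1 + (1 - p) = 0) ?powRr0 ?mul1r; last by ring.
  rewrite -{1}(powRr1 (ltW nR)) -powRD ?(gt_eqF nR) ?implybT//; congr powR; ring.
have BE : L `^ (p - 1) * B = Om * n%:R `^ p + L `^ (p - 1) * \sum_i d i.
  by rewrite Sd -Ly; ring.
have Lp : 0 < L `^ (p - 1) by exact: powR_gt0.
split; first by rewrite BE lerDl mulr_ge0 ?(ltW Lp)// sumr_ge0.
move=> E i; move/eqP: BE; rewrite E -subr_eq0 opprD addNKr oppr_eq0 mulf_eq0 (gt_eqF Lp)/=.
rewrite psumr_eq0// => /allP/(_ i (mem_index_enum _)) /= /eqP di.
have [le iff] := tl i.
have b1 : Om * ((1 - p) * l i * y `^ (- p) + p * y `^ (1 - p)) = b i.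
  by apply/esym/eqP; rewrite -subr_eq0 -/(d i) di.
have ly : l i = y.
  apply/eqP; rewrite -iff eq_le le /= -(ler_pM2l Om0) b1; exact: bE.
split=> //; move: iff; rewrite ly eqxx => /eqP iff.
by rewrite -b1 ly iff mulrCA -ly lp mulr1.
Qed.

(** The [m] parameters in [[0, 1[] are sorted, and the sequence is closed up cyclically by one
    period. *)
Lemma multiplicity_partition g (P : R * R) (m : nat) : (0 < m)%N ->
  (forall t, g (t + 1) = g t) -> has_point_of_multiplicity_T1 g P m ->
  exists s : nat -> R, [/\ s m = s 0%N + 1,
    forall i, (i < m)%N -> s i < s i.+1 & forall i, (i <= m)%N -> g (s i) = P].
Proof.
move=> m0 per [t [tinj t01 tP]].
pose ss := sort <=%R [seq t i | i <- enum 'I_m].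
have sz : size ss = m by rewrite size_sort size_map size_enum_ord.
have us : uniq ss by rewrite sort_uniq map_inj_uniq// enum_uniq.
have os : sorted <%R ss by rewrite lt_sorted_uniq_le us sort_sorted//; exact: le_total.
have ssP i : (i < m)%N -> exists j, nth 0 ss i = t j.
  move=> im; have : nth 0 ss i \in ss by rewrite mem_nth// sz.
  by rewrite mem_sort => /mapP[j _ ->]; exists j.
(* The index [m] stands for the first parameter one period later, so the last arc passes through the
   base point of the circle. *)
exists (fun i => if (i < m)%N then nth 0 ss i else nth 0 ss 0 + 1); split.
- by rewrite ltnn m0.
- move=> i im; rewrite im; case: ifPn => [im'|_].
    by rewrite (sorted_ltn_nth (@lt_trans _ _))// inE sz.
  have [j ->] := ssP i im; have [j0 ->] := ssP _ m0.
  have := t01 j; have := t01 j0; rewrite !in_itv/= => /andP[h1 _] /andP[_ h2].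
  by rewrite (lt_le_trans h2)// lerDr.
- move=> i _; case: ifPn => [im|_]; first by have [j ->] := ssP i im.
  by rewrite per; have [j0 ->] := ssP _ m0.
Qed.

(** A leaf of length [l] has bending [varpi p * l^(1-p)]. The total length is [m l], so the powers
    of [l] cancel and [m^(p-1) m] remains. *)
Lemma leafed_energy p (m : nat) g : 1 < p -> (0 < m)%N -> W2p_imm_T1 p g ->
  leafed p m g -> nbending p 0 1 g = varpi p * m%:R `^ p.
Proof.
move=> p1 m0 W [_ [a [a0 a1 am hf eql]]].
have mR : 0 < m%:R :> R by rewrite ltr0n.
have [lE bE] := curve_partition p1 m0 am W.2; rewrite a0 a1 in lE bE.
pose l := curve_length (a 0%N) (a 1%N) g.
have l0 : 0 < l by apply: curve_length_gt0 p1 _ (W.2 _ _ _); exact: am.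
have E (i : 'I_m) : bending p (a i) (a i.+1) g = varpi p * l `^ (1 - p).
  have [v [th [k T]]] := W2p_imm_tangent_lift p1 (am i (ltn_ord i)) (W.2 _ _ (am i (ltn_ord i))).
  have H : nbending p (a i) (a i.+1) g = varpi p.
    rewrite (varpiE p1) (leaf_energy_qstar p1).
    exact: half_fold_energy p1 (am i (ltn_ord i)) T (hf i (ltn_ord i)).
  have Hl : curve_length (a i) (a i.+1) g = l by exact: eql (ltn_ord i) m0.
  by apply: solve_powR l0 _; rewrite -Hl.
rewrite /nbending lE bE (eq_bigr (fun=> l)); last by move=> i _; exact: eql.
rewrite (eq_bigr _ (fun i _ => E i)) !sumr_const card_ord.
by rewrite -[l *+ m]mulr_natl -[(varpi p * _) *+ m]mulr_natl equal_leaves_energy.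
Qed.

End MultiplePoint.

Theorem theorem1p6 (R : realType) (p : R) (hp : 1 < p)
    (m : nat) (hm : (2 <= m)%N)
    (gamma : R -> R * R) (hgamma : W2p_imm_T1 p gamma)
    (hmult : exists P : R * R, has_point_of_multiplicity_T1 gamma P m) :
  varpi p * m%:R `^ p <= nbending p 0 1 gamma /\
  (nbending p 0 1 gamma = varpi p * m%:R `^ p <-> closed_leafed p m gamma).
Proof.
have m0 : (0 < m)%N by exact: ltnW.
have [P /(multiplicity_partition m0 hgamma.1)[s [sm sl sP]]] := hmult.
have [lE bE] := curve_partition hp m0 sl hgamma.2.
have nE : nbending p 0 1 gamma = nbending p (s 0%N) (s m) gamma.
  rewrite sm /nbending; have [-> ->] := curve_period (s 0%N) 0 hp hgamma.
  by rewrite add0r.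
have loop (i : 'I_m) := loop_energy hp (sl i (ltn_ord i)) (hgamma.2 _ _ (sl i (ltn_ord i)))
  (etrans (sP i (ltnW (ltn_ord i))) (esym (sP i.+1 (ltn_ord i)))).
have l0 (i : 'I_m) := curve_length_gt0 hp (sl i (ltn_ord i)) (hgamma.2 _ _ (sl i (ltn_ord i))).
have [LE EQ] := sum_leaf_energy hp (leaf_energy_gt0 hp) m0 l0 (fun i => (loop i).1).
rewrite -lE -bE -varpiE// in LE EQ.
rewrite nE; split; first exact: LE.
split=> [/EQ H|[_ [t0 leaf]]]; last first.
  (* The converse: the energy does not depend on the starting point, so it is evaluated on the curve
     started at [t0]. *)
  rewrite -nE -(nbending_shift t0 hp hgamma).
  exact: leafed_energy (W2p_imm_T1_shift t0 hgamma) leaf.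
(* The leaves are the arcs between successive parameters of the multiple point, so the curve is
   started at the first of them. *)
split=> //; exists (s 0%N); split.
  by apply: W2p_imm_shift; apply: hgamma.2; rewrite ltrD2r.
exists (fun i => s i - s 0%N); split.
- by rewrite subrr.
- by rewrite sm addrAC subrr add0r.
- by move=> i im; rewrite ltrD2r sl.
- move=> i im; apply: half_fold_shift.
  rewrite (subrK (s 0%N) (s i)) (subrK (s 0%N) (s i.+1)).
  have [_ Ei] := H (Ordinal im).
  apply: (loop (Ordinal im)).2.
  rewrite -(varpiE hp).
  exact: Ei.
- move=> i j im jm; rewrite !curve_length_shift !subrK.
  by rewrite (H (Ordinal im)).1 (H (Ordinal jm)).1.
Qed.
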